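(* Let $\mathbf d\in\mathbb Z_{>0}^n$, let $J$ be a $\mathbf d$-homogeneous ideal in $\mathbb K_{\mathbf d}[x_1,\dots,x_n]$, $A=\mathbb K_{\mathbf d}[x_1,\dots,x_n]/J$, $C$ a maximal cone in $\operatorname{GF}(J)$ with compatible monomial term order $<$, and $\mathbf r$ an $(m\times n)$-matrix whose rows are representatives of the primitive ray generators of $\overline C\subset\mathbb R^n/\mathcal L(J)$. Then: (i) The algebra $\tilde A_{\mathbf r}$ is a free $\mathbb K[t_1,\dots,t_m]$-module with basis $\mathbb B_<$, the standard monomial basis of $A$ with respect to $\operatorname{in}_<(J)$. In particular, we have a flat family $\pi:\operatorname{Proj}(\tilde A_{\mathbf r})\hookrightarrow\mathbb P(\mathbf d)\times\mathbb A^m\twoheadrightarrow\mathbb A^m$. (ii) For every face $\tau$ of $C$ there exists $\mathbf a_\tau\in\mathbb A^m$ such that $\pi^{-1}(\mathbf a_\tau)=\operatorname{Proj}(\mathbb K_{\mathbf d}[x_1,\dots,x_n]/\operatorname{in}_\tau(J))$. In particular, generic fibers are isomorphic to $\operatorname{Proj}(A)$ and there exist special fibers for every proper face $\tau\subset C$.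
   Context: $\mathbb K$ is an algebraically closed field; $\mathbb K_{\mathbf d}[x_1,\dots,x_n]$ is the polynomial ring graded by $\deg x_i=d_i$, and $\mathbb P(\mathbf d)=\operatorname{Proj}\mathbb K_{\mathbf d}[x_1,\dots,x_n]$. For $w\in\mathbb R^n$, $\operatorname{in}_w(f)$ is the sum of terms $c_\alpha\mathbf x^\alpha$ of $f$ with $w\cdot\alpha$ minimal, $\operatorname{in}_w(J)=\langle\operatorname{in}_w(f):f\in J\rangle$; for a monomial term order $<$, $\operatorname{in}_<(f)$ is the $<$-largest term. $\operatorname{GF}(J)$ is the complete fan in $\mathbb R^n$ in which $u,w$ lie in the relative interior of the same cone iff $\operatorname{in}_u(J)=\operatorname{in}_w(J)$; $\operatorname{in}_\tau(J)=\operatorname{in}_w(J)$ for $w$ in the relative interior of $\tau$; maximal cones are $n$-dimensional; $<$ is compatible with $C$ if $\operatorname{in}_<(J)=\operatorname{in}_C(J)$. $\mathcal L(J)=\{u:\operatorname{in}_u(J)=J\}$, $\overline C=C/\mathcal L(J)$. $\mathbb B_<=\{\bar{\mathbf x}^\alpha:\mathbf x^\alpha\notin\operatorname{in}_<(J)\}$; its elements are regarded in $\tilde A_{\mathbf r}$ as classes of the same monomials. Representatives $r_1,\dots,r_m\in C$ are taken integral. For $0\ne f=\sum c_\alpha\mathbf x^\alpha\in J$ let $\mu_{\mathbf r}(f)=(\min_{c_\alpha\ne0}r_i\cdot\alpha)_i$, $\tilde f_{\mathbf r}=\sum c_\alpha\mathbf x^\alpha\mathbf t^{\mathbf r\cdot\alpha-\mu_{\mathbf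 r}(f)}$, $\tilde J_{\mathbf r}=\langle\tilde f_{\mathbf r}:f\in J\rangle$, $\tilde A_{\mathbf r}=\mathbb K[t_1,\dots,t_m][x_1,\dots,x_n]/\tilde J_{\mathbf r}$, graded by $\deg x_i=d_i$, $\deg t_j=0$. *)

(* Defs.v *)
From HB Require Import structures.
From mathcomp Require Import all_boot all_order all_algebra.
From mathcomp Require Import mpoly ring.
From mathcomp Require Import boolp classical_sets reals topology_structure.

Set Implicit Arguments.
Unset Strict Implicit.
Unset Printing Implicit Defensive.

Import Order.TTheory GRing.Theory Num.Theory.
Local Open Scope ring_scope.
Local Open Scope classical_set_scope.
Local Open Scope quotient_scope.

Identity Coercion fun_of_set : set >-> Funclass.

(* ------------------------------------------------------------------------ *)
(** * Ideals and quotient rings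

    Rings are [comPzRingType]s, so that the zero ring (the quotient by the
    unit ideal) is allowed. *)

Definition is_ideal (S : comPzRingType) (I : set S) : Prop :=
  [/\ I 0, (forall a b, I a -> I b -> I (a + b)) & (forall a b, I b -> I (a * b))].

Record ideal (S : comPzRingType) := Ideal {
  ideal_set :> set S;
  idealP : is_ideal ideal_set }.

Lemma ideal_ext (S : comPzRingType) (I I' : ideal S) :
  I = I' :> set S -> I = I'.
Proof. by case: I I' => [A iA] [B iB] /= AB; subst B; congr Ideal; exact: Prop_irrelevance. Qed.

Lemma smallest_ideal_subproof (S : comPzRingType) (F : set S) :
  is_ideal (smallest (@is_ideal S) F).
Proof.
split=> [I [[]] //|a b Ha Hb I [iI FI]|a b Hb I [iI FI]]; case: (iI) => _ ID IM.
- by apply: ID; [apply: Ha|apply: Hb].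
- by apply: IM; apply: Hb.
Qed.

Definition idgen (S : comPzRingType) (F : set S) : ideal S :=
  Ideal (smallest_ideal_subproof F).

Section QuotientRing.
Variables (S : comPzRingType) (I : ideal S).

Definition qequiv : rel S := fun a b => `[< I (a - b) >].

Lemma qequivP : equiv_class_of qequiv.
Proof.
case: (idealP I) => I0 ID IM.
have IN a : I a -> I (- a) by rewrite -mulN1r; exact: IM.
split=> [a|a b|b a c].
- by apply/asboolP; rewrite subrr.
- by apply/asboolP/asboolP => /IN; rewrite opprB.
- move=> /asboolP ab /asboolP bc; apply/asboolP.
  by have := ID _ _ ab bc; rewrite addrA subrK.
Qed.

Canonical qequiv_equiv := EquivRelPack qequivP.
Canonical qequiv_encModRel := defaultEncModRel qequiv.

Definition quot : Type := {eq_quot qequiv}.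
HB.instance Definition _ := Choice.on quot.
HB.instance Definition _ := EqQuotient.on quot.

Definition qproj (a : S) : quot := \pi a.

Lemma qprojP a b : qproj a = qproj b <-> I (a - b).
Proof.
split=> [/eqP|ab]; first by rewrite eqmodE => /asboolP.
by apply/eqP; rewrite eqmodE; apply/asboolP.
Qed.

Lemma qproj_surj x : exists a, x = qproj a.
Proof. by exists (repr x); rewrite /qproj reprK. Qed.

Definition qzero : quot := qproj 0.
Definition qone : quot := qproj 1.
Definition qopp (x : quot) : quot := qproj (- repr x).
Definition qadd (x y : quot) : quot := qproj (repr x + repr y).
Definition qmul (x y : quot) : quot := qproj (repr x * repr y).

Let reprI a : I (repr (qproj a) - a).
Proof. by apply/qprojP; rewrite {1}/qproj reprK. Qed.

Let IN a : I a -> I (- a).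
Proof. by case: (idealP I) => _ _ IM; rewrite -mulN1r; exact: IM. Qed.

Lemma qoppE a : qopp (qproj a) = qproj (- a).
Proof. by apply/qprojP; rewrite -opprD; apply: IN; apply: reprI. Qed.

Lemma qaddE a b : qadd (qproj a) (qproj b) = qproj (a + b).
Proof.
case: (idealP I) => _ ID _; apply/qprojP.
by rewrite opprD addrACA; apply: ID; apply: reprI.
Qed.

Lemma qmulE a b : qmul (qproj a) (qproj b) = qproj (a * b).
Proof.
case: (idealP I) => _ ID IM; apply/qprojP.
set a' := repr _; set b' := repr _.
have -> : a' * b' - a * b = b' * (a' - a) + a * (b' - b).
  by rewrite !mulrBr (mulrC b' a') (mulrC b' a) addrA subrK.
by apply: ID; apply: IM; apply: reprI.
Qed.

Lemma qaddA : associative qadd.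
Proof.
move=> x y z; have [a ->] := qproj_surj x; have [b ->] := qproj_surj y.
by have [c ->] := qproj_surj z; rewrite !qaddE addrA.
Qed.

Lemma qaddC : commutative qadd.
Proof.
move=> x y; have [a ->] := qproj_surj x; have [b ->] := qproj_surj y.
by rewrite !qaddE addrC.
Qed.

Lemma qadd0 : left_id qzero qadd.
Proof. by move=> x; have [a ->] := qproj_surj x; rewrite qaddE add0r. Qed.

Lemma qaddN : left_inverse qzero qopp qadd.
Proof. by move=> x; have [a ->] := qproj_surj x; rewrite qoppE qaddE addNr. Qed.

HB.instance Definition _ := GRing.isZmodule.Build quot qaddA qaddC qadd0 qaddN.

Lemma qmulA : associative qmul.
Proof.
move=> x y z; have [a ->] := qproj_surj x; have [b ->] := qproj_surj y.
by have [c ->] := qproj_surj z; rewrite !qmulE mulrA.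
Qed.

Lemma qmulC : commutative qmul.
Proof.
move=> x y; have [a ->] := qproj_surj x; have [b ->] := qproj_surj y.
by rewrite !qmulE mulrC.
Qed.

Lemma qmul1 : left_id qone qmul.
Proof. by move=> x; have [a ->] := qproj_surj x; rewrite qmulE mul1r. Qed.

Lemma qmulD : left_distributive qmul +%R.
Proof.
move=> x y z; have [a ->] := qproj_surj x; have [b ->] := qproj_surj y.
have [c ->] := qproj_surj z.
rewrite (qaddE a b : qproj a + qproj b = _) !qmulE.
by rewrite (qaddE _ _ : qproj (a * c) + qproj (b * c) = _) mulrDl.
Qed.

HB.instance Definition _ :=
  GRing.Zmodule_isComPzRing.Build quot qmulA qmulC qmul1 qmulD.

Lemma qproj_is_zmod_morphism : zmod_morphism qproj.
Proof.
by move=> a b; rewrite (qoppE b : - qproj b = _) (qaddE _ _ : qproj _ + qproj _ = _).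
Qed.

Lemma qproj_is_monoid_morphism : monoid_morphism qproj.
Proof.
by split=> // a b; rewrite (qmulE a b : qproj a * qproj b = _).
Qed.

HB.instance Definition _ :=
  GRing.isZmodMorphism.Build S quot qproj qproj_is_zmod_morphism.
HB.instance Definition _ :=
  GRing.isMonoidMorphism.Build S quot qproj qproj_is_monoid_morphism.

End QuotientRing.

(* ------------------------------------------------------------------------ *)
(** * Locally ringed spaces

    A sheaf of rings is given by its stalks and, for every open [U], by the
    families of germs [(s x)_(x in U)] that are sections over [U]; a section is
    a total function on the space of which only the values on [U] matter. *)

Definition invertible (S : comPzRingType) (a : S) : Prop := exists b, a * b = 1.

Definition local_ring (S : comPzRingType) : Prop :=
  (1 : S) <> 0 /\
  forall a b : S, invertible (a + b) -> invertible a \/ invertible b.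

Record lrs := LRS {
  space :> topologicalType;
  stalk : space -> comPzRingType;
  sect : set space -> set (forall x, stalk x);
  (* restriction, gluing, and irrelevance of the values outside U *)
  sect_local : forall U s, open U ->
    (sect U s <-> forall x, U x -> exists V t,
       [/\ open V, V x, sect V t & forall y, U y -> V y -> s y = t y]);
  sect1 : forall U, open U -> sect U (fun=> 1);
  sectB : forall U s t, open U -> sect U s -> sect U t ->
    sect U (fun x => s x - t x);
  sectM : forall U s t, open U -> sect U s -> sect U t ->
    sect U (fun x => s x * t x);
  germ_surj : forall x (a : stalk x), exists U s,
    [/\ open U, U x, sect U s & s x = a];
  germ_inj : forall U s x, open U -> U x -> sect U s -> s x = 0 ->
    exists V, [/\ open V, V x & forall y, U y -> V y -> s y = 0];
  stalk_local : forall x, local_ring (stalk x) }.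

Record lrs_mor (X Y : lrs) := LRSMor {
  mor_pt :> X -> Y;
  mor_st : forall x, stalk (mor_pt x) -> stalk x;
  mor_cont : forall V, open V -> open (mor_pt @^-1` V);
  mor_zmod : forall x, zmod_morphism (@mor_st x);
  mor_monoid : forall x, monoid_morphism (@mor_st x);
  mor_local : forall x a, invertible (@mor_st x a) -> invertible a;
  mor_sect : forall V t, open V -> sect V t ->
    sect (mor_pt @^-1` V) (fun x => mor_st (t (mor_pt x))) }.

Arguments mor_st {X Y} l {x} a.
Arguments mor_cont {X Y} l {V}.
Arguments mor_zmod {X Y} l x.
Arguments mor_monoid {X Y} l x.
Arguments mor_local {X Y} l {x a}.
Arguments mor_sect {X Y} l {V t}.

Section Comp.
Variables (X Y Z : lrs) (g : lrs_mor Y Z) (f : lrs_mor X Y).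

Let cpt (x : X) : Z := g (f x).
Let cst (x : X) (a : stalk (cpt x)) : stalk x := mor_st f (mor_st g a).

Lemma comp_cont V : open V -> open (cpt @^-1` V).
Proof. by move=> oV; exact: (mor_cont f (mor_cont g oV)). Qed.

Lemma comp_zmod x : zmod_morphism (@cst x).
Proof. by move=> a b; rewrite /cst !mor_zmod. Qed.

Lemma comp_monoid x : monoid_morphism (@cst x).
Proof.
split=> [|a b]; rewrite /cst; first by rewrite !(mor_monoid _ _).1.
by rewrite !(mor_monoid _ _).2.
Qed.

Lemma comp_local x a : invertible (@cst x a) -> invertible a.
Proof. by move=> /(mor_local f) /(mor_local g). Qed.

Lemma comp_sect V t : open V -> sect V t ->
  sect (cpt @^-1` V) (fun x => @cst x (t (cpt x))).
Proof.
by move=> oV sV; exact: (mor_sect f (mor_cont g oV) (mor_sect g oV sV)).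
Qed.

Definition lrs_comp : lrs_mor X Z :=
  LRSMor comp_cont comp_zmod comp_monoid comp_local comp_sect.
End Comp.

Notation "g \O f" := (lrs_comp g f) (at level 50, format "g  \O  f").

(** [P] with projections [p], [q] is the fibre product of [f] and [g]. *)
Definition is_pullback (X Y Z P : lrs) (f : lrs_mor X Z) (g : lrs_mor Y Z)
    (p : lrs_mor P X) (q : lrs_mor P Y) : Prop :=
  f \O p = g \O q /\
  forall (T : lrs) (a : lrs_mor T X) (b : lrs_mor T Y), f \O a = g \O b ->
    exists! u : lrs_mor T P, p \O u = a /\ q \O u = b.

Definition closed_immersion (X Y : lrs) (f : lrs_mor X Y) : Prop :=
  [/\ injective f, (forall A, closed A -> closed (f @` A)) &
      forall x (b : stalk x), exists a, mor_st f a = b].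

(** Flatness of [phi : R -> S]: [N (x)_R S -> N' (x)_R S] is injective for every
    injective [N -> N'].  By the universal property of the tensor product,
    [\sum_i n i (x) s i = 0] means that every biadditive [R]-balanced map
    kills [\sum_i (n i, s i)]. *)
Definition balanced (R S : comPzRingType) (phi : R -> S) (N : lmodType R)
    (P : zmodType) (b : N -> S -> P) : Prop :=
  [/\ (forall s, zmod_morphism (b^~ s)), (forall x, zmod_morphism (b x)) &
      forall c x s, b (c *: x) s = b x (phi c * s)].

Definition tensor_zero (R S : comPzRingType) (phi : R -> S) (N : lmodType R)
    (k : nat) (x : 'I_k -> N) (s : 'I_k -> S) : Prop :=
  forall (P : zmodType) (b : N -> S -> P), balanced phi b ->
    \sum_(i < k) b (x i) (s i) = 0.

Definition flat_ring_map (R S : comPzRingType) (phi : R -> S) : Prop :=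
  forall (N N' : lmodType R) (f : {linear N -> N'}), injective f ->
  forall (k : nat) (x : 'I_k -> N) (s : 'I_k -> S),
    tensor_zero phi (f \o x) s -> tensor_zero phi x s.

Definition flat_mor (X Y : lrs) (f : lrs_mor X Y) : Prop :=
  forall x : X, flat_ring_map (@mor_st _ _ f x).

(* ------------------------------------------------------------------------ *)
(** * Graded rings, [Proj] and [Spec] *)

(** Directness of the sum is not part of the structure, so that [S / I] carries
    the image grading for every ideal [I]; that grading is direct as soon as
    [I] is homogeneous. *)
Record grading (S : comPzRingType) := Grading {
  gpart :> nat -> set S;
  gpart0 : forall e, gpart e 0;
  gpartB : forall e a b, gpart e a -> gpart e b -> gpart e (a - b);
  gpart1 : gpart 0 1;
  gpartM : forall e f a b, gpart e a -> gpart f b -> gpart (e + f)%N (a * b);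
  gpart_sum : forall a, exists k (c : 'I_k -> S),
    (forall i : 'I_k, gpart i (c i)) /\ a = \sum_(i < k) c i }.

Definition homogeneous (S : comPzRingType) (gr : grading S) (I : set S) : Prop :=
  forall k (c : 'I_k -> S), (forall i : 'I_k, gr i (c i)) -> I (\sum_(i < k) c i) ->
    forall i, I (c i).

Definition prime_ideal (S : comPzRingType) (P : set S) : Prop :=
  [/\ is_ideal P, ~ P 1 & forall a b, P (a * b) -> P a \/ P b].

(** [hspec gr N] is the space of the homogeneous primes that do not contain [N],
    with the sheaf of degree-0 homogeneous fractions.  It is [Proj] when [N] is
    the irrelevant ideal, and [Spec] when the ring is concentrated in degree 0
    and [N] is the unit ideal. *)
Section HSpec.
Variables (S : comPzRingType) (gr : grading S) (N : set S).

Record hpoint := HPoint {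
  hprime :> set S;
  hprime_prime : prime_ideal hprime;
  hprime_homog : homogeneous gr hprime;
  hprime_rel : ~ (N `<=` hprime) }.

HB.instance Definition _ := gen_eqMixin hpoint.
HB.instance Definition _ := gen_choiceMixin hpoint.

Definition homog_set : set S := [set a | exists e, gr e a].

Definition zariski_open (U : set hpoint) : Prop :=
  exists2 A : set S, A `<=` homog_set & U = [set P : hpoint | ~ (A `<=` P)].

Lemma zariski_openT : zariski_open setT.
Proof.
exists [set 1]; first by move=> _ ->; exists 0%N; exact: gpart1.
apply/seteqP; split=> // P _ /= P1; case: (hprime_prime P) => _ nP1 _.
by apply: nP1; apply: P1.
Qed.

Lemma zariski_openI : setI_closed zariski_open.
Proof.
move=> _ _ [A hA ->] [B hB ->].
exists [set c | exists a b, [/\ A a, B b & c = a * b]].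
  move=> _ [a [b [Aa Bb ->]]]; have [e ea] := hA _ Aa; have [f fb] := hB _ Bb.
  by exists (e + f)%N; exact: gpartM.
apply/seteqP; split=> P /=; case: (hprime_prime P) => [[_ _ PM] _ PP].
- move=> [nA nB] AB; apply: nA => a Aa; apply: contrapT => nPa.
  apply: nB => b Bb; have : P (a * b) by apply: AB; exists a, b.
  by case/PP.
- move=> AB; split=> AP; apply: AB => _ [a [b [Aa Bb ->]]].
    by rewrite mulrC; apply: PM; exact: AP.
  by apply: PM; exact: AP.
Qed.

Lemma zariski_open_bigU (I : Type) (f : I -> set hpoint) :
  (forall i, zariski_open (f i)) -> zariski_open (\bigcup_i f i).
Proof.
move=> of_; have /choice[A hA] : forall i, exists A : set S,
    A `<=` homog_set /\ f i = [set P : hpoint | ~ (A `<=` P)].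
  by move=> i; have [A ? ?] := of_ i; exists A.
exists (\bigcup_i A i); first by move=> a [i _ Aa]; apply: (hA i).1 Aa.
apply/seteqP; split=> P /=.
  by move=> [i _]; rewrite (hA i).2 /= => nA AP; apply: nA => a Aa; apply: AP; exists i.
move=> nA; apply: contrapT => nf; apply: nA => a [i _ Aa]; apply: contrapT => nPa.
by apply: nf; exists i => //; rewrite (hA i).2 /= => /(_ _ Aa).
Qed.

HB.instance Definition _ := isOpenTopological.Build hpoint
  zariski_openT zariski_openI zariski_open_bigU.

Section Stalk.
Variable P : hpoint.

Record hfrac := HFrac {
  fdeg : nat;
  fnum : S;
  fden : S;
  fnum_deg : gr fdeg fnum;
  fden_deg : gr fdeg fden;
  fden_nin : ~ hprime P fden }.

HB.instance Definition _ := gen_eqMixin hfrac.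
HB.instance Definition _ := gen_choiceMixin hfrac.

Definition fequiv : rel hfrac := fun x y => `[< exists u,
  [/\ homog_set u, ~ hprime P u & u * (fnum x * fden y) = u * (fnum y * fden x)] >].

Let PM a b : ~ hprime P a -> ~ hprime P b -> ~ hprime P (a * b).
Proof. by case: (hprime_prime P) => _ _ PP na nb /PP []. Qed.

Let P1 : ~ hprime P 1.
Proof. by case: (hprime_prime P). Qed.

Let hM a b : homog_set a -> homog_set b -> homog_set (a * b).
Proof. by move=> [e ae] [f bf]; exists (e + f)%N; exact: gpartM. Qed.

Let h1 : homog_set 1.
Proof. by exists 0%N; exact: gpart1. Qed.

Lemma fequivP : equiv_class_of fequiv.
Proof.
split=> [x|x y|y x z].
- by apply/asboolP; exists 1.
- by apply/asboolP/asboolP=> -[u [hu nu E]]; exists u.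
- move=> /asboolP[u [hu nu E]] /asboolP[v [hv nv F]]; apply/asboolP.
  exists (u * v * fden y); split.
  + apply: hM; first exact: hM.
    by exists (fdeg y); exact: fden_deg.
  + apply: PM; first exact: PM.
    exact: fden_nin.
  + transitivity (v * fden z * (u * (fnum x * fden y))); first by ring.
    rewrite E; transitivity (u * fden x * (v * (fnum y * fden z))); first by ring.
    by rewrite F; ring.
Qed.

Canonical fequiv_equiv := EquivRelPack fequivP.
Canonical fequiv_encModRel := defaultEncModRel fequiv.

(** The ring of fractions [a / b] with [a], [b] homogeneous of the same degree
    and [b] not in [P]. *)
Definition hloc : Type := {eq_quot fequiv}.
HB.instance Definition _ := Choice.on hloc.
HB.instance Definition _ := EqQuotient.on hloc.

Definition frac (x : hfrac) : hloc := \pi x.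

Lemma fracP x y : frac x = frac y <-> exists u,
  [/\ homog_set u, ~ hprime P u & u * (fnum x * fden y) = u * (fnum y * fden x)].
Proof.
split=> [/eqP|xy]; first by rewrite eqmodE => /asboolP.
by apply/eqP; rewrite eqmodE; apply/asboolP.
Qed.

Lemma fracE x y : fnum x * fden y = fnum y * fden x -> frac x = frac y.
Proof. by move=> xy; apply/fracP; exists 1; rewrite xy. Qed.

Lemma frac_surj (a : hloc) : exists x, a = frac x.
Proof. by exists (repr a); rewrite /frac reprK. Qed.

Lemma fzero_den : gr 0 1. Proof. exact: gpart1. Qed.
Definition f0 : hfrac := HFrac (gpart0 gr 0) fzero_den P1.
Definition f1 : hfrac := HFrac fzero_den fzero_den P1.

Lemma gpartN e a : gr e a -> gr e (- a).
Proof. by move=> ea; rewrite -sub0r; apply: gpartB => //; exact: gpart0. Qed.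

Lemma gpartD e a b : gr e a -> gr e b -> gr e (a + b).
Proof. by move=> ea eb; rewrite -[b]opprK; apply: gpartB => //; exact: gpartN. Qed.

Definition fopp (x : hfrac) : hfrac :=
  HFrac (gpartN (fnum_deg x)) (fden_deg x) (@fden_nin x).

Definition fmul (x y : hfrac) : hfrac :=
  HFrac (gpartM (fnum_deg x) (fnum_deg y)) (gpartM (fden_deg x) (fden_deg y))
    (PM (@fden_nin x) (@fden_nin y)).

Definition fadd (x y : hfrac) : hfrac :=
  HFrac (gpartD (gpartM (fnum_deg x) (fden_deg y)) (gpartM (fden_deg x) (fnum_deg y)))
    (gpartM (fden_deg x) (fden_deg y)) (PM (@fden_nin x) (@fden_nin y)).

Definition hopp (a : hloc) : hloc := frac (fopp (repr a)).
Definition hadd (a b : hloc) : hloc := frac (fadd (repr a) (repr b)).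
Definition hmul (a b : hloc) : hloc := frac (fmul (repr a) (repr b)).

Let reprE x : exists u, [/\ homog_set u, ~ hprime P u &
  u * (fnum (repr (frac x)) * fden x) = u * (fnum x * fden (repr (frac x)))].
Proof. by apply/fracP; rewrite {1}/frac reprK. Qed.

Lemma hoppE x : hopp (frac x) = frac (fopp x).
Proof.
have [u [hu nu E]] := reprE x; apply/fracP; exists u; split=> //=.
by rewrite !mulNr !mulrN E.
Qed.

Lemma haddE x y : hadd (frac x) (frac y) = frac (fadd x y).
Proof.
have [u [hu nu E]] := reprE x; have [v [hv nv F]] := reprE y.
apply/fracP; exists (u * v); split=> /=; [exact: hM|exact: PM|].
move: (repr (frac x)) (repr (frac y)) E F => x' y' E F.
transitivity (v * fden y' * fden y * (u * (fnum x' * fden x)) +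
              u * fden x' * fden x * (v * (fnum y' * fden y))); first by ring.
by rewrite E F; ring.
Qed.

Lemma hmulE x y : hmul (frac x) (frac y) = frac (fmul x y).
Proof.
have [u [hu nu E]] := reprE x; have [v [hv nv F]] := reprE y.
apply/fracP; exists (u * v); split=> /=; [exact: hM|exact: PM|].
move: (repr (frac x)) (repr (frac y)) E F => x' y' E F.
transitivity (u * (fnum x' * fden x) * (v * (fnum y' * fden y))); first by ring.
by rewrite E F; ring.
Qed.

Lemma haddA : associative hadd.
Proof.
move=> a b c; have [x ->] := frac_surj a; have [y ->] := frac_surj b.
by have [z ->] := frac_surj c; rewrite !haddE; apply: fracE => /=; ring.
Qed.

Lemma haddC : commutative hadd.
Proof.
move=> a b; have [x ->] := frac_surj a; have [y ->] := frac_surj b.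
by rewrite !haddE; apply: fracE => /=; ring.
Qed.

Lemma hadd0 : left_id (frac f0) hadd.
Proof.
by move=> a; have [x ->] := frac_surj a; rewrite haddE; apply: fracE => /=; ring.
Qed.

Lemma haddN : left_inverse (frac f0) hopp hadd.
Proof.
move=> a; have [x ->] := frac_surj a.
by rewrite hoppE haddE; apply: fracE => /=; ring.
Qed.

HB.instance Definition _ := GRing.isZmodule.Build hloc haddA haddC hadd0 haddN.

Lemma hmulA : associative hmul.
Proof.
move=> a b c; have [x ->] := frac_surj a; have [y ->] := frac_surj b.
by have [z ->] := frac_surj c; rewrite !hmulE; apply: fracE => /=; ring.
Qed.

Lemma hmulC : commutative hmul.
Proof.
move=> a b; have [x ->] := frac_surj a; have [y ->] := frac_surj b.
by rewrite !hmulE; apply: fracE => /=; ring.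
Qed.

Lemma hmul1 : left_id (frac f1) hmul.
Proof.
by move=> a; have [x ->] := frac_surj a; rewrite hmulE; apply: fracE => /=; ring.
Qed.

Lemma hmulD : left_distributive hmul +%R.
Proof.
move=> a b c; have [x ->] := frac_surj a; have [y ->] := frac_surj b.
have [z ->] := frac_surj c; rewrite (haddE x y : frac x + frac y = _) !hmulE.
rewrite (haddE _ _ : frac (fmul x z) + frac (fmul y z) = _).
by apply: fracE => /=; ring.
Qed.

HB.instance Definition _ :=
  GRing.Zmodule_isComPzRing.Build hloc hmulA hmulC hmul1 hmulD.

Lemma fracB x y : frac x - frac y = frac (fadd x (fopp y)).
Proof. by rewrite (hoppE y : - frac y = _) (haddE _ _ : frac _ + frac _ = _). Qed.

Lemma fracD x y : frac x + frac y = frac (fadd x y).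
Proof. exact: haddE. Qed.

Lemma fracM x y : frac x * frac y = frac (fmul x y).
Proof. exact: hmulE. Qed.

Lemma frac1 : 1 = frac f1. Proof. by []. Qed.

Lemma frac_eq0 x : frac x = 0 <->
  exists u, [/\ homog_set u, ~ hprime P u & u * fnum x = 0].
Proof.
split=> [/fracP[u [hu nu]]|[u [hu nu E]]].
  by rewrite /= mulr1 mul0r mulr0 => E; exists u.
by apply/fracP; exists u; split=> //=; rewrite mulr1 mul0r mulr0.
Qed.

Lemma frac_invertible x : invertible (frac x) <-> ~ hprime P (fnum x).
Proof.
split=> [[b]|nx].
  have [y ->] := frac_surj b; rewrite fracM => /fracP[u [hu nu /= E]] Px.
  case: (hprime_prime P) => [[_ _ Pmul] _ _].
  suff : hprime P (u * (1 * (fden x * fden y))).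
    by apply: PM => //; rewrite mul1r; apply: PM; exact: fden_nin.
  rewrite -E; have -> : u * (fnum x * fnum y * 1) = u * fnum y * fnum x by ring.
  exact: Pmul.
exists (frac (HFrac (fden_deg x) (fnum_deg x) nx)).
by rewrite fracM; apply: fracE => /=; ring.
Qed.

Lemma hloc_local : local_ring hloc.
Proof.
case: (hprime_prime P) => [[P0 PD Pmul] _ _]; split.
  move=> /frac_eq0[u [_ nu]] /=; rewrite mulr1 => u0.
  by apply: nu; rewrite u0.
move=> a b; have [x ->] := frac_surj a; have [y ->] := frac_surj b.
rewrite fracD !frac_invertible /= => nxy.
apply: contrapT => /not_orP[/contrapT Px /contrapT Py]; apply: nxy.
by apply: PD; [rewrite mulrC|]; exact: Pmul.
Qed.

End Stalk.

Definition hsect (U : set hpoint) : set (forall P, hloc P) :=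
  fun s => forall P, U P -> exists V a b, [/\ open V, V P &
    forall Q, U Q -> V Q -> exists x : hfrac Q,
      [/\ fnum x = a, fden x = b & s Q = frac x]].

Lemma open_hpointE (U : set hpoint) : open U <-> zariski_open U.
Proof. by []. Qed.

Lemma open_D u : homog_set u -> open [set P : hpoint | ~ hprime P u].
Proof.
move=> hu; apply/open_hpointE; exists [set u]; first by move=> _ ->.
by apply/seteqP; split=> P /= nu; [move=> /(_ _ erefl)|move=> Pu; apply: nu => _ ->].
Qed.

Lemma hsect_local U s : open U ->
  (hsect U s <-> forall P, U P -> exists V t,
     [/\ open V, V P, hsect V t & forall Q, U Q -> V Q -> s Q = t Q]).
Proof.
move=> oU; split=> [sU P UP|H P UP]; first by exists U, s.
have [V [t [oV VP tV st]]] := H P UP.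
have [W [a [b [oW WP ab]]]] := tV P VP.
exists (V `&` W), a, b; split=> [|//|Q UQ [VQ WQ]]; first exact: openI.
by have [x [xa xb tx]] := ab Q VQ WQ; exists x; split=> //; rewrite st.
Qed.

Lemma hsect1 U : open U -> hsect U (fun=> 1).
Proof.
move=> oU P UP; exists U, 1, 1; split=> // Q UQ _.
by exists (f1 Q).
Qed.

Lemma hsectB U s t : open U -> hsect U s -> hsect U t ->
  hsect U (fun P => s P - t P).
Proof.
move=> oU sU tU P UP; have [V [a [b [oV VP ab]]]] := sU P UP.
have [W [c [d [oW WP cd]]]] := tU P UP.
exists (V `&` W), (a * d + b * - c), (b * d).
split=> [|//|Q UQ [VQ WQ]]; first exact: openI.
have [x [<- <- ->]] := ab Q UQ VQ; have [y [<- <- ->]] := cd Q UQ WQ.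
by exists (fadd x (fopp y)); split=> //; exact: fracB.
Qed.

Lemma hsectM U s t : open U -> hsect U s -> hsect U t ->
  hsect U (fun P => s P * t P).
Proof.
move=> oU sU tU P UP; have [V [a [b [oV VP ab]]]] := sU P UP.
have [W [c [d [oW WP cd]]]] := tU P UP.
exists (V `&` W), (a * c), (b * d).
split=> [|//|Q UQ [VQ WQ]]; first exact: openI.
have [x [<- <- ->]] := ab Q UQ VQ; have [y [<- <- ->]] := cd Q UQ WQ.
by exists (fmul x y); split=> //; exact: fracM.
Qed.

Lemma hgerm_surj P (a : hloc P) : exists U s,
  [/\ open U, U P, hsect U s & s P = a].
Proof.
have [x ->] := frac_surj a.
have hden : homog_set (fden x) by exists (fdeg x); exact: fden_deg.
pose s Q : hloc Q := match pselect (hprime Q (fden x)) with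
  | left _ => 0
  | right h => frac (HFrac (fnum_deg x) (fden_deg x) h)
  end.
have sE Q : ~ hprime Q (fden x) -> exists y : hfrac Q,
    [/\ fnum y = fnum x, fden y = fden x & s Q = frac y].
  by rewrite /s; case: pselect => // h _; exists (HFrac (fnum_deg x) (fden_deg x) h).
exists [set Q | ~ hprime Q (fden x)], s; split.
- exact: open_D.
- exact: fden_nin.
- move=> Q nQ; exists setT, (fnum x), (fden x); split=> [|//|Q' nQ' _].
    exact: openT.
  exact: sE.
- by have [y [yn yd ->]] := sE P (@fden_nin P x); apply: fracE; rewrite yn yd.
Qed.

Lemma hgerm_inj U s P : open U -> U P -> hsect U s -> s P = 0 ->
  exists V, [/\ open V, V P & forall Q, U Q -> V Q -> s Q = 0].
Proof.
move=> oU UP sU sP0; have [V [a [b [oV VP ab]]]] := sU P UP.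
have [x [xa xb sx]] := ab P UP VP; move: sP0; rewrite sx => /frac_eq0[u [hu nu ux]].
exists (V `&` [set Q | ~ hprime Q u]); split=> [|//|Q UQ [VQ nQ]].
  by apply: openI => //; exact: open_D.
have [y [ya yb ->]] := ab Q UQ VQ; apply/frac_eq0; exists u; split=> //.
by rewrite ya -xa.
Qed.

Definition hspec : lrs :=
  LRS hsect_local hsect1 hsectB hsectM hgerm_surj hgerm_inj hloc_local.

End HSpec.

Definition irrelevant (S : comPzRingType) (gr : grading S) : set S :=
  [set a | exists2 e, (0 < e)%N & gr e a].

Definition Proj (S : comPzRingType) (gr : grading S) : lrs :=
  hspec gr (irrelevant gr).

Section TrivialGrading.
Variable S : comPzRingType.

Definition triv_part (e : nat) : set S := [set a | (0 < e)%N -> a = 0].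

Lemma triv_part0 e : triv_part e 0. Proof. by []. Qed.

Lemma triv_partB e a b : triv_part e a -> triv_part e b -> triv_part e (a - b).
Proof. by move=> a0 b0 e0; rewrite a0 // b0 // subr0. Qed.

Lemma triv_part1 : triv_part 0 1. Proof. by []. Qed.

Lemma triv_partM e f a b : triv_part e a -> triv_part f b -> triv_part (e + f)%N (a * b).
Proof.
rewrite /triv_part /= addn_gt0 => a0 b0 /orP[/a0 ->|/b0 ->];
by rewrite ?mul0r ?mulr0.
Qed.

Lemma triv_part_sum a : exists k (c : 'I_k -> S),
  (forall i : 'I_k, triv_part i (c i)) /\ a = \sum_(i < k) c i.
Proof. by exists 1%N, (fun=> a); split; [case=> -[]|rewrite big_ord1]. Qed.

Definition triv_grading : grading S :=
  Grading triv_part0 triv_partB triv_part1 triv_partM triv_part_sum.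
End TrivialGrading.

Definition Spec (S : comPzRingType) : lrs := hspec (triv_grading S) setT.

(** The morphism of spaces given by a homomorphism of graded rings such that the
    preimages of admissible primes are admissible. *)
Section HMap.
Variables (S T : comPzRingType) (grS : grading S) (grT : grading T).
Variables (NS : set S) (NT : set T) (g : {rmorphism S -> T}).
Hypothesis g_deg : forall e a, grS e a -> grT e (g a).
Hypothesis g_rel : forall P : hpoint grT NT, ~ (NS `<=` g @^-1` P).

Section Point.
Variable P : hpoint grT NT.

Lemma preim_prime : prime_ideal (g @^-1` P).
Proof.
case: (hprime_prime P) => [[P0 PD Pmul] nP1 PP]; split=> /=.
- split=> /= [|a b|a b]; rewrite ?rmorph0 ?rmorphD ?rmorphM //.
    exact: PD.
  exact: Pmul.
- by rewrite rmorph1.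
- by move=> a b; rewrite rmorphM; exact: PP.
Qed.

Lemma preim_homog : homogeneous grS (g @^-1` P).
Proof.
move=> k c hc; rewrite /= rmorph_sum => Pc i.
by apply: (hprime_homog (c := g \o c)) Pc i => j; exact: g_deg.
Qed.

Definition preim_point : hpoint grS NS := HPoint preim_prime preim_homog (@g_rel P).

Definition frac_map (x : hfrac preim_point) : hfrac P :=
  HFrac (g_deg (fnum_deg x)) (g_deg (fden_deg x)) (@fden_nin _ _ _ _ x).

Definition hloc_map (a : hloc preim_point) : hloc P := frac (frac_map (repr a)).

Lemma hloc_mapE x : hloc_map (frac x) = frac (frac_map x).
Proof.
have : frac (repr (frac x)) = frac x by rewrite {1}/frac reprK.
move=> /fracP[u [[e hu] nu E]]; apply/fracP; exists (g u); split=> //.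
  by exists e; exact: g_deg.
by rewrite /= -!rmorphM E.
Qed.

Lemma hloc_map_zmod : zmod_morphism hloc_map.
Proof.
move=> a b; have [x ->] := frac_surj a; have [y ->] := frac_surj b.
rewrite fracB !hloc_mapE fracB; apply: fracE => /=.
by rewrite rmorphD !rmorphM rmorphN.
Qed.

Lemma hloc_map_monoid : monoid_morphism hloc_map.
Proof.
split=> [|a b].
  by rewrite frac1 hloc_mapE; apply: fracE => /=; rewrite rmorph1.
have [x ->] := frac_surj a; have [y ->] := frac_surj b.
by rewrite fracM !hloc_mapE fracM; apply: fracE => /=; rewrite !rmorphM.
Qed.

Lemma hloc_map_local a : invertible (hloc_map a) -> invertible a.
Proof.
by have [x ->] := frac_surj a; rewrite hloc_mapE !frac_invertible.
Qed.
End Point.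

Lemma preim_cont (V : set (hpoint grS NS)) : open V -> open (preim_point @^-1` V).
Proof.
move=> /open_hpointE[A hA ->]; apply/open_hpointE.
exists (g @` A); first by move=> _ [a /hA[e ea] <-]; exists e; exact: g_deg.
apply/seteqP; split=> P /= nA gA; apply: nA => a.
  by move=> Aa; apply: gA; exists a.
by move=> [b Ab <-]; exact: gA.
Qed.

Lemma hloc_map_sect (V : set (hpoint grS NS)) t : open V -> hsect V t ->
  hsect (preim_point @^-1` V) (fun P => hloc_map (t (preim_point P))).
Proof.
move=> oV tV P VP; have [W [a [b [oW WP ab]]]] := tV _ VP.
exists (preim_point @^-1` W), (g a), (g b); split=> [|//|Q VQ WQ].
  exact: preim_cont.
have [x [<- <- ->]] := ab _ VQ WQ; exists (frac_map x); split=> //.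
exact: hloc_mapE.
Qed.

Definition hmap : lrs_mor (hspec grT NT) (hspec grS NS) :=
  @LRSMor (hspec grT NT) (hspec grS NS) preim_point hloc_map preim_cont
    hloc_map_zmod hloc_map_monoid hloc_map_local hloc_map_sect.

End HMap.

Section SpecMap.
Variables (S T : comPzRingType) (g : {rmorphism S -> T}).

Lemma triv_deg e a : triv_grading S e a -> triv_grading T e (g a).
Proof. by move=> a0 e0; rewrite a0 // rmorph0. Qed.

Lemma triv_rel (P : hpoint (triv_grading T) setT) : ~ (setT `<=` g @^-1` P).
Proof.
move=> /(_ 1 I) /=; rewrite rmorph1.
by case: (hprime_prime P).
Qed.

Definition Spec_map : lrs_mor (Spec T) (Spec S) := hmap triv_deg (@triv_rel).
End SpecMap.

Section QuotientGrading.
Variables (S : comPzRingType) (gr : grading S) (I : ideal S).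

Definition quot_part (e : nat) : set (quot I) := @qproj S I @` gr e.

Lemma quot_part0 e : quot_part e 0.
Proof. by exists 0; [exact: gpart0|rewrite rmorph0]. Qed.

Lemma quot_partB e a b : quot_part e a -> quot_part e b -> quot_part e (a - b).
Proof.
by move=> [x ex <-] [y ey <-]; exists (x - y); [exact: gpartB|rewrite rmorphB].
Qed.

Lemma quot_part1 : quot_part 0 1.
Proof. by exists 1; [exact: gpart1|rewrite rmorph1]. Qed.

Lemma quot_partM e f a b :
  quot_part e a -> quot_part f b -> quot_part (e + f)%N (a * b).
Proof.
by move=> [x ex <-] [y ey <-]; exists (x * y); [exact: gpartM|rewrite rmorphM].
Qed.

Lemma quot_part_sum a : exists k (c : 'I_k -> quot I),
  (forall i : 'I_k, quot_part i (c i)) /\ a = \sum_(i < k) c i.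
Proof.
have [x ->] := qproj_surj a; have [k [c [hc ->]]] := gpart_sum gr x.
exists k, (@qproj S I \o c); split=> [i|]; last by rewrite rmorph_sum.
by exists (c i).
Qed.

Definition quot_grading : grading (quot I) :=
  Grading quot_part0 quot_partB quot_part1 quot_partM quot_part_sum.

Lemma quot_deg e a : gr e a -> quot_grading e (qproj I a).
Proof. by move=> ea; exists a. Qed.

Lemma quot_rel (P : hpoint quot_grading (irrelevant quot_grading)) :
  ~ (irrelevant gr `<=` @qproj S I @^-1` P).
Proof.
move=> H; apply: (hprime_rel (h := P)) => _ [e e0 [a ea <-]].
by apply: H; exists e.
Qed.

(** The embedding of [Proj (S / I)] in [Proj S]. *)
Definition Proj_quot : lrs_mor (Proj quot_grading) (Proj gr) :=
  hmap quot_deg (@quot_rel).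
End QuotientGrading.

(* ------------------------------------------------------------------------ *)
(** * Weighted polynomial rings *)

Section WeightedPolynomials.
Variables (n : nat) (B : comNzRingType) (d : 'I_n -> nat).

Definition wdeg (al : 'X_{1..n}) : nat := (\sum_(i < n) d i * al i)%N.

Definition wpart (e : nat) : set {mpoly B[n]} :=
  [set f | forall al, al \in msupp f -> wdeg al = e].

Lemma wpart0 e : wpart e 0.
Proof. by move=> al; rewrite msupp0. Qed.

Lemma wpartB e f g : wpart e f -> wpart e g -> wpart e (f - g).
Proof.
by move=> ef eg al /msuppB_le; rewrite mem_cat => /orP[/ef|/eg].
Qed.

Lemma wpart1 : wpart 0 1.
Proof.
move=> al; rewrite msupp1 inE => /eqP ->.
by rewrite /wdeg big1 // => i _; rewrite mnm0E muln0.
Qed.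

Lemma wpartM e e' f g : wpart e f -> wpart e' g -> wpart (e + e')%N (f * g).
Proof.
move=> ef eg al /msuppM_le /allpairsP[[be ga] /= [/ef <- /eg <- ->]].
by rewrite /wdeg -big_split; apply: eq_bigr => i _; rewrite mnmDE mulnDr.
Qed.

Definition wcomp (f : {mpoly B[n]}) (e : nat) : {mpoly B[n]} :=
  \sum_(al <- msupp f | wdeg al == e) f@_al *: 'X_[al].

Lemma wcompP f e : wpart e (wcomp f e).
Proof.
move=> al; rewrite /wcomp => /msupp_sum_le /flattenP[s /mapP[be]].
rewrite mem_filter => /andP[/eqP <- _] -> /msuppZ_le.
by rewrite msuppX inE => /eqP ->.
Qed.

Lemma wpart_sum f : exists k (c : 'I_k -> {mpoly B[n]}),
  (forall i : 'I_k, wpart i (c i)) /\ f = \sum_(i < k) c i.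
Proof.
pose k := (\max_(al <- msupp f) wdeg al).+1.
exists k, (fun i => wcomp f i); split=> [i|]; first exact: wcompP.
rewrite {1}[f]mpolyE /wcomp; rewrite (eq_bigr (fun i : 'I_k => \sum_(al <- msupp f)
    if wdeg al == i then f@_al *: 'X_[al] else 0)); last first.
  by move=> i _; rewrite big_mkcond.
rewrite exchange_big /= !big_seq; apply: eq_bigr => al alf.
have ltk : (wdeg al < k)%N by rewrite ltnS; exact: leq_bigmax_seq.
by rewrite (bigD1 (Ordinal ltk)) //= eqxx big1 ?addr0 // => i; rewrite -val_eqE /= eq_sym => /negPf ->.
Qed.

Definition wgrading : grading {mpoly B[n]} :=
  Grading wpart0 wpartB wpart1 wpartM wpart_sum.

Lemma mpolyC_deg e (a : B) :
  triv_grading B e a -> wgrading e (mpolyC n a).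
Proof.
move=> ha al; case: (posnP e) ha => [-> _|e0 ->//]; last by rewrite mpolyC0 msupp0.
rewrite msuppC; case: eqP => // _; rewrite inE => /eqP ->.
by rewrite /wdeg big1 // => i _; rewrite mnm0E muln0.
Qed.

Lemma mpolyC_rel (P : hpoint wgrading (irrelevant wgrading)) :
  ~ (setT `<=` @mpolyC n B @^-1` P).
Proof.
move=> /(_ 1 I) /=; rewrite rmorph1.
by case: (hprime_prime P).
Qed.

(** [Proj B[x]], the weighted projective space over [B], with its structure
    morphism. *)
Definition wProj : lrs := Proj wgrading.
Definition wProj_struct : lrs_mor wProj (Spec B) := hmap mpolyC_deg (@mpolyC_rel).

(** The closed subscheme [Proj (B[x] / I)] and its embedding. *)
Definition subProj (I : ideal {mpoly B[n]}) : lrs := Proj (quot_grading wgrading I).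
Definition subProj_emb (I : ideal {mpoly B[n]}) : lrs_mor (subProj I) wProj :=
  Proj_quot wgrading I.

End WeightedPolynomials.

Section CoefficientExtension.
Variables (n : nat) (B B' : comNzRingType) (g : {rmorphism B -> B'}) (d : 'I_n -> nat).

Lemma map_mpoly_deg e (f : {mpoly B[n]}) :
  wgrading B d e f -> wgrading B' d e (map_mpoly g f).
Proof.
move=> ef al; rewrite mcoeff_msupp mcoeff_map_mpoly => gf; apply: ef.
by rewrite mcoeff_msupp; apply: contra gf => /eqP ->; apply/eqP; exact: rmorph0.
Qed.

Lemma map_mpoly_rel (P : hpoint (wgrading B' d) (irrelevant (wgrading B' d))) :
  ~ (irrelevant (wgrading B d) `<=` @map_mpoly n B B' g @^-1` P).
Proof.
move=> H; apply: (hprime_rel (h := P)) => f [e e0 ef].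
case: (hprime_prime P) => [[P0 PD PM] _ _].
rewrite [f]mpolyE big_seq; elim/big_ind: _ => // al alf.
rewrite -mul_mpolyC; apply: PM; rewrite -(map_mpolyX g); apply: H.
by exists e => // be; rewrite msuppX inE => /eqP ->; exact: ef.
Qed.

(** The base change [Proj B'[x] -> Proj B[x]]. *)
Definition wProj_map : lrs_mor (wProj B' d) (wProj B d) :=
  hmap map_mpoly_deg (@map_mpoly_rel).
End CoefficientExtension.

(* ------------------------------------------------------------------------ *)
(** * Initial ideals and the Groebner fan *)

Section InitialIdeals.
Variables (K : fieldType) (R : realType) (n : nat).
Implicit Types (f : {mpoly K[n]}) (J : ideal {mpoly K[n]}) (u v w : 'rV[R]_n).

Definition wdot w (al : 'X_{1..n}) : R := \sum_(i < n) w 0 i * (al i)%:R.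

Definition in_w w f : {mpoly K[n]} :=
  \sum_(al <- msupp f | all (fun be => wdot w al <= wdot w be) (msupp f))
    f@_al *: 'X_[al].

Definition in_ideal w J : ideal {mpoly K[n]} := idgen (in_w w @` J).

Record term_order := TermOrder {
  tle :> rel 'X_{1..n};
  tle_refl : reflexive tle;
  tle_anti : antisymmetric tle;
  tle_trans : transitive tle;
  tle_total : total tle;
  tle0 : forall al, tle 0%MM al;
  tleD : forall al be ga, tle al be -> tle (ga + al)%MM (ga + be)%MM }.

Definition in_to (le : term_order) f : {mpoly K[n]} :=
  \sum_(al <- msupp f | all (fun be => le be al) (msupp f)) f@_al *: 'X_[al].

Definition in_to_ideal (le : term_order) J : ideal {mpoly K[n]} :=
  idgen (in_to le @` J).

Definition dot u v : R := \sum_(i < n) u 0 i * v 0 i.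

Definition int_vec (v : 'rV[int]_n) : 'rV[R]_n := map_mx intr v.

Definition rational_cone (C : set 'rV[R]_n) : Prop :=
  exists k (l : 'I_k -> 'rV[int]_n),
    C = [set v | forall i, 0 <= dot (int_vec (l i)) v].

(* for a convex set *)
Definition relint (C : set 'rV[R]_n) : set 'rV[R]_n :=
  [set v | C v /\ forall u, C u -> exists2 e, 0 < e & C (v + e *: (v - u))].

Definition full_dim (C : set 'rV[R]_n) : Prop :=
  exists2 M : 'M[R]_n, M \in unitmx & forall i, C (row i M).

Definition face (C tau : set 'rV[R]_n) : Prop :=
  exists2 l, (forall v, C v -> 0 <= dot l v) & tau = [set v | C v /\ dot l v = 0].

(** The cones of [GF J]. *)
Definition gfan J (C : set 'rV[R]_n) : Prop :=
  rational_cone C /\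
  exists w, relint C = [set u | in_ideal u J = in_ideal w J].

Definition maximal_cone J (C : set 'rV[R]_n) : Prop :=
  [/\ gfan J C, (forall D, gfan J D -> C `<=` D -> D = C) & full_dim C].

Definition lineality J : set 'rV[R]_n := [set u | in_ideal u J = J].

(** The preimage in [C] of a ray of [C / L]. *)
Definition ray (L C rho : set 'rV[R]_n) : Prop :=
  face C rho /\
  exists2 v, ~ L v & rho = [set u | exists2 c, 0 <= c & L (u - c *: v)].

(** The class of [v] modulo [L] is primitive in the image of the lattice [Z^n]. *)
Definition primitive (L : set 'rV[R]_n) (v : 'rV[int]_n) : Prop :=
  ~ L (int_vec v) /\
  forall (k : nat) (v' : 'rV[int]_n), L (int_vec v - k%:R *: int_vec v') -> k = 1%N.

(** The rows of [r] represent the primitive ray generators of [C / L], each of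
    them once. *)
Definition ray_generators (L C : set 'rV[R]_n) m (r : 'M[int]_(m, n)) : Prop :=
  (forall i, primitive L (row i r) /\
     exists2 rho, ray L C rho & rho (int_vec (row i r))) /\
  (forall rho, ray L C rho -> exists! i, rho (int_vec (row i r))).

End InitialIdeals.

(* ------------------------------------------------------------------------ *)
(** * The family *)

Section Family.
Variables (K : fieldType) (n m : nat) (d : 'I_n -> nat) (r : 'M[int]_(m, n)).
Implicit Types (f : {mpoly K[n]}) (J : ideal {mpoly K[n]}).

Let Kt := {mpoly K[m]}.

Definition rdot (j : 'I_m) (al : 'X_{1..n}) : int := \sum_(i < n) r j i * (al i)%:Z.

Definition min_int (s : seq int) : int := \big[Num.min/head 0 s]_(x <- s) x.

Definition mu f (j : 'I_m) : int := min_int [seq rdot j al | al <- msupp f].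

(* the difference is nonnegative for [al] in the support of [f] *)
Definition tpow f (al : 'X_{1..n}) : 'X_{1..m} :=
  [multinom absz (rdot j al - mu f j) | j < m].

Definition tilde f : {mpoly Kt[n]} :=
  \sum_(al <- msupp f) (f@_al *: 'X_[tpow f al] : Kt) *: 'X_[al].

Definition Jtilde J : ideal {mpoly Kt[n]} :=
  idgen (tilde @` [set f | J f /\ f != 0]).

Definition affine_space : lrs := Spec Kt.

Definition closed_point (a : 'I_m -> K) : lrs_mor (Spec K) affine_space :=
  Spec_map (meval a : {rmorphism Kt -> K}).

Definition affine_struct : lrs_mor affine_space (Spec K) :=
  Spec_map (@mpolyC m K : {rmorphism K -> Kt}).

(** [P(d) x A^m = Proj K[t][x]], with its projections. *)
Definition PxA : lrs := wProj Kt d.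
Definition PxA_pr1 : lrs_mor PxA (wProj K d) :=
  wProj_map (@mpolyC m K : {rmorphism K -> Kt}) d.
Definition PxA_pr2 : lrs_mor PxA affine_space := wProj_struct Kt d.

Variable J : ideal {mpoly K[n]}.

Definition Atilde : comPzRingType := quot (Jtilde J).
Definition total_emb : lrs_mor (subProj d (Jtilde J)) PxA := subProj_emb d (Jtilde J).
Definition pi_family : lrs_mor (subProj d (Jtilde J)) affine_space :=
  PxA_pr2 \O total_emb.

(** [Proj (K[x] / I)], with the projection [i] to the total space, is the
    scheme-theoretic fibre of the family over [a]. *)
Definition fibre_proj (a : 'I_m -> K) (I : ideal {mpoly K[n]})
    (i : lrs_mor (subProj d I) (subProj d (Jtilde J))) : Prop :=
  is_pullback pi_family (closed_point a) i (wProj_struct K d \O subProj_emb d I).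

Definition fibre_iso (a : 'I_m -> K) (I : ideal {mpoly K[n]}) : Prop :=
  exists i, fibre_proj a (I := I) i.

(** Equality of the fibre and [Proj (K[x] / I)] as closed subschemes of [P(d)]. *)
Definition fibre_eq (a : 'I_m -> K) (I : ideal {mpoly K[n]}) : Prop :=
  exists2 i, fibre_proj a (I := I) i & PxA_pr1 \O total_emb \O i = subProj_emb d I.

End Family.

(** [b], restricted to [D], is a basis of [S] as an [R]-module via [phi]. *)
Definition module_basis (R S : comPzRingType) (phi : R -> S) (I : eqType)
    (D : set I) (b : I -> S) : Prop :=
  (forall (s : seq I) (c : I -> R), uniq s -> (forall i, i \in s -> D i) ->
     \sum_(i <- s) phi (c i) * b i = 0 -> forall i, i \in s -> c i = 0) /\
  (forall a, exists (s : seq I) (c : I -> R), (forall i, i \in s -> D i) /\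
     a = \sum_(i <- s) phi (c i) * b i).

Definition standard_monomials (K : fieldType) n (le : term_order n)
    (J : ideal {mpoly K[n]}) : set 'X_{1..n} :=
  [set al | ~ in_to_ideal le J 'X_[al]].

(* Main.v *)
Require Import Defs.
From HB Require Import structures.
From mathcomp Require Import all_boot all_order all_algebra.
From mathcomp Require Import mpoly ring zify.
From mathcomp Require Import boolp classical_sets reals topology_structure.

Set Implicit Arguments.
Unset Strict Implicit.
Unset Printing Implicit Defensive.

Import Order.TTheory GRing.Theory Num.Theory.
Local Open Scope ring_scope.
Local Open Scope classical_set_scope.

Local Notation frac := Defs.frac.

(** Call a monomial nonstandard when it lies in the initial ideal of [J] for the
    term order. Every nonstandard [x^al] is the leading monomial of a unique monic
    element [g al] of [J] whose other monomials are standard ([normal_forms]); [J]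
    is homogeneous for positive weights, so the reduction takes place among finitely
    many monomials. The [g al] form a basis of [J] as a vector space. What makes the
    theorem true is that this basis deforms well. The cone [C] consists of the
    weights [v] for which [al] has minimal weight among the monomials of [g al], for
    all [al], and the lineality space of those for which all these weights agree
    ([coneP], [lineality_coneP]). As the rows of [r] belong to [C], the coefficient
    of [x^al] in [tilde (g al)] is 1, and the [tilde (g al)] span the ideal [Jtilde]
    over [K[t]] ([Jtilde_span]); in the same way the initial forms of the [g al]
    span the initial ideal for every weight in [C] ([in_ideal_span]). Both are
    instances of one computation with cocycles of weights ([deform_ideal]).

    In each of these families the member of index [al] involves no nonstandard
    monomial other than [x^al], so an element of the span can be read off from its
    nonstandard coefficients. Hence the standard monomials are a basis of the
    quotient ([quot_module_basis]), which gives freeness, and a specialisation of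
    the parameters that maps one family to another is a base change of the quotients
    ([quotient_base_change]). Setting [t_j = 0] for the rays [r_j] in a face [tau]
    and [t_j = 1] for the other rays keeps the terms of [g al] of minimal weight for
    all rays of [tau]. A weight in the relative interior of [tau] is a positive
    combination of these rays up to lineality ([relint_face_decomposition]), so
    these terms form its initial form ([face_point_kron]). If all [t_j] are nonzero,
    a torus element carries the fibre to that of [J] ([generic_fibre]).

    The geometric statements follow from facts about locally ringed spaces. If [T]
    is the base change of a graded ring [S] along [B -> B'], then [Proj T] is the
    fibre product of [Proj S] and [Spec B'] over [Spec B] ([base_change_pullback]);
    this gives the product of the weighted projective space with the affine space as
    well as all fibres. A graded ring that is free over [B] on homogeneous elements
    has a flat [Proj] ([Proj_flat]), and [Proj] of a quotient is a closed subscheme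
    ([Proj_quot_closed_immersion]). *)

(** * Local rings and sections of locally ringed spaces *)

Lemma invertible1 (S : comPzRingType) : invertible (1 : S).
Proof. by exists 1; rewrite mulr1. Qed.

Lemma invertibleMP (S : comPzRingType) (a b : S) :
  invertible (a * b) <-> invertible a /\ invertible b.
Proof.
split=> [[c abc]|[[a' aa'] [b' bb']]].
  by split; [exists (b * c)|exists (a * c)]; rewrite -abc; ring.
exists (a' * b'); have -> : a * b * (a' * b') = (a * a') * (b * b') by ring.
by rewrite aa' bb' mulr1.
Qed.

Lemma invertible_mulI (S : comPzRingType) (a b c : S) :
  invertible a -> b * a = c * a -> b = c.
Proof.
by move=> [a' aa'] E; rewrite -[b]mulr1 -[c]mulr1 -aa' !mulrA E.
Qed.

Lemma local_ring0 (S : comPzRingType) : local_ring S -> ~ invertible (0 : S).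
Proof. by case=> n10 _ [b]; rewrite mul0r => /esym. Qed.

Lemma local_ring_sum (S : comPzRingType) (k : nat) (a : 'I_k -> S) :
  local_ring S -> invertible (\sum_(i < k) a i) -> exists i, invertible (a i).
Proof.
move=> lS; elim: k a => [|k IH] a; first by rewrite big_ord0 => /(local_ring0 lS).
rewrite big_ord_recl => /lS.2[|/IH[i]]; first by exists ord0.
by exists (lift ord0 i).
Qed.

Section Sections.
Variable X : lrs.
Implicit Types (U V : set X) (s t : forall x : X, stalk x).

Lemma sect_sub U V s : open U -> open V -> V `<=` U -> sect U s -> sect V s.
Proof.
move=> oU oV VU sU; apply/(sect_local s oV) => x Vx.
by exists U, s; split=> //; exact: VU.
Qed.

Lemma sect_ext U s t : open U -> (forall x, U x -> s x = t x) -> sect U s -> sect U t.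
Proof.
move=> oU st sU; apply/(sect_local t oU) => x Ux.
by exists U, s; split=> // y Uy _; rewrite st.
Qed.

Lemma sect0 U : open U -> sect U (fun x : X => 0 : stalk x).
Proof.
move=> oU; apply: (sect_ext oU _ (sectB oU (sect1 oU) (sect1 oU))) => x _.
by rewrite subrr.
Qed.

Lemma sectD U s t : open U -> sect U s -> sect U t -> sect U (fun x => s x + t x).
Proof.
move=> oU sU tU; apply: (sect_ext oU _ (sectB oU sU (sectB oU (sect0 oU) tU))) => x _.
by rewrite sub0r opprK.
Qed.

Lemma sect_sum U (k : nat) (s : 'I_k -> forall x : X, stalk x) : open U ->
  (forall i, sect U (s i)) -> sect U (fun x => \sum_(i < k) s i x).
Proof.
move=> oU; elim: k s => [|k IH] s sU.
  by apply: (sect_ext oU _ (sect0 oU)) => x _; rewrite big_ord0.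
apply: (sect_ext oU _ (sectD oU (sU ord0) (IH _ (fun i => sU (lift ord0 i))))) => x _.
by rewrite big_ord_recl.
Qed.

(** Near [x], a section that extends the germ of an inverse is still an inverse. *)
Lemma sect_invertible U s x : open U -> sect U s -> U x -> invertible (s x) ->
  exists V, [/\ open V, V x & forall y, U y -> V y -> invertible (s y)].
Proof.
move=> oU sU Ux [b sb]; have [W [t [oW Wx tW tx]]] := germ_surj b.
have oUW : open (U `&` W) by exact: openI.
have st := sectB oUW (sectM oUW (sect_sub oU oUW (@subIsetl _ _ _) sU)
  (sect_sub oW oUW (@subIsetr _ _ _) tW)) (sect1 oUW).
have [|V [oV Vx st0]] := germ_inj oUW (conj Ux Wx) st; first by rewrite tx sb subrr.
exists (V `&` W); split=> // [|y Uy [Vy Wy]]; first exact: openI.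
by exists (t y); apply/eqP; rewrite -subr_eq0; apply/eqP; apply: st0.
Qed.

Lemma sect_inv U s t : open U -> sect U s -> (forall x, U x -> s x * t x = 1) ->
  sect U t.
Proof.
move=> oU sU st; apply/(sect_local t oU) => x Ux.
have [W [t' [oW Wx tW tx]]] := germ_surj (t x).
have oUW : open (U `&` W) by exact: openI.
have st' := sectB oUW (sectM oUW (sect_sub oU oUW (@subIsetl _ _ _) sU)
  (sect_sub oW oUW (@subIsetr _ _ _) tW)) (sect1 oUW).
have [|V [oV Vx st0]] := germ_inj oUW (conj Ux Wx) st'; first by rewrite tx st // subrr.
exists (V `&` (U `&` W)), t'; split=> // [||y Uy [Vy [_ Wy]]].
- exact: openI.
- by apply: (sect_sub oW _ _ tW); [exact: openI|move=> ? [? []]].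
- have /eqP : s y * t' y - 1 = 0 by exact: (st0 y (conj Uy Wy) Vy).
  rewrite subr_eq0 => /eqP E.
  apply: (@invertible_mulI _ (s y)); first by exists (t y); exact: st.
  by rewrite ![_ * s y]mulrC E st.
Qed.

End Sections.

(** * Morphisms between spectra of homogeneous primes *)

Section StalkMaps.
Variables (X Y : lrs) (f : lrs_mor X Y) (x : X).
Implicit Types a b : stalk (f x).

Lemma mor_st0 : mor_st f (0 : stalk (f x)) = 0.
Proof. by rewrite -{1}(subrr 0) mor_zmod subrr. Qed.

Lemma mor_stD a b : mor_st f (a + b) = mor_st f a + mor_st f b.
Proof. by rewrite -{1}[b]opprK -[- b]sub0r !mor_zmod mor_st0 sub0r opprK. Qed.

Lemma mor_st_sum k (a : 'I_k -> stalk (f x)) :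
  mor_st f (\sum_(i < k) a i) = \sum_(i < k) mor_st f (a i).
Proof. by apply: (big_morph (fun c : stalk (f x) => mor_st f c) mor_stD mor_st0). Qed.

End StalkMaps.

Lemma hpoint_ext (S : comPzRingType) (gr : grading S) (N : set S) (P Q : hpoint gr N) :
  hprime P = hprime Q -> P = Q.
Proof.
case: P Q => P pP hP rP [Q pQ hQ rQ] /= PQ; subst Q.
by congr HPoint; exact: Prop_irrelevance.
Qed.

(** Equality of homogeneous primes is tested on homogeneous elements, because each
    of them contains the components of its elements. *)
Lemma hprime_ext (S : comPzRingType) (gr : grading S) (N : set S) (P Q : hpoint gr N) :
  (forall e a, gr e a -> (hprime P a <-> hprime Q a)) -> hprime P = hprime Q.
Proof.
move=> PQ; have sub (P' Q' : hpoint gr N) :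
    (forall e a, gr e a -> (hprime P' a <-> hprime Q' a)) -> hprime P' `<=` hprime Q'.
  move=> PQ' a; have [k [c [hc ->]]] := gpart_sum gr a => Pa.
  have [[Q0 QD _] _ _] := hprime_prime Q'.
  elim/big_ind: _ => // i _; apply/PQ'; first exact: hc.
  exact: (hprime_homog (c := c)) Pa i.
by apply/seteqP; split; apply: sub => // e a ea; apply: iff_sym; exact: PQ ea.
Qed.

Lemma frac_eq (S : comPzRingType) (gr : grading S) (N : set S) (P : hpoint gr N)
    (A B : hfrac P) : fnum A = fnum B -> fden A = fden B -> frac A = frac B.
Proof. by move=> nAB dAB; apply: fracE; rewrite nAB dAB. Qed.

Section MorphismsToHSpec.
Variables (X : lrs) (S : comPzRingType) (gr : grading S) (N : set S).
Implicit Types f : lrs_mor X (hspec gr N).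

(** The stalks at [f1 x] and [f2 x] are different types; comparing the values on
    fractions with the same numerator and denominator avoids transport. *)
Lemma hspec_mor_ext f1 f2 :
  (forall x, hprime (f1 x : hpoint gr N) = hprime (f2 x : hpoint gr N)) ->
  (forall x (A : hfrac (f1 x : hpoint gr N)) (B : hfrac (f2 x : hpoint gr N)),
     fnum A = fnum B -> fden A = fden B -> mor_st f1 (frac A) = mor_st f2 (frac B)) ->
  f1 = f2.
Proof.
case: f1 => p1 s1 c1 z1 m1 l1 t1; case: f2 => p2 s2 c2 z2 m2 l2 t2 /= E F.
have Ep : p1 = p2 by apply: funext => x; exact: hpoint_ext.
subst p2; have Es : s1 = s2.
  apply: functional_extensionality_dep => x; apply: funext => a.
  by have [A ->] := frac_surj (a : hloc (p1 x : hpoint gr N)); exact: F.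
by subst s2; congr LRSMor; exact: Prop_irrelevance.
Qed.

Lemma mor_st_frac f1 f2 x (A : hfrac (f1 x : hpoint gr N)) (B : hfrac (f2 x : hpoint gr N)) :
  f1 = f2 -> fnum A = fnum B -> fden A = fden B -> mor_st f1 (frac A) = mor_st f2 (frac B).
Proof. by move=> E; subst f2 => nAB dAB; rewrite (frac_eq nAB dAB). Qed.

End MorphismsToHSpec.

Section Induced.
Variables (S T : comPzRingType) (grS : grading S) (grT : grading T).
Variables (NS : set S) (NT : set T).

(** [f] is the morphism given by [g] on primes and on fractions.  Stated without
    reference to the construction [hmap], this property is stable under
    composition and determines [f]. *)
Definition induced (f : lrs_mor (hspec grT NT) (hspec grS NS)) (g : S -> T) : Prop :=
  forall P : hpoint grT NT,
    (forall a, hprime (f P : hpoint grS NS) a <-> hprime P (g a)) /\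
    forall (A : hfrac (f P : hpoint grS NS)) (B : hfrac P),
      fnum B = g (fnum A) -> fden B = g (fden A) -> mor_st f (frac A) = frac B.

Definition graded_map (g : S -> T) : Prop := forall e a, grS e a -> grT e (g a).

Lemma hmap_induced (g : {rmorphism S -> T}) (dg : forall e a, grS e a -> grT e (g a))
    (rg : forall P : hpoint grT NT, ~ (NS `<=` g @^-1` P)) :
  induced (hmap dg rg) g.
Proof.
move=> P; split=> // A B nE dE.
by rewrite [LHS](@hloc_mapE _ _ _ _ _ _ _ dg rg P A); apply: frac_eq.
Qed.

Lemma induced_eq f1 f2 (g1 g2 : S -> T) : graded_map g1 -> g1 =1 g2 ->
  induced f1 g1 -> induced f2 g2 -> f1 = f2.
Proof.
move=> dg /funext E; subst g2 => i1 i2; apply: hspec_mor_ext => P.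
  by apply/seteqP; split=> a; [move/(i1 P).1/(i2 P).1|move/(i2 P).1/(i1 P).1].
move=> A B nE dE; have nd : ~ hprime P (g1 (fden A)).
  by move=> /(i1 P).1; exact: fden_nin.
rewrite ((i1 P).2 A (HFrac (dg _ _ (fnum_deg A)) (dg _ _ (fden_deg A)) nd)) //.
by rewrite ((i2 P).2 B (HFrac (dg _ _ (fnum_deg A)) (dg _ _ (fden_deg A)) nd)) //= ?nE ?dE.
Qed.

End Induced.

Lemma induced_comp (S T V : comPzRingType) (grS : grading S) (grT : grading T)
    (grV : grading V) (NS : set S) (NT : set T) (NV : set V)
    (f : lrs_mor (hspec grT NT) (hspec grS NS)) (h : lrs_mor (hspec grV NV) (hspec grT NT))
    (g : S -> T) (k : T -> V) :
  graded_map grS grT g -> induced f g -> induced h k -> induced (f \O h) (k \o g).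
Proof.
move=> dg fi hi P; split=> [a|A B nE dE].
  by split=> [/(fi _).1/(hi _).1|/(hi _).1/(fi _).1].
have nd : ~ hprime (h P : hpoint grT NT) (g (fden A)).
  by move=> /(fi _).1; exact: fden_nin.
rewrite /= ((fi (h P)).2 A (HFrac (dg _ _ (fnum_deg A)) (dg _ _ (fden_deg A)) nd)) //.
exact: (hi P).2.
Qed.

(** * Direct gradings *)

Definition direct (S : comPzRingType) (gr : grading S) : Prop :=
  homogeneous gr [set 0].

Lemma gr_sum (S : comPzRingType) (gr : grading S) e (I : Type) (r : seq I) (P : pred I)
    (F : I -> S) : (forall i, P i -> gr e (F i)) -> gr e (\sum_(i <- r | P i) F i).
Proof.
by move=> h; apply: big_ind h => [|a b]; [exact: gpart0|exact: gpartD].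
Qed.

Section Components.
Variables (S : comPzRingType) (gr : grading S).
Hypothesis gr_direct : direct gr.

Let decomp (a : S) (F : nat -> S) : Prop :=
  (forall e, gr e (F e)) /\
  exists k, (forall e, (k <= e)%N -> F e = 0) /\ a = \sum_(0 <= i < k) F i.

Let decomp_widen a F k K : (k <= K)%N -> (forall e, (k <= e)%N -> F e = 0) ->
  a = \sum_(0 <= i < k) F i -> a = \sum_(0 <= i < K) F i :> S.
Proof.
move=> kK F0 ->; rewrite [RHS](big_cat_nat (leq0n k) kK) /= [X in _ + X]big_nat_cond.
by rewrite [X in _ + X]big1 ?addr0 // => i /andP[/andP[/F0]].
Qed.

Let decomp_exists a : exists F, decomp a F.
Proof.
have [k [c [hc ->]]] := gpart_sum gr a.
pose F e := oapp c 0 (insub e : option 'I_k); exists F; split=> [e|].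
  by rewrite /F; case: insubP => [i _ <-|_] /=; [exact: hc|exact: gpart0].
exists k; split=> [e ke|]; first by rewrite /F insubN // -leqNgt.
by rewrite big_mkord; apply: eq_bigr => i _; rewrite /F valK.
Qed.

Let decomp_unique a F G : decomp a F -> decomp a G -> forall e, F e = G e.
Proof.
move=> [hF [k [F0 Fa]]] [hG [l [G0 Ga]]] e.
pose K := maxn e.+1 (maxn k l).
have Fa' := @decomp_widen a F k K (leq_trans (leq_maxl _ _) (leq_maxr _ _)) F0 Fa.
have Ga' := @decomp_widen a G l K (leq_trans (leq_maxr _ _) (leq_maxr _ _)) G0 Ga.
have eK : (e < K)%N by exact: leq_maxl.
apply/eqP; rewrite -subr_eq0; apply/eqP.
apply: (gr_direct (c := fun i : 'I_K => F i - G i) _ _ (Ordinal eK)) => [i|].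
  exact: gpartB.
by rewrite /= sumrB -!(big_mkord xpredT) -Fa' -Ga' subrr.
Qed.

Lemma direct_components : exists comp : nat -> S -> S,
  [/\ forall e a, gr e (comp e a), forall e, zmod_morphism (comp e),
      forall a, exists k, a = \sum_(i < k) comp i a &
      forall e f a, gr f a -> comp e a = if e == f then a else 0].
Proof.
have /choice[cmp cmpP] := decomp_exists.
exists (fun e a => cmp a e); split=> [e a|e a b|a|e f a fa].
- exact: (cmpP a).1.
- apply: (decomp_unique (a := a - b) (G := fun e => cmp a e - cmp b e)) => //.
  have [ha [k [a0 aE]]] := cmpP a; have [hb [l [b0 bE]]] := cmpP b.
  split=> [{}e|]; first exact: gpartB.
  exists (maxn k l); split=> [{}e|].
    by rewrite geq_max => /andP[/a0 -> /b0 ->]; rewrite subr0.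
  by rewrite sumrB -(decomp_widen (leq_maxl _ _) a0 aE) -(decomp_widen (leq_maxr _ _) b0 bE).
- by have [_ [k [_ aE]]] := cmpP a; exists k; rewrite -(big_mkord xpredT (cmp a)).
- apply: (decomp_unique (a := a) (G := fun e => if e == f then a else 0)) => //.
  split=> [{}e|]; first by case: eqP => [->|_] //; exact: gpart0.
  exists f.+1; split=> [{}e|]; first by rewrite ltn_neqAle eq_sym => /andP[/negPf ->].
  rewrite big_nat_recr //= eqxx big_nat_cond big1 ?add0r // => i /andP[/andP[_]].
  by rewrite ltn_neqAle => /andP[/negPf ->].
Qed.

(** A homogeneous prime can be built from its complement among the homogeneous
    elements.  Multiplicativity of [U] alone does not rule out zero divisors in
    mixed degrees; as usual, the product of the lowest components outside the
    prime decides. *)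
Lemma prime_of_units (U : nat -> S -> Prop) :
    U 0%N 1 -> (forall e, ~ U e 0) ->
    (forall e f a b, gr e a -> gr f b -> (U (e + f)%N (a * b) <-> U e a /\ U f b)) ->
    (forall e a b, gr e a -> gr e b -> U e (a + b) -> U e a \/ U e b) ->
  exists P : set S, [/\ prime_ideal P, homogeneous gr P &
    forall e a, gr e a -> (P a <-> ~ U e a)].
Proof.
move=> U1 U0 UM UD; have [comp [comp_gr compB comp_sum comp_hom]] := direct_components.
pose P := [set a | forall e, ~ U e (comp e a)].
have comp0 e : comp e 0 = 0 by rewrite -[0 in LHS]subr0 compB subrr.
have compD e a b : comp e (a + b) = comp e a + comp e b.
  by rewrite -{1}[b]opprK -[- b]sub0r !compB comp0 sub0r opprK.
have comp_bigsum e k (c : 'I_k -> S) : comp e (\sum_(i < k) c i) = \sum_(i < k) comp e (c i).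
  by apply: (big_morph (comp e)) => //; exact: compD.
have Phom e a : gr e a -> (P a <-> ~ U e a).
  move=> ea; split=> [/(_ e)|nU f]; first by rewrite (comp_hom _ _ _ ea) eqxx.
  by rewrite (comp_hom _ _ _ ea); case: eqP => [->|_] //; exact: U0.
have P0 : P 0 by move=> e; rewrite comp0; exact: U0.
have PD a b : P a -> P b -> P (a + b).
  by move=> Pa Pb e; rewrite compD => /UD[||/Pa|/Pb].
have Psum k (c : 'I_k -> S) : (forall i, P (c i)) -> P (\sum_(i < k) c i).
  by move=> Pc; elim/big_ind: _.
have PM a b : P b -> P (a * b).
  move=> Pb; have [k ->] := comp_sum a; have [l ->] := comp_sum b.
  rewrite mulr_suml; apply: (Psum) => i; rewrite mulr_sumr; apply: (Psum) => j.
  apply/(Phom (i + j)%N); first by apply: gpartM; exact: comp_gr.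
  by move=> /UM[]// _; exact: Pb.
have PN a : P a -> P (- a) by move=> Pa; rewrite -mulN1r; exact: PM.
exists P; split=> //; last first.
  move=> k c hc; rewrite /P /= => Pc i; apply/(Phom i); first exact: hc.
  have := Pc i; rewrite comp_bigsum (bigD1 i) //= (comp_hom _ _ _ (hc i)) eqxx.
  rewrite big1 ?addr0 // => j ji; rewrite (comp_hom _ _ _ (hc j)).
  by rewrite -val_eqE /= eq_sym in ji; rewrite (negPf ji).
split; [by split|by move/(_ 0%N); rewrite (comp_hom _ _ _ (gpart1 gr)) eqxx|].
move=> a b Pab; apply: contrapT => /not_orP[nPa nPb].
have low c : ~ P c -> exists e, U e (comp e c) /\ forall f, (f < e)%N -> ~ U f (comp f c).
  move=> /existsNP[e /contrapT Ue].
  have ex : exists e, `[< U e (comp e c) >] by exists e; apply/asboolP.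
  case: (ex_minnP ex) => {Ue}e /asboolP Ue emin; exists e; split=> // f fe Uf.
  by have := emin f (asboolT Uf); rewrite leqNgt fe.
have [e [Ue elow]] := low _ nPa; have [f [Uf flow]] := low _ nPb.
have [k aE] := comp_sum a; have [l bE] := comp_sum b.
have ek : (e < k)%N.
  rewrite ltnNge; apply/negP => ke; apply: (U0 e); rewrite aE comp_bigsum in Ue.
  move: Ue; rewrite big1 // => i _; rewrite (comp_hom _ _ _ (comp_gr i a)).
  by rewrite gtn_eqF // (leq_trans (ltn_ord i)).
have fl : (f < l)%N.
  rewrite ltnNge; apply/negP => lf; apply: (U0 f); rewrite bE comp_bigsum in Uf.
  move: Uf; rewrite big1 // => i _; rewrite (comp_hom _ _ _ (comp_gr i b)).
  by rewrite gtn_eqF // (leq_trans (ltn_ord i)).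
have : P (comp e a * comp f b).
  pose F (p : 'I_k * 'I_l) := comp (e + f)%N (comp p.1 a * comp p.2 b).
  have cE : comp (e + f)%N (a * b) = \sum_p F p.
    rewrite {1}aE {1}bE mulr_suml comp_bigsum -(pair_bigA _ (fun i j => F (i, j))) /=.
    by apply: eq_bigr => i _; rewrite mulr_sumr comp_bigsum.
  have FE p : F p = if (e + f == p.1 + p.2)%N then comp p.1 a * comp p.2 b else 0.
    by rewrite /F (comp_hom _ _ _ (gpartM (comp_gr _ _) (comp_gr _ _))).
  have -> : comp e a * comp f b = comp (e + f)%N (a * b)
      - \sum_(p | p != (Ordinal ek, Ordinal fl)) F p.
    by rewrite cE (bigD1 (Ordinal ek, Ordinal fl)) //= FE /= eqxx addrK.
  apply: (PD); first by apply/(Phom _ _ (comp_gr (e + f)%N _)).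
  apply: (PN); elim/big_ind: _ => // -[i j]; rewrite FE /= => ij.
  case: eqP => [efE|//]; have ijlow : (i < e)%N \/ (j < f)%N.
    apply/orP; rewrite -[(_ || _)]negbK negb_or -!leqNgt; apply: contra ij => /andP[ei fj].
    have ie : i = e :> nat.
      apply/eqP; rewrite eqn_leq ei andbT -(leq_add2r f) efE leq_add2l.
      exact: fj.
    have jf : j = f :> nat by apply/eqP; rewrite -(eqn_add2l e) efE ie.
    by apply/eqP; congr pair; apply: val_inj.
  apply/(Phom (i + j)%N); first by apply: gpartM; exact: comp_gr.
  move=> /UM[]//; case: ijlow => [/elow nU U_ _|/flow nU _ U_]; exact: nU.
move/(Phom (e + f)%N); apply; first by apply: gpartM; exact: comp_gr.
by apply/UM.
Qed.

End Components.

(** * Base change of Proj *)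

Section BaseChange.
Variables (S T : comPzRingType) (grS : grading S) (grT : grading T).
Variables (B B' : comPzRingType).
Variables (g : {rmorphism S -> T}) (psi : {rmorphism B -> S}).
Variables (phi : {rmorphism B' -> T}) (chi : {rmorphism B -> B'}).

(** Every graded piece of [T] has the universal property of [S_e (x)_B B'], for
    those balanced maps that are products of a ring homomorphism on [B'] and an
    additive map on [S_e]; these are the only ones that a morphism to a fibre
    product produces. *)
Definition graded_base_change : Prop :=
  [/\ graded_map grS grT g,
      (forall b, grS 0%N (psi b)) /\ (forall b, grT 0%N (phi b)),
      (forall b, g (psi b) = phi (chi b)),
      (forall e F, grT e F -> exists k (b : 'I_k -> B') (s : 'I_k -> S),
         (forall i, grS e (s i)) /\ F = \sum_(i < k) phi (b i) * g (s i)) &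
      (forall e (O : comPzRingType) (rho : B' -> O) (lam : S -> O),
         zmod_morphism rho -> monoid_morphism rho ->
         (forall s t, grS e s -> grS e t -> lam (s + t) = lam s + lam t) ->
         (forall b s, grS e s -> lam (psi b * s) = rho (chi b) * lam s) ->
         exists Phi : T -> O,
           (forall F G, grT e F -> grT e G -> Phi (F + G) = Phi F + Phi G) /\
           (forall b s, grS e s -> Phi (phi b * g s) = rho b * lam s))].

Hypothesis T_direct : direct grT.
Hypothesis gbc : graded_base_change.

Let g_deg : graded_map grS grT g. Proof. by case: gbc. Qed.
Let psi_deg b : grS 0%N (psi b). Proof. by case: gbc => _ []. Qed.
Let phi_deg b : grT 0%N (phi b). Proof. by case: gbc => _ []. Qed.
Let gpsi b : g (psi b) = phi (chi b). Proof. by case: gbc. Qed.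
Let T_gen e F : grT e F -> exists k (b : 'I_k -> B') (s : 'I_k -> S),
  (forall i, grS e (s i)) /\ F = \sum_(i < k) phi (b i) * g (s i).
Proof. by case: gbc => _ _ _ + _; apply. Qed.

Variables (f : lrs_mor (Proj grS) (Spec B)) (h : lrs_mor (Spec B') (Spec B)).
Variables (p : lrs_mor (Proj grT) (Proj grS)) (q : lrs_mor (Proj grT) (Spec B')).
Hypotheses (f_ind : induced f psi) (h_ind : induced h chi).
Hypotheses (p_ind : induced p g) (q_ind : induced q phi).

Lemma base_change_commutes : f \O p = h \O q.
Proof.
have dpsi : graded_map (triv_grading B) grS psi.
  move=> [|e] b; first by move=> _; exact: psi_deg.
  by move=> ->//; rewrite rmorph0; exact: gpart0.
have dchi : graded_map (triv_grading B) (triv_grading B') chi.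
  by move=> e b eb e0; rewrite eb // rmorph0.
apply: (@induced_eq _ _ _ _ _ _ _ _ (g \o psi) (phi \o chi)) => //.
- by move=> e b eb; apply: g_deg; exact: dpsi.
- exact: induced_comp.
- exact: induced_comp.
Qed.

(** Let [x] be a point of [X], [l] of degree [e] in [S] a homogeneous element that
    does not vanish at [a x], and [F] of degree [e] in [T]. The fraction [F / g l]
    has a value [Phi x e l F] in the stalk at [x], by the universal property of [T]
    in degree [e]. The morphism [u] to [Proj T] sends [x] to the prime generated by
    the homogeneous [G] of which no multiple has an invertible value of this kind;
    [u] is determined by these values on fractions. Working with multiples of [G]
    makes the primality of [upt x] and the uniqueness of the stalk maps formal;
    powers of [G] only occur in the proof that [u] is unique. *)
Section Lift.
Variables (X : lrs) (a : lrs_mor X (Proj grS)) (b : lrs_mor X (Spec B')).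
Hypothesis fa_hb : f \O a = h \O b.

Let apt (x : X) : hpoint grS (irrelevant grS) := a x.
Let bpt (x : X) : hpoint (triv_grading B') setT := b x.

Let one_nin (R : comPzRingType) (gr : grading R) N (P : hpoint gr N) : ~ hprime P 1.
Proof. by case: (hprime_prime P). Qed.

Let triv0 (R : comPzRingType) (c : R) : triv_grading R 0%N c.
Proof. by []. Qed.

Let const (P : hpoint (triv_grading B') setT) (c : B') : hfrac P :=
  HFrac (triv0 c) (triv0 1) (@one_nin _ _ _ P).

Let rho x (c : B') : stalk x := mor_st b (frac (const (bpt x) c)).

Let rho_zmod x : zmod_morphism (rho x).
Proof.
by move=> c d; rewrite /rho -(mor_zmod b) fracB; congr (mor_st b _); apply: fracE => /=; ring.
Qed.

Let rho_monoid x : monoid_morphism (rho x).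
Proof.
split=> [|c d]; last first.
  by rewrite /rho -(mor_monoid b x).2 fracM; congr (mor_st b _); apply: fracE => /=; ring.
by rewrite -(mor_monoid b x).1 /rho frac1; congr (mor_st b _); exact: fracE.
Qed.

(* the value at [x] of the fraction [s / l] *)
Let lam x (l s : S) : stalk x :=
  match pselect (exists A : hfrac (apt x), fnum A = s /\ fden A = l) with
  | left E => mor_st a (frac (sval (cid E)))
  | right _ => 0
  end.

Let lamE x (A : hfrac (apt x)) : lam x (fden A) (fnum A) = mor_st a (frac A).
Proof.
rewrite /lam; case: pselect => [E|[]]; last by exists A.
by case: cid => A' [nE dE] /=; congr (mor_st a _); exact: frac_eq.
Qed.

Let adm x e (l : S) : Prop := grS e l /\ ~ hprime (apt x) l.

Let lamE' x e l s (al : adm x e l) (es : grS e s) :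
  lam x l s = mor_st a (frac (HFrac es al.1 al.2)).
Proof. exact: (lamE (HFrac es al.1 al.2)). Qed.

Let adm1 x : adm x 0 1.
Proof. by split; [exact: gpart1|exact: one_nin]. Qed.

Let admM x e l e' l' : adm x e l -> adm x e' l' -> adm x (e + e')%N (l * l').
Proof.
move=> [el nl] [el' nl']; split; first exact: gpartM.
by case: (hprime_prime (apt x)) => _ _ PP /PP[].
Qed.

Let lamD x e l s t : adm x e l -> grS e s -> grS e t -> lam x l (s + t) = lam x l s + lam x l t.
Proof.
move=> al es et; rewrite (lamE' al es) (lamE' al et) (lamE' al (gpartD es et)).
by rewrite -mor_stD fracD; congr (mor_st a _); apply: fracE => /=; ring.
Qed.

Let lamM x e l s e' l' s' : adm x e l -> grS e s -> adm x e' l' -> grS e' s' ->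
  lam x (l * l') (s * s') = lam x l s * lam x l' s'.
Proof.
move=> al es al' es'; rewrite (lamE' al es) (lamE' al' es').
rewrite (lamE' (admM al al') (gpartM es es')) -(mor_monoid a x).2 fracM.
by congr (mor_st a _); exact: fracE.
Qed.

Let lam_self x e l : adm x e l -> lam x l l = 1.
Proof.
move=> al; rewrite (lamE' al al.1) -(mor_monoid a x).1 frac1.
by congr (mor_st a _); apply: fracE => /=; ring.
Qed.

(* the only place where the two given morphisms are compared over [Spec B] *)
Let lam_psi x c : lam x 1 (psi c) = rho x (chi c).
Proof.
have fax : forall d, hprime ((f \O a) x : hpoint (triv_grading B) setT) d <->
    hprime (apt x) (psi d) by exact: (f_ind (apt x)).1.
have hbx : forall d, hprime ((h \O b) x : hpoint (triv_grading B) setT) d <->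
    hprime (bpt x) (chi d) by exact: (h_ind (bpt x)).1.
pose A1 : hfrac ((f \O a) x : hpoint (triv_grading B) setT) :=
  HFrac (triv0 c) (triv0 1) (@one_nin _ _ _ _).
pose A2 : hfrac ((h \O b) x : hpoint (triv_grading B) setT) :=
  HFrac (triv0 c) (triv0 1) (@one_nin _ _ _ _).
have := mor_st_frac (A := A1) (B := A2) fa_hb erefl erefl.
rewrite (lamE' (adm1 x) (psi_deg c)) /=.
rewrite (((f_ind (apt x)).2 A1) (HFrac (psi_deg c) (adm1 x).1 (adm1 x).2)) ?rmorph1 // => ->.
by rewrite (((h_ind (bpt x)).2 A2) (const (bpt x) (chi c))) ?rmorph1.
Qed.

Let Phi_exists x e l : exists Phi : T -> stalk x, adm x e l ->
  (forall F G, grT e F -> grT e G -> Phi (F + G) = Phi F + Phi G) /\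
  (forall c s, grS e s -> Phi (phi c * g s) = rho x c * lam x l s).
Proof.
have [al|nal] := pselect (adm x e l); last by exists (fun=> 0).
have [_ _ _ _ univ] := gbc.
have [|c s es|Phi PhiP] := univ e (stalk x) (rho x) (lam x l) (@rho_zmod x) (@rho_monoid x).
- by move=> s t es et; apply: (lamD al).
- by rewrite -lam_psi -(lamM (adm1 x) (psi_deg c) al es) mul1r.
by exists Phi.
Qed.

(* the value at [x] of the fraction [F / g l] *)
Let Phi x e l : T -> stalk x := sval (cid (Phi_exists x e l)).

Let PhiD x e l F G : adm x e l -> grT e F -> grT e G ->
  Phi x e l (F + G) = Phi x e l F + Phi x e l G.
Proof. by move=> al; move: F G; rewrite /Phi; case: cid => P /= /(_ al)[]. Qed.

Let Phi_gen x e l c s : adm x e l -> grS e s ->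
  Phi x e l (phi c * g s) = rho x c * lam x l s.
Proof. by move=> al; move: c s; rewrite /Phi; case: cid => P /= /(_ al)[]. Qed.

Let Phi0 x e l : adm x e l -> Phi x e l 0 = 0.
Proof.
move=> al; have := PhiD al (gpart0 grT e) (gpart0 grT e).
by rewrite addr0 => /eqP; rewrite -subr_eq0 opprD addNKr oppr_eq0 => /eqP.
Qed.

Let gen_deg e c s : grS e s -> grT e (phi c * g s).
Proof. by move=> es; rewrite -[e]add0n; apply: gpartM; [exact: phi_deg|exact: g_deg]. Qed.

Let Phi_bigsum x e l k (F : 'I_k -> T) : adm x e l -> (forall i, grT e (F i)) ->
  Phi x e l (\sum_(i < k) F i) = \sum_(i < k) Phi x e l (F i).
Proof.
move=> al eF; elim: k F eF => [|k IH] F eF; first by rewrite !big_ord0 Phi0.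
rewrite !big_ord_recl PhiD //; first by rewrite IH.
by apply: gr_sum.
Qed.

Let Phi_sum x e l k (c : 'I_k -> B') (s : 'I_k -> S) : adm x e l ->
  (forall i, grS e (s i)) ->
  Phi x e l (\sum_(i < k) phi (c i) * g (s i)) = \sum_(i < k) rho x (c i) * lam x l (s i).
Proof.
move=> al es; rewrite Phi_bigsum //; last by move=> i; exact: gen_deg.
by apply: eq_bigr => i _; rewrite Phi_gen.
Qed.

Let PhiM x e l F e' l' F' : adm x e l -> grT e F -> adm x e' l' -> grT e' F' ->
  Phi x (e + e')%N (l * l') (F * F') = Phi x e l F * Phi x e' l' F'.
Proof.
move=> al eF al' eF'; have [k [c [s [es FE]]]] := T_gen eF.
have [k' [c' [s' [es' FE']]]] := T_gen eF'; rewrite FE FE' !Phi_sum // !mulr_suml.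
rewrite Phi_bigsum //; first last.
- move=> i; rewrite -FE'; apply: gpartM => //; exact: gen_deg.
- exact: admM.
apply: eq_bigr => i _; rewrite !mulr_sumr Phi_bigsum //; first last.
- by move=> j; apply: gpartM; exact: gen_deg.
- exact: admM.
apply: eq_bigr => j _.
have -> : phi (c i) * g (s i) * (phi (c' j) * g (s' j)) =
    phi (c i * c' j) * g (s i * s' j) by rewrite !rmorphM; ring.
rewrite Phi_gen; first last.
- by apply: gpartM.
- exact: admM.
by rewrite (rho_monoid x).2 (lamM al (es i) al' (es' j)); ring.
Qed.

Let PhiME x e l F e' l' F' k m H : adm x e l -> grT e F -> adm x e' l' -> grT e' F' ->
  k = (e + e')%N -> m = l * l' -> H = F * F' ->
  Phi x k m H = Phi x e l F * Phi x e' l' F'.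
Proof. by move=> al eF al' eF' -> -> ->; exact: PhiM. Qed.

Let rho1 x : rho x 1 = 1. Proof. exact: (rho_monoid x).1. Qed.

Let Phi_g x e l s : adm x e l -> grS e s -> Phi x e l (g s) = lam x l s.
Proof. by move=> al es; rewrite -[g s]mul1r -(rmorph1 phi) Phi_gen // rho1 mul1r. Qed.

Let Phi_self x e l : adm x e l -> Phi x e l (g l) = 1.
Proof. by move=> al; rewrite Phi_g ?(lam_self al) //; exact: al.1. Qed.

Let Phi_phi x c : Phi x 0 1 (phi c) = rho x c.
Proof.
rewrite -[phi c]mulr1 -(rmorph1 g) Phi_gen; [|exact: adm1|exact: gpart1].
by rewrite (lam_self (adm1 x)) mulr1.
Qed.

Let Phi_scale x k l c K : adm x k l -> grT k K ->
  Phi x (0 + k)%N l (phi c * K) = rho x c * Phi x k l K.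
Proof. by move=> al kK; rewrite -Phi_phi -(PhiM (adm1 x)) ?mul1r. Qed.

Let open_adm l : homog_set grS l -> open [set x : X | ~ hprime (apt x) l].
Proof. by move=> hl; exact: (mor_cont a (open_D (irrelevant grS) hl)). Qed.

Let rho_sect c : sect setT (fun x : X => rho x c).
Proof.
have oT : open [set: Spec B'] by exact: openT.
pose t (P : hpoint (triv_grading B') setT) : hloc P := frac (const P c).
have tT : @sect (Spec B') setT t.
  by move=> P _; exists setT, c, 1; split=> // Q _ _; exists (const Q c).
exact: (mor_sect b oT tT).
Qed.

Let lam_sect e l s : grS e l -> grS e s ->
  sect [set x : X | ~ hprime (apt x) l] (fun x : X => lam x l s).
Proof.
move=> el es; have hl : homog_set grS l by exists e.
have oD := open_D (irrelevant grS) hl.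
pose t (P : hpoint grS (irrelevant grS)) : hloc P :=
  match pselect (hprime P l) with
  | left _ => 0
  | right n => frac (HFrac es el n)
  end.
have tD : @sect (Proj grS) [set P : hpoint grS (irrelevant grS) | ~ hprime P l] t.
  move=> P nP; exists setT, s, l; split=> //; first exact: openT.
  move=> Q nQ _; exists (HFrac es el nQ); split=> //; rewrite /t; case: pselect => // n.
  exact: frac_eq.
apply: (sect_ext _ _ (mor_sect a oD tD)) => [|x nx]; first exact: (mor_cont a oD).
rewrite (lamE' (conj el nx : adm x e l) es) /t; case: pselect => // n.
by congr (mor_st a _); exact: frac_eq.
Qed.

Let Phi_sect e l F : grS e l -> grT e F ->
  sect [set x : X | ~ hprime (apt x) l] (fun x : X => Phi x e l F).
Proof.
move=> el eF; have [k [c [s [es FE]]]] := T_gen eF.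
have oD : open [set x : X | ~ hprime (apt x) l] by apply: open_adm; exists e.
apply: (sect_ext oD _ (sect_sum (s := fun i x => rho x (c i) * lam x l (s i)) oD _)).
  by move=> x nx; rewrite FE Phi_sum.
move=> i; apply: (sectM oD); last exact: (lam_sect el).
exact: (sect_sub (@openT X) oD _ (rho_sect (c i))).
Qed.

(** [G] does not vanish at [x] in the fibre product. *)
Let unit x e (G : T) : Prop := exists e' K l,
  [/\ grT e' K, adm x (e + e')%N l & invertible (Phi x (e + e')%N l (G * K))].

Let unit1 x : unit x 0 1.
Proof.
exists 0%N, 1, 1; split; [exact: gpart1|exact: adm1|].
by rewrite mulr1 addn0 -(rmorph1 phi) Phi_phi rho1; exact: invertible1.
Qed.

Let unit0 x e : ~ unit x e 0.
Proof.
move=> [e' [K [l [_ al]]]]; rewrite mul0r Phi0 //.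
exact: local_ring0 (@stalk_local X x).
Qed.

Let unitM x e e' F G : grT e F -> grT e' G ->
  (unit x (e + e')%N (F * G) <-> unit x e F /\ unit x e' G).
Proof.
move=> eF eG; split=> [[k [K [l [kK al inv]]]]|[]].
  split.
  - exists (e' + k)%N, (G * K), l; rewrite addnA mulrA; split=> //.
    exact: gpartM.
  - exists (e + k)%N, (F * K), l; split; first exact: gpartM.
      by rewrite addnCA addnA.
    by rewrite addnCA addnA mulrCA mulrA.
move=> [k [K [l [kK al inv]]]] [k' [K' [l' [kK' al' inv']]]].
exists (k + k')%N, (K * K'), (l * l'); rewrite addnACA mulrACA; split.
- exact: gpartM.
- exact: admM.
- by rewrite PhiM //; [apply/invertibleMP|exact: gpartM|exact: gpartM].
Qed.

Let unitD x e F G : grT e F -> grT e G -> unit x e (F + G) -> unit x e F \/ unit x e G.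
Proof.
move=> eF eG [k [K [l [kK al]]]]; rewrite mulrDl PhiD //; try exact: gpartM.
by move=> /(stalk_local x).2[inv|inv]; [left|right]; exists k, K, l.
Qed.

Let unit_g x e l : adm x e l -> unit x e (g l).
Proof.
move=> al; exists 0%N, 1, l; rewrite addn0 mulr1; split=> //; first exact: gpart1.
by rewrite Phi_self //; exact: invertible1.
Qed.

Let apt_relevant x : exists e l, (0 < e)%N /\ adm x e l.
Proof.
apply: contrapT => H; apply: (hprime_rel (h := apt x)) => l [e e0 el].
by apply: contrapT => nl; apply: H; exists e, l.
Qed.

Let lift_exists x : exists P : hpoint grT (irrelevant grT),
  forall e F, grT e F -> (hprime P F <-> ~ unit x e F).
Proof.
have [P [pP hP PE]] := prime_of_units T_direct (unit1 x) (@unit0 x) (@unitM x) (@unitD x).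
have rP : ~ (irrelevant grT `<=` P).
  have [e [l [e0 al]]] := apt_relevant x => /(_ (g l)) H.
  have el := g_deg al.1; apply: ((PE _ _ el).1 _ (unit_g al)).
  by apply: H; exists e.
by exists (HPoint pP hP rP).
Qed.

Let upt x : hpoint grT (irrelevant grT) := sval (cid (lift_exists x)).

Let uptP x e F : grT e F -> (hprime (upt x) F <-> ~ unit x e F).
Proof. by rewrite /upt; case: cid => P /= H; exact: H. Qed.

Let unit_upt x e F : grT e F -> ~ hprime (upt x) F -> unit x e F.
Proof. by move=> eF nF; apply: contrapT => /(uptP x eF). Qed.

(* [v] is the value at [x] of [F / G], tested on all multiples of the denominator
   that have a value *)
Let isval x e (F G : T) (v : stalk x) : Prop := forall k K l,
  grT k K -> adm x (e + k)%N l ->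
  v * Phi x (e + k)%N l (G * K) = Phi x (e + k)%N l (F * K).

Let val_exists x (A : hfrac (upt x)) : exists v : stalk x, isval (fdeg A) (fnum A) (fden A) v.
Proof.
have [k0 [K0 [l0 [kK0 al0 inv0]]]] := unit_upt (fden_deg A) (@fden_nin _ _ _ _ A).
have [w Ew] := inv0.
exists (Phi x (fdeg A + k0)%N l0 (fnum A * K0) * w) => k K l kK al.
have dA := gpartM (fden_deg A) kK0; have nA := gpartM (fnum_deg A) kK0.
have dB := gpartM (fden_deg A) kK; have nB := gpartM (fnum_deg A) kK.
apply: (invertible_mulI inv0).
have -> : forall y z t u : stalk x, y * z * t * u = y * t * (u * z) by move=> *; ring.
rewrite Ew mulr1 -!PhiM //; congr (Phi _ _ _ _); first exact: addnC.
  exact: mulrC.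
by ring.
Qed.

Let val x (A : hfrac (upt x)) : stalk x := sval (cid (val_exists A)).
Let valP x (A : hfrac (upt x)) : isval (fdeg A) (fnum A) (fden A) (val A).
Proof. by rewrite /val; case: cid. Qed.

Let isval_uniq x e e' F G F' G' v v' u : homog_set grT u -> ~ hprime (upt x) u ->
  grT e F -> grT e G -> ~ hprime (upt x) G ->
  grT e' F' -> grT e' G' -> ~ hprime (upt x) G' ->
  isval e F G (v : stalk x) -> isval e' F' G' (v' : stalk x) ->
  u * (F * G') = u * (F' * G) -> v = v'.
Proof.
move=> [d du] nu eF eG nG eF' eG' nG' vE vE' E.
have [k [K [l [kK al inv]]]] := unit_upt eG nG.
have [k' [K' [l' [kK' al' inv']]]] := unit_upt eG' nG'.
have [j [L [m [jL am invu]]]] := unit_upt du nu.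
have eGK := gpartM eG kK; have eGK' := gpartM eG' kK'; have duL := gpartM du jL.
have eFK := gpartM eF kK; have eFK' := gpartM eF' kK'.
have inv3 : invertible (Phi x (e + k)%N l (G * K) *
    (Phi x (e' + k')%N l' (G' * K') * Phi x (d + j)%N m (u * L))).
  by apply/invertibleMP; split=> //; apply/invertibleMP.
apply: (invertible_mulI inv3); rewrite !mulrA (vE _ _ _ kK al).
have -> : v' * Phi x (e + k)%N l (G * K) * Phi x (e' + k')%N l' (G' * K') =
   v' * Phi x (e' + k')%N l' (G' * K') * Phi x (e + k)%N l (G * K) by ring.
rewrite (vE' _ _ _ kK' al') [X in _ = X * _]mulrC -!PhiM //; try exact: admM; try exact: gpartM.
congr (Phi _ _ _ _); transitivity (u * (F * G') * (K * K' * L)); first by ring.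
by rewrite E; ring.
Qed.

Let ust x (c : hloc (upt x)) : stalk x := val (repr c).

Let ustE x (A : hfrac (upt x)) v : isval (fdeg A) (fnum A) (fden A) (v : stalk x) ->
  ust (frac A) = v.
Proof.
have /fracP[u [hu nu E]] : frac (repr (frac A)) = frac A by rewrite {1}/frac reprK.
move=> vE; apply: (isval_uniq hu nu _ _ _ _ _ _ (@valP x _) vE E);
  first [exact: fnum_deg|exact: fden_deg|exact: fden_nin].
Qed.

Let ust_zmod x : zmod_morphism (@ust x).
Proof.
move=> c d; have [A ->] := frac_surj c; have [A' ->] := frac_surj d.
rewrite fracB [ust (frac A)](ustE (@valP x A)) [ust (frac A')](ustE (@valP x A')).
apply: ustE => k K l kK /= al; have := fnum_deg A; have := fden_deg A.
move: (@valP x A) (@valP x A') (fnum_deg A') (fden_deg A').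
move: (val A) (val A') (fdeg A) (fdeg A') (fnum A) (fden A) (fnum A') (fden A') al.
move=> v v' e e' F G F' G' al vE vE' eF' eG' eG eF.
have al1 : adm x (e + (e' + k))%N l by rewrite addnA.
have al2 : adm x (e' + (e + k))%N l by rewrite addnCA addnA.
have := vE _ _ _ (gpartM eG' kK) al1; have := vE' _ _ _ (gpartM eG kK) al2.
rewrite (addnCA e' e k) (addnA e e' k) => E' E.
have -> : (F * G' + G * - F') * K = F * (G' * K) - F' * (G * K) by ring.
rewrite PhiD // ?mulrBl; last 2 first.
- by rewrite mulrA; apply: gpartM => //; exact: gpartM.
- apply: gpartN; rewrite (_ : (e + e' + k)%N = (e' + (e + k))%N); last by lia.
  by apply: gpartM => //; exact: gpartM.
have PhiN H : grT (e + e' + k)%N H -> Phi x (e + e' + k)%N l (- H) = - Phi x (e + e' + k)%N l H.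
  move=> eH; apply/eqP; rewrite -addr_eq0 -PhiD // ?addNr ?Phi0 //.
  exact: gpartN.
rewrite PhiN; last first.
  rewrite (_ : (e + e' + k)%N = (e' + (e + k))%N); last by lia.
  by apply: gpartM => //; exact: gpartM.
rewrite -E -E'; congr (_ * Phi _ _ _ _ - _ * Phi _ _ _ _); ring.
Qed.

Let ust_monoid x : monoid_morphism (@ust x).
Proof.
split=> [|c d].
  by rewrite frac1; apply: ustE => k K l kK al /=; rewrite mul1r.
have [A ->] := frac_surj c; have [A' ->] := frac_surj d.
rewrite fracM [ust (frac A)](ustE (@valP x A)) [ust (frac A')](ustE (@valP x A')).
apply: ustE => k K l kK /= al; have := fnum_deg A; have := fden_deg A.
move: (@valP x A) (@valP x A') (fnum_deg A') (fden_deg A').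
move: (val A) (val A') (fdeg A) (fdeg A') (fnum A) (fden A) (fnum A') (fden A') al.
move=> v v' e e' F G F' G' al vE vE' eF' eG' eG eF.
have al1 : adm x (e + (e' + k))%N l by rewrite addnA.
have al2 : adm x (e' + (e + k))%N l by rewrite addnCA addnA.
have := vE _ _ _ (gpartM eF' kK) al1; have := vE' _ _ _ (gpartM eG kK) al2.
rewrite (addnCA e' e k) (addnA e e' k) => E' E.
rewrite -mulrA -[F * F' * K]mulrA -E -mulrA; congr (_ * _).
by rewrite [G * (F' * K)]mulrCA -E'; congr (_ * Phi _ _ _ _); ring.
Qed.

Let ust_local x (c : hloc (upt x)) : invertible (ust c) -> invertible c.
Proof.
have [A ->] := frac_surj c; rewrite (ustE (@valP x A)) frac_invertible => inv.
apply/(uptP x (fnum_deg A)); apply.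
have [k [K [l [kK al invd]]]] := unit_upt (fden_deg A) (@fden_nin _ _ _ _ A).
exists k, K, l; split=> //; rewrite -(@valP x A) //.
by apply/invertibleMP.
Qed.

Let unit_near x e k l G K : grT e G -> grT k K -> adm x (e + k)%N l ->
  invertible (Phi x (e + k)%N l (G * K)) ->
  exists V, [/\ open V, V x & forall y, V y -> adm y (e + k)%N l /\
     invertible (Phi y (e + k)%N l (G * K))].
Proof.
move=> eG kK al inv; have hl : homog_set grS l by exists (e + k)%N; exact: al.1.
have [V [oV Vx Vinv]] := sect_invertible (open_adm hl)
  (Phi_sect al.1 (gpartM eG kK)) al.2 inv.
exists ([set y | ~ hprime (apt y) l] `&` V); split=> [|//|y [nl Vy]].
- by apply: openI => //; exact: open_adm.
- by split=> //; exact: al.2.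
- by split; [split=> //; exact: al.1|exact: Vinv].
Qed.

Let ucont (V : set (hpoint grT (irrelevant grT))) : open V -> open (upt @^-1` V).
Proof.
move=> /open_hpointE[A hA ->].
suff H : forall x, upt x \in [set P : hpoint grT (irrelevant grT) | ~ (A `<=` P)] ->
  exists W : set X, [/\ open W, W x & W `<=` upt @^-1` [set P | ~ (A `<=` hprime P)]].
  have -> : upt @^-1` [set P : hpoint grT (irrelevant grT) | ~ (A `<=` P)] =
     \bigcup_(W in [set W : set X | open W /\
        W `<=` upt @^-1` [set P | ~ (A `<=` hprime P)]]) W.
    apply/seteqP; split=> [x xA|x [W [_ WA] Wx]]; last exact: WA.
    by have [|W [oW Wx WA]] := H x; [rewrite inE|exists W].
  by apply: bigcup_open => W [].
move=> x; rewrite inE /= => /existsNP[F /not_implyP[AF nF]].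
have [e eF] := hA _ AF; have [k [K [l [kK al inv]]]] := unit_upt eF nF.
have [W [oW Wx WP]] := unit_near eF kK al inv.
exists W; split=> // y /WP[al' inv'] /= /(_ F AF) /(uptP y eF); apply.
by exists k, K, l.
Qed.

Let usect (V : set (hpoint grT (irrelevant grT))) (t : forall P, hloc P) :
  open V -> hsect V t -> sect (upt @^-1` V) (fun x => ust (t (upt x))).
Proof.
move=> oV tV; have oW := ucont oV; apply/(sect_local _ oW) => x Vx.
have [W [F [G [oW' Wx WE]]]] := tV _ Vx.
have [A [AF AG _]] := WE _ Vx Wx.
have eF : grT (fdeg A) F by rewrite -AF; exact: fnum_deg.
have eG : grT (fdeg A) G by rewrite -AG; exact: fden_deg.
have nG : ~ hprime (upt x) G by rewrite -AG; exact: fden_nin.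
have [k [K [l [kK al inv]]]] := unit_upt eG nG.
have [U [oU Ux UP]] := unit_near eG kK al inv.
pose Y := U `&` (upt @^-1` V `&` upt @^-1` W).
have oY : open Y by apply: openI => //; apply: openI => //; exact: ucont.
pose e := fdeg A.
have tY y : Y y -> isval e F G (ust (t (upt y))).
  move=> [Uy [Vy Wy]]; have [A' [nA' dA' ->]] := WE _ Vy Wy.
  rewrite (ustE (@valP y A')).
  have eG' : grT (fdeg A') G by rewrite -dA'; exact: fden_deg.
  have eF' : grT (fdeg A') F by rewrite -nA'; exact: fnum_deg.
  have nG' : ~ hprime (upt y) G by rewrite -dA'; exact: fden_nin.
  have [v vE] := val_exists (HFrac eF eG nG').
  have hu1 : homog_set grT 1 by exists 0%N; exact: gpart1.
  have nu1 : ~ hprime (upt y) 1 by exact: one_nin.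
  have vA : isval (fdeg A') F G (val A') by move: (@valP y A'); rewrite nA' dA'.
  by rewrite (isval_uniq hu1 nu1 eF' eG' nG' eF eG nG' vA vE erefl).
have oD : open [set y : X | ~ hprime (apt y) l] by apply: open_adm; exists (e + k)%N; exact: al.1.
have YD : Y `<=` [set y : X | ~ hprime (apt y) l] by move=> y [/UP[[]]].
pose w y : stalk y := match pselect (invertible (Phi y (e + k)%N l (G * K))) with
  | left E => sval (cid E) | right _ => 0 end.
exists Y, (fun y => Phi y (e + k)%N l (F * K) * w y); split=> //.
  apply: (sectM oY).
    exact: (sect_sub oD oY YD (Phi_sect al.1 (gpartM eF kK))).
  apply: (sect_inv oY (sect_sub oD oY YD (Phi_sect al.1 (gpartM eG kK)))).
  move=> y [/UP[_ E] _]; rewrite /w; case: pselect => // E'.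
  by case: cid.
move=> y _ Yy; have [ay invy] := UP _ (Yy.1).
have <- := tY y Yy _ _ _ kK ay; rewrite -mulrA /w; case: pselect => // E'.
by case: cid => z /= ->; rewrite mulr1.
Qed.

Let u : lrs_mor X (Proj grT) :=
  @LRSMor X (Proj grT) upt ust ucont ust_zmod ust_monoid ust_local usect.

Let unit_gP x e s : grS e s -> (unit x e (g s) <-> ~ hprime (apt x) s).
Proof.
move=> es; split=> [|ns]; last exact: unit_g.
move=> [k [K [l [kK al]]]] inv sP.
have [j [c [t [kt KE]]]] := T_gen kK.
move: inv; rewrite KE mulr_sumr.
have -> : \sum_(i < j) g s * (phi (c i) * g (t i)) =
    \sum_(i < j) phi (c i) * g (s * t i).
  by apply: eq_bigr => i _; rewrite rmorphM; ring.
rewrite Phi_sum //; last by move=> i; exact: gpartM.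
move=> /(local_ring_sum (@stalk_local X x))[i] /invertibleMP[_].
rewrite (lamE' al (gpartM es (kt i))) => /(mor_local a) /frac_invertible; apply.
by rewrite /= mulrC; case: (hprime_prime (apt x)) => [[_ _ PM] _ _]; exact: PM.
Qed.

Let pu : p \O u = a.
Proof.
have prE x : hprime ((p \O u) x : hpoint grS (irrelevant grS)) = hprime (apt x).
  apply: hprime_ext => e s es; rewrite ((p_ind (upt x)).1 s) (uptP x (g_deg es)) (unit_gP x es).
  by split=> [/contrapT|? ?].
apply: hspec_mor_ext => // x A A' nE dE.
have nd : ~ hprime (upt x) (g (fden A)).
  by move=> /(p_ind (upt x)).1; exact: fden_nin.
rewrite [LHS]/= ((p_ind (upt x)).2 A (HFrac (g_deg (fnum_deg A)) (g_deg (fden_deg A)) nd)) //.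
rewrite -(@lamE x A') -nE -dE.
have al0 : adm x (fdeg A) (fden A).
  by split; [exact: fden_deg|move: (@fden_nin _ _ _ _ A); rewrite prE].
apply: ustE => k K l kK al /=.
have en := g_deg (fnum_deg A); have ed := g_deg (fden_deg A).
rewrite -(Phi_g al0 (fnum_deg A)) -PhiM //; last exact: gpartM.
rewrite (@PhiME x (fdeg A) (fden A) (g (fden A)) (fdeg A + k)%N l (g (fnum A) * K)) //; first last.
- by ring.
- exact: gpartM.
by rewrite Phi_self // mul1r.
Qed.

Let qu : q \O u = b.
Proof.
have prE x : hprime ((q \O u) x : hpoint (triv_grading B') setT) = hprime (bpt x).
  have rP c : ~ hprime (bpt x) c <-> invertible (rho x c).
    rewrite /rho; split=> [nc|/(mor_local b) /frac_invertible //].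
    have /frac_invertible[z cz] : ~ hprime (bpt x) (fnum (const (bpt x) c)) by [].
    by exists (mor_st b z); rewrite -(mor_monoid b x).2 cz (mor_monoid b x).1.
  suff H c : unit x 0 (phi c) <-> ~ hprime (bpt x) c.
    apply: hprime_ext => e c _; rewrite ((q_ind (upt x)).1 c) (uptP x (phi_deg c)) H.
    by split=> [/contrapT|? ?].
  rewrite rP; split=> [[k [K [l [kK al]]]]|inv].
    by rewrite Phi_scale // => /invertibleMP[].
  exists 0%N, 1, 1; rewrite addn0 mulr1 Phi_phi; split=> //; exact: gpart1.
apply: hspec_mor_ext => // x A A' nE dE.
have nd : ~ hprime (upt x) (phi (fden A)).
  by move=> /(q_ind (upt x)).1; exact: fden_nin.
rewrite [LHS]/= ((q_ind (upt x)).2 A (HFrac (phi_deg (fnum A)) (phi_deg (fden A)) nd)) //.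
apply: ustE => k K l kK al /=.
rewrite !Phi_scale // mulrA; congr (_ * _).
rewrite /rho -(mor_monoid b x).2 fracM nE dE; congr (mor_st b _).
by apply: fracE => /=; ring.
Qed.

Let u_unique (u' : lrs_mor X (Proj grT)) : p \O u' = a -> q \O u' = b -> u = u'.
Proof.
move=> pu' qu'.
pose upt' x : hpoint grT (irrelevant grT) := u' x.
have gP x s : hprime (upt' x) (g s) <-> hprime (apt x) s.
  by rewrite -((p_ind (upt' x)).1 s) /apt -pu'.
have fracPhi x e l H (al : adm x e l) (eH : grT e H) (A : hfrac (upt' x)) :
    fnum A = H -> fden A = g l -> mor_st u' (frac A) = Phi x e l H.
  move=> nA dA; have [k [c [s [es HE]]]] := T_gen eH.
  have nl : ~ hprime (upt' x) (g l) by move=> /gP; exact: al.2.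
  have n1 := @one_nin _ _ _ (upt' x).
  pose C i : hfrac (upt' x) := HFrac (phi_deg (c i)) (gpart1 grT) n1.
  pose D i : hfrac (upt' x) := HFrac (g_deg (es i)) (g_deg al.1) nl.
  have -> : frac A = \sum_(i < k) frac (C i) * frac (D i).
    have -> : frac A = frac (HFrac eH (g_deg al.1) nl) by exact: frac_eq.
    have E i : frac (C i) * frac (D i) = frac (HFrac (gen_deg (c i) (es i)) (g_deg al.1) nl).
      by rewrite fracM; apply: fracE => /=; ring.
    under eq_bigr do rewrite E.
    elim: k c s es H eH HE {C D E A nA dA} => [|k IH] c s es H eH HE.
      rewrite big_ord0; apply/frac_eq0; exists 1; split.
      - by exists 0%N; exact: gpart1.
      - exact: one_nin.
      - by rewrite /= HE big_ord0 mulr0.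
    have eH' : grT e (\sum_(i < k) phi (c (lift ord0 i)) * g (s (lift ord0 i))).
      by apply: gr_sum => i _; exact: gen_deg.
    rewrite big_ord_recl -(IH _ _ (fun i => es (lift ord0 i)) _ eH' erefl) fracD.
    by apply: fracE => /=; rewrite HE big_ord_recl; ring.
  rewrite mor_st_sum HE Phi_sum //; apply: eq_bigr => i _.
  rewrite (mor_monoid u' x).2; congr (_ * _).
    pose A1 : hfrac ((q \O u') x : hpoint (triv_grading B') setT) := const _ (c i).
    have := mor_st_frac (A := A1) (B := const (bpt x) (c i)) qu' erefl erefl.
    by rewrite /rho => <- /=; rewrite ((q_ind (upt' x)).2 A1 (C i)) //= rmorph1.
  have nl' : ~ hprime ((p \O u') x : hpoint grS (irrelevant grS)) l.
    by move=> /((p_ind (upt' x)).1 l).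
  pose A1 : hfrac ((p \O u') x : hpoint grS (irrelevant grS)) := HFrac (es i) al.1 nl'.
  rewrite (lamE' al (es i)).
  have := mor_st_frac (A := A1) (B := HFrac (es i) al.1 al.2) pu' erefl erefl.
  by move=> <- /=; rewrite ((p_ind (upt' x)).2 A1 (D i)).
have uE x : hprime (upt x) = hprime (upt' x).
  apply: hprime_ext => e G eG; rewrite (uptP x eG).
  case: (hprime_prime (upt' x)) => [[_ _ PM] _ PP].
  split=> [nU|PG [k [K [l [kK al]]]]].
    apply: contrapT => nG; apply: nU.
    have [D [l [D0 al]]] := apt_relevant x.
    have alX : forall j, adm x (j * D)%N (l ^+ j).
      elim=> [|j IH]; first exact: adm1.
      by rewrite exprS mulSn; exact: admM.
    have GX : forall j, grT (j * e)%N (G ^+ j) /\ ~ hprime (upt' x) (G ^+ j).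
      elim=> [|j [IH1 IH2]]; first by split; [exact: gpart1|exact: one_nin].
      by rewrite exprS mulSn; split; [exact: gpartM|move=> /PP[]].
    have ED : (e + D.-1 * e = e * D)%N by rewrite -mulSn prednK // mulnC.
    (* [G ^+ D / l ^+ e] has degree zero *)
    exists (D.-1 * e)%N, (G ^+ D.-1), (l ^+ e).
    rewrite ED -exprS prednK //; split; [exact: (GX _).1|exact: alX|].
    have eGD : grT (e * D)%N (G ^+ D) by rewrite mulnC; exact: (GX D).1.
    have nl : ~ hprime (upt' x) (g (l ^+ e)) by move=> /gP; exact: (alX e).2.
    pose A := HFrac eGD (g_deg (alX e).1) nl.
    rewrite -(@fracPhi x _ _ _ (alX e) eGD A) //.
    have /frac_invertible[z Az] : ~ hprime (upt' x) (fnum A) by exact: (GX D).2.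
    by exists (mor_st u' z); rewrite -(mor_monoid u' x).2 Az (mor_monoid u' x).1.
  have nl : ~ hprime (upt' x) (g l) by move=> /gP; exact: al.2.
  pose A := HFrac (gpartM eG kK) (g_deg al.1) nl.
  rewrite -(@fracPhi x _ _ _ al (gpartM eG kK) A) // => /(mor_local u') /frac_invertible; apply.
  by rewrite /= mulrC; exact: PM.
apply: hspec_mor_ext => // x A A' nE dE.
apply: ustE => k K l kK al /=.
have nl : ~ hprime (upt' x) (g l) by move=> /gP; exact: al.2.
rewrite -(@fracPhi x _ _ _ al _ (HFrac (gpartM (fden_deg A) kK) (g_deg al.1) nl)) //; last first.
  by apply: gpartM => //; exact: fden_deg.
rewrite -(@fracPhi x _ _ _ al _ (HFrac (gpartM (fnum_deg A) kK) (g_deg al.1) nl)) //; last first.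
  by apply: gpartM => //; exact: fnum_deg.
rewrite -(mor_monoid u' x).2 fracM; congr (mor_st u' _).
by apply: fracE => /=; rewrite nE dE; ring.
Qed.

Lemma base_change_lift : exists! v : lrs_mor X (Proj grT), p \O v = a /\ q \O v = b.
Proof. by exists u; split=> [|v [pv qv]]; [split|exact: u_unique]. Qed.

End Lift.

Theorem base_change_pullback : is_pullback f h p q.
Proof.
by split=> [|X a b ab]; [exact: base_change_commutes|exact: base_change_lift].
Qed.

End BaseChange.

(** * Closed subschemes given by quotients *)

Lemma idealN (S : comPzRingType) (I : ideal S) a : I a -> I (- a).
Proof. by case: (idealP I) => _ _ IM Ia; rewrite -mulN1r; exact: IM. Qed.

Lemma qproj_eq0 (S : comPzRingType) (I : ideal S) a : qproj I a = 0 <-> I a.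
Proof. by rewrite -[0](rmorph0 (qproj I)) qprojP subr0. Qed.

Section QuotientLift.
Variables (S T : comPzRingType) (I : ideal S) (f : {rmorphism S -> T}).
Hypothesis fI : forall a, I a -> f a = 0.

Definition qlift of (forall a, I a -> f a = 0) := fun x : quot I => f (repr x).

Lemma qliftE a : qlift fI (qproj I a) = f a.
Proof.
apply/eqP; rewrite -subr_eq0 -rmorphB; apply/eqP; apply: fI.
by apply/qprojP; rewrite {1}/qproj reprK.
Qed.

Lemma qlift_is_zmod_morphism : zmod_morphism (qlift fI).
Proof.
move=> x y; have [a ->] := qproj_surj x; have [b ->] := qproj_surj y.
by rewrite -rmorphB !qliftE rmorphB.
Qed.

Lemma qlift_is_monoid_morphism : monoid_morphism (qlift fI).
Proof.
split=> [|x y]; first by rewrite -[1](rmorph1 (qproj I)) qliftE rmorph1.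
have [a ->] := qproj_surj x; have [b ->] := qproj_surj y.
by rewrite -rmorphM !qliftE rmorphM.
Qed.

End QuotientLift.

HB.instance Definition _ (S T : comPzRingType) (I : ideal S) (f : {rmorphism S -> T})
    (fI : forall a, I a -> f a = 0) :=
  GRing.isZmodMorphism.Build (quot I) T (qlift fI) (qlift_is_zmod_morphism fI).
HB.instance Definition _ (S T : comPzRingType) (I : ideal S) (f : {rmorphism S -> T})
    (fI : forall a, I a -> f a = 0) :=
  GRing.isMonoidMorphism.Build (quot I) T (qlift fI) (qlift_is_monoid_morphism fI).

Section QuotientProj.
Variables (S : comPzRingType) (gr : grading S) (I : ideal S).
Let grQ := quot_grading gr I.

Lemma quot_direct : homogeneous gr I -> direct grQ.
Proof.
move=> hI k c hc c0 i.
have /choice[s sP] : forall i : 'I_k, exists s, gr i s /\ qproj I s = c i.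
  by move=> j; have [s es <-] := hc j; exists s.
have := hI k s (fun i => (sP i).1) _ i; rewrite -(sP i).2.
move=> /(_ _)/qproj_eq0; apply; apply/qproj_eq0; rewrite rmorph_sum -{}[RHS]c0.
by apply: eq_bigr => j _; exact: (sP j).2.
Qed.

Let pt (P : hpoint grQ (irrelevant grQ)) : hpoint gr (irrelevant gr) := Proj_quot gr I P.

Lemma Proj_quot_inj : injective (Proj_quot gr I).
Proof.
move=> P Q E; apply: hpoint_ext; apply/seteqP.
have PE a : hprime P (qproj I a) <-> hprime Q (qproj I a).
  have : hprime (pt P) a <-> hprime (pt Q) a by rewrite /pt E.
  by [].
by split=> x; have [a ->] := qproj_surj x; move=> /PE.
Qed.

Lemma Proj_quot_stalk_surj P (b : stalk (P : Proj grQ)) :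
  exists a, mor_st (Proj_quot gr I) a = b.
Proof.
have [A ->] := frac_surj (b : hloc (P : hpoint grQ (irrelevant grQ))).
have [s es sA] := fnum_deg A; have [t et tA] := fden_deg A.
have nt : ~ hprime (pt P) t by move: (@fden_nin _ _ _ _ A); rewrite -tA.
exists (frac (HFrac es et nt)).
rewrite [LHS](@hloc_mapE _ _ _ _ _ _ _ (@quot_deg S gr I) (@quot_rel S gr I) P).
exact: frac_eq.
Qed.

(** The image of a closed set is cut out by the homogeneous elements that vanish
    on it; a homogeneous prime that contains these contains [I], because it
    contains the components of the elements of [I]. *)
Lemma Proj_quot_closed A : closed A -> closed (Proj_quot gr I @` A).
Proof.
move=> /closed_openC /open_hpointE[F hF AF].
have AE P : A P <-> F `<=` hprime (P : hpoint grQ (irrelevant grQ)).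
  have : (~` A) P <-> ~ (F `<=` hprime (P : hpoint grQ (irrelevant grQ))) by rewrite AF.
  by move=> [H1 H2]; split=> [AP|FP]; apply: contrapT => nn; [exact: H2 nn AP|exact: H1 nn FP].
rewrite -openC; apply/open_hpointE.
exists [set c | homog_set gr c /\ forall P, A P -> hprime (pt P) c]; first by move=> c [].
apply/seteqP; split=> [Q nQ H|Q nQ [P AP PQ]]; last first.
  by apply: nQ => c [_ /(_ _ AP)]; rewrite /pt PQ.
apply: nQ; have [[Q0 QD QM] Q1 QP] := hprime_prime Q.
have IQ s : I s -> hprime Q s.
  have [k [c [hc ->]]] := gpart_sum gr s => Is.
  elim/big_ind: _ => // i _; apply: H; split; first by exists i.
  move=> P AP; apply: (hprime_homog (c := c)) => //; rewrite /=.
  by rewrite (qproj_eq0 I _).2 //; case: (hprime_prime P) => -[].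
have QI s t : qproj I s = qproj I t -> hprime Q s -> hprime Q t.
  move=> /esym/qprojP/IQ + Qs; rewrite -{2}[t](subrK s) => Qts.
  exact: QD.
pose P : set (quot I) := [set x | hprime Q (repr x)].
have PE s : P (qproj I s) <-> hprime Q s.
  by split; apply: QI; rewrite /qproj reprK.
have pP : prime_ideal P.
  split=> [||x y].
  - split=> [|x y|x y].
    + by rewrite -[0](rmorph0 (qproj I)); apply/PE.
    + have [a ->] := qproj_surj x; have [b ->] := qproj_surj y.
      by move=> /PE Qa /PE Qb; rewrite -rmorphD; apply/PE; exact: QD.
    + have [a ->] := qproj_surj x; have [b ->] := qproj_surj y.
      by move=> /PE Qb; rewrite -rmorphM; apply/PE; exact: QM.
  - by rewrite -[1](rmorph1 (qproj I)) => /PE.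
  - have [a ->] := qproj_surj x; have [b ->] := qproj_surj y.
    by rewrite -rmorphM => /PE/QP[Qa|Qb]; [left|right]; apply/PE.
have hP : homogeneous grQ P.
  move=> k c hc Pc i.
  have /choice[s sP] : forall i : 'I_k, exists s, gr i s /\ qproj I s = c i.
    by move=> j; have [s es <-] := hc j; exists s.
  rewrite -(sP i).2; apply/PE; apply: (hprime_homog (fun i => (sP i).1)).
  apply/PE; rewrite rmorph_sum; move: Pc.
  by rewrite (eq_bigr _ (fun j _ => esym (sP j).2)).
have rP : ~ (irrelevant grQ `<=` P).
  move=> PI; apply: (hprime_rel (h := Q)) => c [e e0 ec]; apply/PE; apply: PI.
  by exists e => //; exists c.
exists (HPoint pP hP rP); last first.
  by apply: hpoint_ext; apply/seteqP; split=> s /= /PE.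
apply/AE => x Fx /=; have [e [s es sx]] := hF _ Fx; rewrite -sx; apply/PE; apply: H.
by split=> [|P' /AE]; [exists e|rewrite /pt /= sx; apply].
Qed.

Lemma Proj_quot_closed_immersion : closed_immersion (Proj_quot gr I).
Proof.
by split; [exact: Proj_quot_inj|exact: Proj_quot_closed|exact: Proj_quot_stalk_surj].
Qed.

End QuotientProj.

(** * Points over a prime of the coefficient ring *)

(** The largest homogeneous prime contained in the prime [ev @^-1` Q]. *)
Lemma homogeneous_prime_below (S B : comPzRingType) (gr : grading S) (ev : {rmorphism S -> B})
    (Q : set B) : direct gr -> prime_ideal Q ->
  exists P : set S, [/\ prime_ideal P, homogeneous gr P &
    forall e a, gr e a -> (P a <-> Q (ev a))].
Proof.
move=> dgr [[Q0 QD QM] nQ1 QP].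
have [||e f a b _ _|e a b _ _|P [pP hP PE]] :=
    @prime_of_units S gr dgr (fun _ a => ~ Q (ev a)).
- by rewrite rmorph1.
- by move=> e; rewrite rmorph0; apply.
- rewrite rmorphM; split=> [nQ|[na nb] /QP[]//].
  by split=> [Qa|Qb]; apply: nQ; [rewrite mulrC|]; exact: QM.
- rewrite rmorphD => nQ; apply: contrapT => /not_orP[/contrapT Qa /contrapT Qb].
  by apply: nQ; exact: QD.
- by exists P; split=> // e a ea; rewrite (PE e a ea); split=> [/contrapT|? ?].
Qed.

Lemma wgrading_direct n (B : comNzRingType) (d : 'I_n -> nat) : direct (wgrading B d).
Proof.
move=> k c hc c0 i; apply/mpolyP => al; rewrite mcoeff0.
have [al_i|al_i] := boolP (al \in msupp (c i)); last exact: memN_msupp_eq0.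
have := congr1 (mcoeff al) c0; rewrite mcoeff0 raddf_sum /= (bigD1 i) //= big1 ?addr0 //.
move=> j ji; apply: memN_msupp_eq0; apply: contra ji => al_j.
by apply/eqP/val_inj; rewrite /= -(hc _ _ al_i) -(hc _ _ al_j).
Qed.

(** The fibre over a prime contains the point where all variables are equal to 1. *)
Lemma wProj_struct_surj n (B : comNzRingType) (d : 'I_n -> nat) (y : Spec B) :
  (0 < n)%N -> (forall i, (0 < d i)%N) -> exists x, wProj_struct B d x = y.
Proof.
move=> n0 d0; pose Q : hpoint (triv_grading B) setT := y.
have [P [pP hP PE]] := homogeneous_prime_below (meval (fun=> 1) : {rmorphism {mpoly B[n]} -> B})
  (@wgrading_direct n B d) (hprime_prime Q).
have rP : ~ (irrelevant (wgrading B d) `<=` P).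
  pose i0 := Ordinal n0.
  have X_deg : wgrading B d (d i0) 'X_i0.
    move=> al; rewrite msuppX inE => /eqP ->; rewrite /wdeg (bigD1 i0) //= mnm1E eqxx muln1.
    by rewrite big1 ?addn0 // => i; rewrite mnm1E eq_sym => /negPf ->; rewrite muln0.
  move=> H; have : P 'X_i0 by apply: H; exists (d i0).
  move/(PE _ _ X_deg); rewrite /= mevalXU.
  by case: (hprime_prime Q).
exists (HPoint pP hP rP); apply: hpoint_ext; apply/seteqP.
have E c : P c%:MP_[n] <-> Q c.
  by rewrite (PE 0%N) /= ?mevalC //; exact: mpolyC_deg.
by split=> c /E.
Qed.

(** * Flatness of Proj of a free algebra *)

Section Flatness.
Variables (B S : comPzRingType) (gr : grading S) (psi : {rmorphism B -> S}).
Variables (I : eqType) (b : I -> S) (coef : S -> I -> B).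

(** A basis in the form that localisation uses: the coordinates are linear functions,
    and a homogeneous element only involves basis elements of its own degree, so that
    these can be divided by denominators of that degree. *)
Definition graded_coordinates : Prop :=
  [/\ (forall F G i, coef (F + G) i = coef F i + coef G i),
      (forall c F i, coef (psi c * F) i = c * coef F i) &
      (forall F, exists s : seq I, [/\ uniq s, F = \sum_(i <- s) psi (coef F i) * b i,
         (forall i, i \notin s -> coef F i = 0) &
         forall e, gr e F -> forall i, i \in s -> gr e (b i)])].

Hypothesis coefP : graded_coordinates.
Hypothesis psi_deg : forall c, gr 0%N (psi c).

Let coefD F G i : coef (F + G) i = coef F i + coef G i.
Proof. by case: coefP => + _ _; apply. Qed.
Let coefZ c F i : coef (psi c * F) i = c * coef F i.
Proof. by case: coefP => _ + _; apply. Qed.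

Let coef0 i : coef 0 i = 0.
Proof. by rewrite -[X in coef X](mul0r 0) -(rmorph0 psi) coefZ mul0r. Qed.

(* [coef] of [c * F] is determined by [coef F] *)
Let coefM F : exists s0 : seq I, forall s, uniq s -> {subset s0 <= s} -> forall c i,
  coef (c * F) i = \sum_(j <- s) coef F j * coef (c * b j) i.
Proof.
have [_ _ /(_ F)[s0 [us0 FE F0 _]]] := coefP; exists s0 => s us s0s c i.
have FE' : F = \sum_(j <- s) psi (coef F j) * b j.
  rewrite {1}FE [RHS](bigID (fun j => j \in s0)) /= [X in _ = _ + X]big1 ?addr0; last first.
    by move=> j /F0 ->; rewrite rmorph0 mul0r.
  rewrite -[RHS]big_filter; apply: perm_big; apply: uniq_perm => //.
    exact: filter_uniq.
  by move=> j; rewrite mem_filter andb_idr // => /s0s.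
rewrite {1}FE' mulr_sumr (big_morph (coef^~ i) (fun _ _ => coefD _ _ i) (coef0 i)).
by apply: eq_bigr => j _; rewrite mulrCA coefZ.
Qed.

Variable P : hpoint gr (irrelevant gr).
Variables (f : lrs_mor (Proj gr) (Spec B)) (f_ind : induced f psi).
Let Q : hpoint (triv_grading B) setT := f P.

Let P1 : ~ hprime P 1. Proof. by case: (hprime_prime P). Qed.
Let PM x y : ~ hprime P x -> ~ hprime P y -> ~ hprime P (x * y).
Proof. by case: (hprime_prime P) => _ _ PP nx ny /PP[]. Qed.

Let hom (x : S) : Prop := homog_set gr x /\ ~ hprime P x.
Let hom1 : hom 1. Proof. by split=> //; exists 0%N; exact: gpart1. Qed.
Let homM x y : hom x -> hom y -> hom (x * y).
Proof.
by move=> [[e ex] nx] [[e' fy] ny]; split; [exists (e + e')%N; exact: gpartM|exact: PM].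
Qed.
Let hom_den (A : hfrac P) : hom (fden A).
Proof. by split; [exists (fdeg A); exact: fden_deg|exact: fden_nin]. Qed.

Let Q1 : ~ hprime Q 1. Proof. by case: (hprime_prime Q). Qed.
Let const_deg (c : B) : triv_grading B 0%N c. Proof. by []. Qed.
Definition cfrac (c : B) : hfrac Q := HFrac (const_deg c) (const_deg 1) Q1.
Let kap (c : B) : hloc Q := frac (cfrac c).

Let kapD c c' : kap (c + c') = kap c + kap c'.
Proof. by rewrite /kap fracD; apply: fracE => /=; ring. Qed.
Let kapM c c' : kap (c * c') = kap c * kap c'.
Proof. by rewrite /kap fracM; apply: fracE => /=; ring. Qed.
Let kap0 : kap 0 = 0.
Proof. exact: fracE. Qed.
Let kap_coefB F G i : kap (coef (F - G) i) = kap (coef F i) - kap (coef G i).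
Proof. by apply/eqP; rewrite eq_sym subr_eq -kapD -coefD subrK. Qed.

Section LocalizedTensor.
Variable N : lmodType (hloc Q).

(** The localisation at the homogeneous elements outside [P] of the tensor product
    of [N] and [S].  A numerator is a formal sum of tensors; it is zero when all
    its coordinates in [N] with respect to [b] vanish. *)
Record ltensor := LTensor {
  lnum : seq (N * S);
  lden : S;
  lden_hom : homog_set gr lden /\ ~ hprime P lden }.

HB.instance Definition _ := gen_eqMixin ltensor.
HB.instance Definition _ := gen_choiceMixin ltensor.

Definition lcoord (l : seq (N * S)) (a : S) (i : I) : N :=
  \sum_(x <- l) kap (coef (a * x.2) i) *: x.1.

Let lcoord_scale l a : exists s0 : seq I, forall s, uniq s -> {subset s0 <= s} ->
  forall c i, lcoord l (c * a) i = \sum_(j <- s) kap (coef (c * b j) i) *: lcoord l a j.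
Proof.
elim: l => [|[x F] l [s0 IH]].
  exists [::] => s _ _ c i; rewrite /lcoord big_nil big1 // => j _.
  by rewrite big_nil scaler0.
have [s1 H1] := coefM (a * F); exists (s0 ++ s1) => s us ss c i.
rewrite /lcoord big_cons -/(lcoord l _ _) (IH s us) => [|j js]; last first.
  by apply: ss; rewrite mem_cat js.
rewrite -[c * a * _]mulrA (H1 s us) => [|j js]; last by apply: ss; rewrite mem_cat js orbT.
rewrite (big_morph kap kapD kap0) scaler_suml -big_split /=.
apply: eq_bigr => j _; rewrite big_cons -/(lcoord l _ _) scalerDr scalerA /=.
by rewrite kapM [kap _ * _]mulrC.
Qed.

Let lcoord_eq l l' a a' c : lcoord l a =1 lcoord l' a' ->
  lcoord l (c * a) =1 lcoord l' (c * a').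
Proof.
move=> E i; have [s0 H0] := lcoord_scale l a; have [s1 H1] := lcoord_scale l' a'.
pose s := undup (s0 ++ s1).
rewrite (H0 s (undup_uniq _)) => [|j js]; last by rewrite mem_undup mem_cat js.
rewrite (H1 s (undup_uniq _)) => [|j js]; last by rewrite mem_undup mem_cat js orbT.
by apply: eq_bigr => j _; rewrite E.
Qed.

Let lmap (c : S) (l : seq (N * S)) := [seq (x.1, c * x.2) | x <- l].
Let lopp (l : seq (N * S)) := [seq (- x.1, x.2) | x <- l].

Let lcoord_cat l l' a i : lcoord (l ++ l') a i = lcoord l a i + lcoord l' a i.
Proof. exact: big_cat. Qed.
Let lcoord_map c l a i : lcoord (lmap c l) a i = lcoord l (a * c) i.
Proof. by rewrite /lcoord big_map; apply: eq_bigr => x _; rewrite mulrA. Qed.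
Let lcoord_opp l a i : lcoord (lopp l) a i = - lcoord l a i.
Proof. by rewrite /lcoord big_map -sumrN; apply: eq_bigr => x _; rewrite scalerN. Qed.

Definition lequiv : rel ltensor := fun x y => `[< exists H,
  (homog_set gr H /\ ~ hprime P H) /\
  lcoord (lnum x) (H * lden y) =1 lcoord (lnum y) (H * lden x) >].

Lemma lequivP : equiv_class_of lequiv.
Proof.
split=> [x|x y|y x z].
- by apply/asboolP; exists 1.
- by apply/asboolP/asboolP => -[H [hH E]]; exists H; split=> // i; rewrite E.
- move=> /asboolP[H [hH E]] /asboolP[K [hK F]]; apply/asboolP.
  exists (H * K * lden y); split; first by apply: (homM (homM hH hK)); exact: lden_hom.
  move=> i; have -> : H * K * lden y * lden z = (K * lden z) * (H * lden y) by ring.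
  rewrite (lcoord_eq (K * lden z) E).
  have -> : K * lden z * (H * lden x) = (H * lden x) * (K * lden z) by ring.
  by rewrite (lcoord_eq (H * lden x) F); congr (lcoord _ _ _); ring.
Qed.

Canonical lequiv_equiv := EquivRelPack lequivP.
Canonical lequiv_encModRel := defaultEncModRel lequiv.

Definition ltens : Type := {eq_quot lequiv}%qT.
HB.instance Definition _ := Choice.on ltens.
HB.instance Definition _ := EqQuotient.on ltens.

Definition lproj (x : ltensor) : ltens := (\pi x)%qT.

Lemma lprojP x y : lproj x = lproj y <-> exists H, hom H /\
  lcoord (lnum x) (H * lden y) =1 lcoord (lnum y) (H * lden x).
Proof.
split=> [/eqP|xy]; first by rewrite eqmodE => /asboolP.
by apply/eqP; rewrite eqmodE; apply/asboolP.
Qed.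

Lemma lproj_surj x : exists a, x = lproj a.
Proof. by exists (repr x); rewrite /lproj reprK. Qed.

Let repr_lproj x : exists H, hom H /\
  lcoord (lnum (repr (lproj x))) (H * lden x) =1 lcoord (lnum x) (H * lden (repr (lproj x))).
Proof. by apply/lprojP; rewrite {1}/lproj reprK. Qed.

Definition lzero : ltensor := LTensor [::] hom1.
Definition lneg (x : ltensor) : ltensor := LTensor (lopp (lnum x)) (lden_hom x).
Definition ladd (x y : ltensor) : ltensor :=
  LTensor (lmap (lden y) (lnum x) ++ lmap (lden x) (lnum y))
    (homM (lden_hom x) (lden_hom y)).

Definition ltens_opp (x : ltens) : ltens := lproj (lneg (repr x)).
Definition ltens_add (x y : ltens) : ltens := lproj (ladd (repr x) (repr y)).

Let lprojE x y : (forall H i, lcoord (lnum x) (H * lden y) i = lcoord (lnum y) (H * lden x) i) ->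
  lproj x = lproj y.
Proof. by move=> E; apply/lprojP; exists 1; split. Qed.

Lemma loppE x : ltens_opp (lproj x) = lproj (lneg x).
Proof.
have [H [hH E]] := repr_lproj x; apply/lprojP; exists H; split=> // i /=.
by rewrite !lcoord_opp E.
Qed.

Lemma laddE x y : ltens_add (lproj x) (lproj y) = lproj (ladd x y).
Proof.
have [H [hH E]] := repr_lproj x; have [K [hK F]] := repr_lproj y.
apply/lprojP; exists (H * K); split=> [|i /=]; first exact: homM.
rewrite !lcoord_cat !lcoord_map.
move: (repr (lproj x)) (repr (lproj y)) E F => x' y' E F.
have -> : H * K * (lden x * lden y) * lden y' = (K * lden y * lden y') * (H * lden x) by ring.
have -> : H * K * (lden x * lden y) * lden x' = (H * lden x * lden x') * (K * lden y) by ring.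
rewrite (lcoord_eq _ E) (lcoord_eq _ F); congr (lcoord _ _ _ + lcoord _ _ _); ring.
Qed.

Lemma laddA : associative ltens_add.
Proof.
move=> x y z; have [a ->] := lproj_surj x; have [c ->] := lproj_surj y.
have [e ->] := lproj_surj z; rewrite !laddE; apply: lprojE => H i /=.
rewrite !lcoord_cat !lcoord_map !lcoord_cat !lcoord_map addrA.
by congr (lcoord _ _ _ + lcoord _ _ _ + lcoord _ _ _); ring.
Qed.

Lemma laddC : commutative ltens_add.
Proof.
move=> x y; have [a ->] := lproj_surj x; have [c ->] := lproj_surj y.
rewrite !laddE; apply: lprojE => H i /=.
rewrite !lcoord_cat !lcoord_map addrC.
by congr (lcoord _ _ _ + lcoord _ _ _); ring.
Qed.

Lemma ladd0 : left_id (lproj lzero) ltens_add.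
Proof.
move=> x; have [a ->] := lproj_surj x; rewrite laddE; apply: lprojE => H i /=.
by rewrite lcoord_map; congr (lcoord _ _ _); ring.
Qed.

Lemma laddN : left_inverse (lproj lzero) ltens_opp ltens_add.
Proof.
move=> x; have [a ->] := lproj_surj x; rewrite loppE laddE; apply: lprojE => H i /=.
by rewrite !lcoord_cat !lcoord_map lcoord_opp addNr /lcoord big_nil.
Qed.

HB.instance Definition _ := GRing.isZmodule.Build ltens laddA laddC ladd0 laddN.

Lemma lproj_eq0 x : lproj x = 0 <-> exists H, hom H /\ lcoord (lnum x) H =1 fun=> 0.
Proof.
have E H : lcoord (lnum x) (H * 1) =1 lcoord [::] (H * lden x) <->
    lcoord (lnum x) H =1 fun=> 0.
  rewrite mulr1; have z i : lcoord [::] (H * lden x) i = 0 by rewrite /lcoord big_nil.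
  by split=> EH i; rewrite EH ?z.
split=> [/lprojP[H [hH /E EH]]|[H [hH /E EH]]]; first by exists H.
by apply/lprojP; exists H.
Qed.

Lemma lproj_add l l' G (hG : homog_set gr G /\ ~ hprime P G) :
  lproj (LTensor l hG) + lproj (LTensor l' hG) = lproj (LTensor (l ++ l') hG).
Proof.
rewrite (laddE _ _ : lproj _ + lproj _ = _); apply: lprojE => H i /=.
rewrite !lcoord_cat !lcoord_map.
by congr (lcoord _ _ _ + lcoord _ _ _); ring.
Qed.

Definition lbil (x : N) (s : hloc P) : ltens :=
  lproj (LTensor [:: (x, fnum (repr s))] (hom_den (repr s))).

Let lcoord1 x F a i : lcoord [:: (x, F)] a i = kap (coef (a * F) i) *: x.
Proof. exact: big_seq1. Qed.

Lemma lbilE x (A : hfrac P) : lbil x (frac A) = lproj (LTensor [:: (x, fnum A)] (hom_den A)).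
Proof.
have /fracP[u [hu nu E]] : frac (repr (frac A)) = frac A by rewrite {1}/frac reprK.
apply/lprojP; exists u; split=> // i /=; rewrite !lcoord1; congr (kap (coef _ i) *: x).
by rewrite -!mulrA ![_ * fnum _]mulrC E.
Qed.

Lemma lbil_sum k (x : 'I_k -> N) (F : 'I_k -> S) G (hG : homog_set gr G /\ ~ hprime P G)
    (A : 'I_k -> hfrac P) : (forall i, fnum (A i) = F i) -> (forall i, fden (A i) = G) ->
  \sum_(i < k) lbil (x i) (frac (A i)) =
  lproj (LTensor [seq (x i, F i) | i <- enum 'I_k] hG).
Proof.
move=> nA dA; transitivity (\sum_(i <- enum 'I_k) lproj (LTensor [:: (x i, F i)] hG)).
  rewrite big_enum; apply: eq_bigr => i _; rewrite lbilE.
  by apply: lprojE => H j /=; rewrite nA dA.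
elim: (enum _) => [|i s IH]; last by rewrite big_cons IH lproj_add.
rewrite big_nil; apply/esym/lproj_eq0; exists 1; split=> // i.
by rewrite /lcoord big_nil.
Qed.

Lemma lbil_zmodl s : zmod_morphism (lbil^~ s).
Proof.
have [A ->] := frac_surj s => x y; rewrite !lbilE.
rewrite (loppE _ : - lproj _ = _) (laddE _ _ : lproj _ + lproj _ = _).
apply: lprojE => H i /=; rewrite /lcoord !big_cons !big_nil /= !addr0 scalerBr scalerN.
by congr (kap (coef _ i) *: x - kap (coef _ i) *: y); ring.
Qed.

Lemma lbil_zmodr x : zmod_morphism (lbil x).
Proof.
move=> s t; have [A ->] := frac_surj s; have [C ->] := frac_surj t.
rewrite fracB !lbilE (loppE _ : - lproj _ = _) (laddE _ _ : lproj _ + lproj _ = _).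
apply: lprojE => H i /=; rewrite /lcoord !big_cons !big_nil /= !addr0 scalerN.
rewrite -scalerBl -kap_coefB; congr (kap (coef _ i) *: x); ring.
Qed.

Let kap_frac (C : hfrac Q) : kap (fden C) * frac C = kap (fnum C).
Proof. by rewrite /kap fracM; apply: fracE => /=; ring. Qed.

Lemma lbil_balanced : balanced (@mor_st _ _ f P) lbil.
Proof.
split; [exact: lbil_zmodl|exact: lbil_zmodr|].
move=> c x s; have [C ->] := frac_surj (c : hloc Q); have [A ->] := frac_surj s.
have nd : ~ hprime P (psi (fden C)) by move=> /(f_ind P).1; exact: fden_nin.
rewrite ((f_ind P).2 C (HFrac (psi_deg (fnum C)) (psi_deg (fden C)) nd)) //.
rewrite fracM !lbilE; apply: lprojE => H i /=; rewrite !lcoord1 scalerA.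
congr (_ *: x); have -> : H * (psi (fden C) * fden A) * fnum A =
  psi (fden C) * (H * fden A * fnum A) by ring.
have -> : H * fden A * (psi (fnum C) * fnum A) = psi (fnum C) * (H * fden A * fnum A) by ring.
by rewrite !coefZ !kapM -kap_frac; ring.
Qed.

End LocalizedTensor.

Let gr_prod (J : eqType) (r : seq J) (R : pred J) (e : J -> nat) (a : J -> S) :
  (forall j, R j -> gr (e j) (a j)) ->
  gr (\sum_(j <- r | R j) e j)%N (\prod_(j <- r | R j) a j).
Proof.
move=> ea; elim: r => [|j r IH]; first by rewrite !big_nil; exact: gpart1.
by rewrite !big_cons; case: ifP => // Rj; apply: gpartM => //; exact: ea.
Qed.

Lemma common_denominator k (s : 'I_k -> hloc P) : exists e G (A : 'I_k -> hfrac P),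
  [/\ gr e G, ~ hprime P G &
      forall i, [/\ fdeg (A i) = e, fden (A i) = G & s i = frac (A i)]].
Proof.
have /choice[A sA] : forall i, exists A, s i = frac A by move=> i; exact: frac_surj.
have ninP (R : pred 'I_k) : ~ hprime P (\prod_(j | R j) fden (A j)).
  elim/big_ind: _ => [|x y|j _]; [exact: P1|exact: PM|exact: fden_nin].
have degP (R : pred 'I_k) : gr (\sum_(j | R j) fdeg (A j))%N (\prod_(j | R j) fden (A j)).
  by apply: gr_prod => j _; exact: fden_deg.
exists (\sum_j fdeg (A j))%N, (\prod_j fden (A j)).
have E i : fden (A i) * \prod_(j | j != i) fden (A j) = \prod_j fden (A j).
  by rewrite [RHS](bigD1 i).
have Ee i : (fdeg (A i) + \sum_(j | j != i) fdeg (A j) = \sum_j fdeg (A j))%N.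
  by rewrite [RHS](bigD1 i).
have nG i : gr (\sum_j fdeg (A j))%N (fnum (A i) * \prod_(j | j != i) fden (A j)).
  by rewrite -(Ee i); apply: gpartM; [exact: fnum_deg|exact: degP].
exists (fun i => HFrac (nG i) (degP xpredT) (@ninP xpredT)).
split=> [||i]; [exact: degP|exact: ninP|split=> //].
by rewrite sA; apply: fracE => /=; rewrite -(E i); ring.
Qed.

(** A relation between tensors over [N'] becomes a relation between their
    coordinates after multiplication by a homogeneous [H] outside [P]; the latter
    holds over [N] by injectivity, and dividing by [H] gives the relation back. *)
Lemma stalk_flat : flat_ring_map (@mor_st _ _ f P).
Proof.
move=> N N' h h_inj k x s z0 M be [beL beR beB].
have [e [G [A [eG nG AP]]]] := common_denominator s.
have hG : hom G by split=> //; exists e.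
have /lproj_eq0[H [[[e' eH] nH] HE]] :
    lproj (LTensor [seq ((h \o x) i, fnum (A i)) | i <- enum 'I_k] hG) = 0.
  rewrite -(@lbil_sum N' k (h \o x) (fun i => fnum (A i)) G hG A) //; last first.
    by move=> i; case: (AP i).
  rewrite -[RHS](z0 _ _ (lbil_balanced N')).
  by apply: eq_bigr => i _; case: (AP i) => _ _ ->.
have {}HE j : \sum_(i < k) kap (coef (H * fnum (A i)) j) *: x i = 0.
  apply: h_inj; rewrite linear0 linear_sum /= -[RHS](HE j) /lcoord /= big_map big_enum.
  by apply: eq_bigr => i _; rewrite linearZ.
have [_ _ /choice[t tP]] := coefP.
have eHF i : gr (e' + e)%N (H * fnum (A i)).
  by apply: gpartM => //; case: (AP i) => <- _ _; exact: fnum_deg.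
pose T := undup (flatten [seq t (H * fnum (A i)) | i <- enum 'I_k]).
have tT i : {subset t (H * fnum (A i)) <= T}.
  move=> j jt; rewrite mem_undup; apply/flattenP; exists (t (H * fnum (A i))) => //.
  by apply/mapP; exists i; rewrite // mem_enum.
have Tdeg j : j \in T -> gr (e' + e)%N (b j).
  rewrite mem_undup => /flattenP[_ /mapP[i _ ->] jt].
  by case: (tP (H * fnum (A i))) => _ _ _; apply; [exact: eHF|].
have uT : uniq T by exact: undup_uniq.
clearbody T; have HG_nin := PM nH nG.
have eHG := gpartM eH eG.
pose bfrac j : hloc P := match pselect (gr (e' + e)%N (b j)) with
  | left bd => frac (HFrac bd eHG HG_nin)
  | right _ => 0
  end.
have st c : mor_st f (kap c) = frac (HFrac (psi_deg c) (gpart1 gr) P1) :> hloc P.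
  by apply: (f_ind P).2; rewrite //= rmorph1.
have sE i : s i = \sum_(j <- T) (mor_st f (kap (coef (H * fnum (A i)) j)) : hloc P) * bfrac j.
  case: (AP i) => dA gA ->.
  have [us FE F0 _] := tP (H * fnum (A i)).
  have TE : H * fnum (A i) = \sum_(j <- T) psi (coef (H * fnum (A i)) j) * b j.
    rewrite {1}FE [RHS](bigID (fun j => j \in t (H * fnum (A i)))) /=.
    rewrite [X in _ = _ + X]big1 ?addr0; last by move=> j /F0 ->; rewrite rmorph0 mul0r.
    rewrite -[RHS]big_filter; apply: perm_big; apply: uniq_perm => //.
      by rewrite filter_uniq.
    by move=> j; rewrite mem_filter andb_idr // => /tT.
  have -> : frac (A i) = frac (HFrac (eHF i) eHG HG_nin).
    by apply: fracE => /=; rewrite gA; ring.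
  move: (eHF i) TE; move: (H * fnum (A i)) (coef (H * fnum (A i))) => F c.
  move: F.
  elim: T Tdeg {tT uT} => [|j T IH] Tdeg F eF.
    rewrite !big_nil => Fz; apply/frac_eq0; exists 1; split; [|exact: P1|by rewrite /= Fz mulr0].
    by exists 0%N; exact: gpart1.
  rewrite !big_cons => Fs.
  have bj : gr (e' + e)%N (b j) by apply: Tdeg; rewrite mem_head.
  have eF' : gr (e' + e)%N (\sum_(l <- T) psi (c l) * b l).
    have -> : \sum_(l <- T) psi (c l) * b l = F - psi (c j) * b j by rewrite Fs; ring.
    by apply: gpartB => //; rewrite -[(e' + e)%N]add0n; exact: gpartM.
  rewrite -(IH _ _ eF' erefl); last by move=> l lT; apply: Tdeg; rewrite inE lT orbT.
  rewrite st /bfrac; case: pselect => // bd; rewrite fracM fracD.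
  by apply: fracE => /=; rewrite Fs; ring.
have be_sumr y (J : Type) (r : seq J) (F : J -> hloc P) :
    be y (\sum_(j <- r) F j) = \sum_(j <- r) be y (F j).
  have be0 : be y 0 = 0 by have := beR y 0 0; rewrite !subrr.
  apply: (big_morph (be y) _ be0) => u v.
  by apply/eqP; rewrite -subr_eq -beR addrK.
have be_suml y (r : seq 'I_k) (F : 'I_k -> N) :
    \sum_(i <- r) be (F i) y = be (\sum_(i <- r) F i) y.
  have be0 : be 0 y = 0 by have := beL y 0 0; rewrite !subrr.
  apply/esym/(big_morph (be^~ y) _ be0) => u v.
  by apply/eqP; rewrite -subr_eq -beL addrK.
under eq_bigr => i _ do rewrite sE be_sumr.
rewrite exchange_big big1 //= => j _.
under eq_bigr => i _ do rewrite -beB.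
by rewrite be_suml HE; have := beL (bfrac j) 0 0; rewrite !subrr.
Qed.

End Flatness.

Theorem Proj_flat (B S : comPzRingType) (gr : grading S) (psi : {rmorphism B -> S})
    (I : eqType) (b : I -> S) (coef : S -> I -> B) (f : lrs_mor (Proj gr) (Spec B)) :
  graded_coordinates gr psi b coef -> (forall c, gr 0%N (psi c)) -> induced f psi ->
  flat_mor f.
Proof. by move=> coefP psi_deg fi P; exact: stalk_flat coefP psi_deg P f fi. Qed.

(** * Ideals with a reduced spanning family *)

Section MonomialSums.
Variables (n : nat) (B : comNzRingType).
Implicit Types F : {mpoly B[n]}.

Lemma msupp_sum_over (V : zmodType) (phi : 'X_{1..n} -> V) F (s : seq 'X_{1..n}) :
  uniq s -> {subset msupp F <= s} -> (forall al, F@_al = 0 -> phi al = 0) ->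
  \sum_(al <- msupp F) phi al = \sum_(al <- s) phi al.
Proof.
move=> us sub phi0; rewrite [RHS](bigID (fun al => al \in msupp F)) /=.
rewrite [X in _ = _ + X]big1 ?addr0; last by move=> al /memN_msupp_eq0 /phi0.
rewrite -[RHS]big_filter; apply: perm_big; apply: uniq_perm.
- exact: msupp_uniq.
- exact: filter_uniq.
- by move=> al; rewrite mem_filter andb_idr // => /sub.
Qed.

End MonomialSums.

Section ReducedFamily.
Variables (n : nat) (B : comNzRingType) (D : pred 'X_{1..n}).
Variable h : 'X_{1..n} -> {mpoly B[n]}.
Implicit Types F G : {mpoly B[n]}.

(** As in a reduced Groebner basis, but with one member for every monomial of the
    initial ideal instead of one for every minimal generator; the family is then a
    basis of the ideal as a module and not only a set of generators. *)
Definition reduced : Prop :=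
  forall al be, D al -> D be -> (h al)@_be = (al == be)%:R.

(** A combination of the members of a reduced family is determined by its coefficients
    on [D], so [F] belongs to the span if and only if [spanned_part F = F]. *)
Definition spanned_part F : {mpoly B[n]} :=
  \sum_(al <- msupp F | D al) F@_al *: h al.

Lemma spanned_part_over F (s : seq 'X_{1..n}) : uniq s -> {subset msupp F <= s} ->
  spanned_part F = \sum_(al <- s | D al) F@_al *: h al.
Proof.
move=> us sub; rewrite /spanned_part big_mkcond [RHS]big_mkcond.
by apply: msupp_sum_over => // al ->; rewrite scale0r if_same.
Qed.

Lemma spanned_part_is_zmod_morphism : zmod_morphism spanned_part.
Proof.
move=> F G; pose s := undup (msupp F ++ msupp G).
have us : uniq s by exact: undup_uniq.
have sF : {subset msupp F <= s} by move=> al; rewrite mem_undup mem_cat => ->.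
have sG : {subset msupp G <= s} by move=> al; rewrite mem_undup mem_cat orbC => ->.
have sFG : {subset msupp (F - G) <= s} by move=> al /msuppB_le; rewrite mem_undup.
rewrite !(spanned_part_over us) // -sumrB; apply: eq_bigr => al _.
by rewrite mcoeffB scalerBl.
Qed.

HB.instance Definition _ := GRing.isZmodMorphism.Build {mpoly B[n]} {mpoly B[n]}
  spanned_part spanned_part_is_zmod_morphism.

Lemma spanned_partZ c F : spanned_part (c *: F) = c *: spanned_part F.
Proof.
rewrite (spanned_part_over (msupp_uniq F) (@msuppZ_le _ _ _ _)) scaler_sumr.
by apply: eq_bigr => al _; rewrite mcoeffZ scalerA.
Qed.

Hypothesis h_red : reduced.

Lemma spanned_part_coef F be : D be -> (spanned_part F)@_be = F@_be.
Proof.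
move=> Dbe; rewrite raddf_sum /=; under eq_bigr => al Dal do rewrite mcoeffZ h_red //.
have [beF|beF] := boolP (be \in msupp F).
  rewrite big_mkcond (bigD1_seq be) //= Dbe eqxx mulr1 big1 ?addr0 // => al /negPf ->.
  by rewrite mulr0 if_same.
rewrite (memN_msupp_eq0 beF) big_seq_cond big1 // => al /andP[alF _].
by case: eqP => [E|]; rewrite ?mulr0 // E (negPf beF) in alF *.
Qed.

Lemma spanned_part_h al : D al -> spanned_part (h al) = h al.
Proof.
move=> Dal; have al_h : al \in msupp (h al) by rewrite mcoeff_msupp h_red // eqxx oner_eq0.
rewrite /spanned_part big_mkcond (bigD1_seq al) //= Dal h_red // eqxx scale1r.
rewrite big1 ?addr0 // => be /negPf ne; case: ifP => // Dbe.
by rewrite h_red // eq_sym ne scale0r.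
Qed.

Lemma spanned_part_idem F : spanned_part (spanned_part F) = spanned_part F.
Proof.
rewrite {2}/spanned_part raddf_sum; apply: eq_bigr => al Dal.
by rewrite /= spanned_partZ spanned_part_h.
Qed.

Lemma spanned_part0 F : (forall al, D al -> F@_al = 0) -> spanned_part F = 0.
Proof. by move=> F0; rewrite /spanned_part big1 // => al /F0 ->; rewrite scale0r. Qed.

Lemma in_span_coefP F : spanned_part F = F <-> forall be,
  F@_be = \sum_(al <- msupp F | D al) F@_al * (h al)@_be.
Proof.
have E be : (spanned_part F)@_be = \sum_(al <- msupp F | D al) F@_al * (h al)@_be.
  by rewrite raddf_sum; apply: eq_bigr => al _; rewrite /= mcoeffZ.
by split=> [{1}<- be|H]; [rewrite E|apply/mpolyP => be; rewrite E -H].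
Qed.

Lemma span_ideal : (forall al ga, D al -> spanned_part ('X_[ga] * h al) = 'X_[ga] * h al) ->
  is_ideal [set F | spanned_part F = F].
Proof.
move=> hX; split=> /= [|F G EF EG|F G EG]; first exact: raddf0.
  by rewrite raddfD /= EF EG.
rewrite [F]mpolyE mulr_suml raddf_sum; apply: eq_bigr => ga _ /=.
rewrite -scalerAl spanned_partZ; congr (_ *: _).
have -> : 'X_[ga] * G = \sum_(al <- msupp G | D al) G@_al *: ('X_[ga] * h al).
  by rewrite -{1}EG mulr_sumr; apply: eq_bigr => al _; rewrite scalerAr.
by rewrite raddf_sum; apply: eq_bigr => al Dal /=; rewrite spanned_partZ hX.
Qed.

Section Degree.
Variable d : 'I_n -> nat.
Hypothesis h_deg : forall al, D al -> wgrading B d (wdeg d al) (h al).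

Lemma wpartZ e c F : wgrading B d e F -> wgrading B d e (c *: F).
Proof. by move=> eF al /msuppZ_le /eF. Qed.

Lemma spanned_part_deg e F : wgrading B d e F -> wgrading B d e (spanned_part F).
Proof.
move=> eF; rewrite /spanned_part big_seq_cond.
apply: (@gr_sum _ (wgrading B d)) => al /andP[alF Dal]; apply: wpartZ.
by rewrite -(eF al alF); exact: h_deg.
Qed.

Lemma span_homogeneous (I : ideal {mpoly B[n]}) :
  (forall F, I F <-> spanned_part F = F) -> homogeneous (wgrading B d) I.
Proof.
move=> IE k c hc /IE; rewrite raddf_sum => E i; apply/IE/eqP; rewrite -subr_eq0; apply/eqP.
apply: (wgrading_direct (c := fun i => spanned_part (c i) - c i)) => [j|].
  by apply: (@gpartB _ (wgrading B d)) => //; exact: spanned_part_deg.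
by rewrite /= sumrB E subrr.
Qed.

End Degree.

Section Quotient.
Variable I : ideal {mpoly B[n]}.
Hypothesis IE : forall F, I F <-> spanned_part F = F.

Lemma span_quot F : qproj I F = qproj I (F - spanned_part F).
Proof. by apply/qprojP; rewrite opprB addrC subrK; apply/IE; rewrite spanned_part_idem. Qed.

Definition quot_coef (x : quot I) (al : 'X_{1..n}) : B :=
  (repr x - spanned_part (repr x))@_al.

Lemma quot_coefE F al : quot_coef (qproj I F) al = (F - spanned_part F)@_al.
Proof.
rewrite /quot_coef; set F' := repr _.
have /qprojP/IE : qproj I F' = qproj I F by rewrite /F' {1}/qproj reprK.
rewrite raddfB => /eqP; rewrite subr_eq => /eqP ->.
by rewrite [X in X@__](_ : _ = F - spanned_part F) /=; ring.
Qed.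

Lemma quot_coordinates d (h_deg : forall al, D al -> wgrading B d (wdeg d al) (h al)) :
  graded_coordinates (quot_grading (wgrading B d) I) (qproj I \o @mpolyC n B)
    (fun al => qproj I 'X_[al]) quot_coef.
Proof.
have coef_spec F : qproj I F = \sum_(al <- msupp (F - spanned_part F))
    (qproj I \o @mpolyC n B) (quot_coef (qproj I F) al) * qproj I 'X_[al].
  rewrite {1}span_quot {1}[F - spanned_part F]mpolyE rmorph_sum; apply: eq_bigr => al _.
  by rewrite quot_coefE /= -mul_mpolyC rmorphM.
split=> [x y al|c x al|x].
- have [F ->] := qproj_surj x; have [G ->] := qproj_surj y.
  rewrite -rmorphD !quot_coefE raddfD -mcoeffD.
  by rewrite [X in X@__ = _](_ : _ = F - spanned_part F + (G - spanned_part G)) //=; ring.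
- have [F ->] := qproj_surj x; rewrite /= -rmorphM !quot_coefE mul_mpolyC spanned_partZ.
  by rewrite -scalerBr mcoeffZ.
- have [F ->] := qproj_surj x; exists (msupp (F - spanned_part F)); split.
  + exact: msupp_uniq.
  + exact: coef_spec.
  + by move=> al; rewrite quot_coefE => /memN_msupp_eq0.
  + move=> e [G eG /esym/qprojP/IE]; rewrite raddfB => E al.
    have -> : F - spanned_part F = G - spanned_part G.
      by move/eqP: E; rewrite subr_eq => /eqP ->; ring.
    have eGs : wgrading B d e (G - spanned_part G).
      by apply: (@gpartB _ (wgrading B d)) => //; exact: spanned_part_deg.
    move=> alG; exists 'X_[al] => // be; rewrite msuppX inE => /eqP ->.
    exact: eGs.
Qed.

Lemma quot_module_basis : module_basis (fun c => qproj I c%:MP_[n]) [set al | ~~ D al]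
  (fun al => qproj I 'X_[al]).
Proof.
split=> [s c us sD|x].
  under eq_bigr do rewrite -rmorphM mul_mpolyC.
  rewrite -rmorph_sum => /qproj_eq0/IE; set F := \sum_(al <- s) _.
  have FE al : al \in s -> F@_al = c al.
    move=> als; rewrite raddf_sum (bigD1_seq al) //= mcoeffZ mcoeffX eqxx mulr1.
    rewrite big1 ?addr0 // => be /negPf ne.
    by rewrite mcoeffZ mcoeffX ne mulr0.
  rewrite spanned_part0 => [F0 al als|al Dal]; first by rewrite -(FE al als) -F0 mcoeff0.
  rewrite raddf_sum big_seq big1 // => be bes.
  rewrite /= mcoeffZ mcoeffX; case: eqP => [E|]; rewrite ?mulr0 //.
  by have := sD _ bes; rewrite /= E Dal.
have [F ->] := qproj_surj x; exists (msupp (F - spanned_part F)), (quot_coef (qproj I F)).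
split=> [al|].
  rewrite mcoeff_msupp; apply: contraNN => Dal.
  by rewrite mcoeffB spanned_part_coef // subrr.
rewrite {1}span_quot {1}[F - spanned_part F]mpolyE rmorph_sum; apply: eq_bigr => al _.
by rewrite quot_coefE -mul_mpolyC rmorphM.
Qed.

End Quotient.
End ReducedFamily.

(** * Base change of polynomial rings and of their quotients *)

Section AdditiveOnDegree.
Variables (S : comPzRingType) (gr : grading S) (e : nat) (O : zmodType) (lam : S -> O).
Hypothesis lamD : forall s t, gr e s -> gr e t -> lam (s + t) = lam s + lam t.

Lemma additive_on_degree0 : lam 0 = 0.
Proof.
have := lamD (gpart0 gr e) (gpart0 gr e); rewrite addr0 => /eqP.
by rewrite -subr_eq0 opprD addNKr oppr_eq0 => /eqP.
Qed.

Lemma additive_on_degree_sum (J : eqType) (r : seq J) (F : J -> S) :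
  (forall j, j \in r -> gr e (F j)) ->
  lam (\sum_(j <- r) F j) = \sum_(j <- r) lam (F j).
Proof.
elim: r => [|j r IH] eF; first by rewrite !big_nil additive_on_degree0.
have er l : l \in r -> gr e (F l) by move=> lr; apply: eF; rewrite inE lr orbT.
rewrite !big_cons lamD ?IH //; first by apply: eF; rewrite mem_head.
by rewrite big_seq; apply: gr_sum.
Qed.
End AdditiveOnDegree.

Lemma wpartX n (B : comNzRingType) (d : 'I_n -> nat) e (F : {mpoly B[n]}) al :
  wgrading B d e F -> al \in msupp F -> wgrading B d e 'X_[al].
Proof. by move=> eF alF be; rewrite msuppX inE => /eqP ->; exact: eF. Qed.

Section PolynomialBaseChange.
Variables (n : nat) (B B' : comNzRingType) (eps : {rmorphism B -> B'}) (d : 'I_n -> nat).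

Lemma polynomial_base_change :
  graded_base_change (wgrading B d) (wgrading B' d)
    (map_mpoly eps : {rmorphism {mpoly B[n]} -> {mpoly B'[n]}})
    (@mpolyC n B) (@mpolyC n B') eps.
Proof.
split=> [e F|||e F eF|e O rho lam rhoB rhoM lamD lamZ].
- exact: map_mpoly_deg.
- by split=> c; exact: mpolyC_deg.
- by move=> c; rewrite /= map_mpolyC.
- exists (size (msupp F)), (fun i => F@_(tnth (in_tuple (msupp F)) i)),
    (fun i => 'X_[tnth (in_tuple (msupp F)) i]); split=> [i|].
    by move=> be; rewrite msuppX inE => /eqP ->; apply: eF; exact: mem_tnth.
  rewrite {1}[F]mpolyE big_tnth; apply: eq_bigr => i _ /=.
  by rewrite map_mpolyX mul_mpolyC.
have rho0 : rho 0 = 0 by rewrite -(subrr 0) rhoB subrr.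
have rhoD a b : rho (a + b) = rho a + rho b.
  by apply/eqP; rewrite -subr_eq -rhoB addrK.
pose Phi F := \sum_(al <- msupp F) rho F@_al * lam 'X_[al].
have PhiE F s : uniq s -> {subset msupp F <= s} ->
    Phi F = \sum_(al <- s) rho F@_al * lam 'X_[al].
  by move=> us sub; apply: msupp_sum_over => // al ->; rewrite rho0 mul0r.
exists Phi; split=> [F G _ _|c s es].
  pose s := undup (msupp F ++ msupp G).
  rewrite !(PhiE _ s) ?undup_uniq //.
  - by rewrite -big_split; apply: eq_bigr => al _ /=; rewrite mcoeffD rhoD mulrDl.
  - by move=> al; rewrite mem_undup mem_cat orbC => ->.
  - by move=> al; rewrite mem_undup mem_cat => ->.
  - by move=> al /msuppD_le; rewrite mem_undup.
rewrite (PhiE _ (msupp s)) ?msupp_uniq //; last first.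
  move=> al; rewrite mcoeff_msupp /= mul_mpolyC mcoeffZ mcoeff_map_mpoly.
  by rewrite mcoeff_msupp; apply: contraNN => /eqP ->; rewrite raddf0 mulr0.
rewrite [X in lam X](mpolyE s) (@additive_on_degree_sum _ _ _ _ _ lamD) => [|al als]; last first.
  by apply: wpartZ; exact: wpartX als.
rewrite [RHS]mulr_sumr; apply: eq_big_seq => al als.
rewrite -mul_mpolyC lamZ; last exact: wpartX als.
by rewrite /= mul_mpolyC mcoeffZ mcoeff_map_mpoly rhoM.2 mulrA.
Qed.

End PolynomialBaseChange.

Section QuotientBaseChange.
Variables (n : nat) (B : comNzRingType) (K : fieldType) (eps : {rmorphism B -> K}).
Variables (d : 'I_n -> nat) (D : pred 'X_{1..n}).
Variables (h : 'X_{1..n} -> {mpoly B[n]}) (h' : 'X_{1..n} -> {mpoly K[n]}).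
Hypotheses (h_red : reduced D h) (h_deg : forall al, D al -> wgrading B d (wdeg d al) (h al)).
Hypothesis (h'_red : reduced D h').
Variables (I : ideal {mpoly B[n]}) (I' : ideal {mpoly K[n]}).
Hypotheses (IE : forall F, I F <-> spanned_part D h F = F).
Hypotheses (IE' : forall F, I' F <-> spanned_part D h' F = F).
Variable theta : 'I_n -> K.
Hypothesis theta_neq0 : forall i, theta i != 0.

Definition torus_weight (al : 'X_{1..n}) : K := \prod_i theta i ^+ al i.

Definition specialize : {mpoly B[n]} -> {mpoly K[n]} :=
  mmap (@mpolyC n K \o eps) (fun i => theta i *: 'X_i).

HB.instance Definition _ := GRing.RMorphism.on specialize.

Lemma torus_weight_neq0 al : torus_weight al != 0.
Proof. by apply/prodf_neq0 => i _; rewrite expf_neq0. Qed.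

Lemma specializeX al : specialize 'X_[al] = torus_weight al *: 'X_[al].
Proof.
rewrite /specialize mmapX /mmap1; under eq_bigr do rewrite exprZn.
by rewrite scaler_prod -mpolyXE_id.
Qed.

Lemma specializeC c : specialize c%:MP = (eps c)%:MP.
Proof. by rewrite /specialize mmapC. Qed.

Lemma specialize_coef F al : (specialize F)@_al = eps F@_al * torus_weight al.
Proof.
rewrite {1}[F]mpolyE rmorph_sum raddf_sum /=.
have E be : (specialize (F@_be *: 'X_[be]))@_al = (eps F@_be * torus_weight be) * (be == al)%:R.
  by rewrite -mul_mpolyC rmorphM /= specializeX specializeC mul_mpolyC !mcoeffZ mcoeffX mulrA.
under eq_bigr do rewrite E.
have [alF|alF] := boolP (al \in msupp F).
  rewrite (bigD1_seq al) //= eqxx mulr1 big1 ?addr0 // => be /negPf ->.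
  by rewrite mulr0.
rewrite (memN_msupp_eq0 alF) raddf0 mul0r big_seq big1 // => be beF.
by case: eqP => [E'|]; rewrite ?mulr0 // -E' beF in alF *.
Qed.

Hypothesis h_special : forall al, D al -> specialize (h al) = torus_weight al *: h' al.

Lemma specialize_spanned_part F :
  specialize (spanned_part D h F) = spanned_part D h' (specialize F).
Proof.
rewrite (spanned_part_over D h' (msupp_uniq F)); last first.
  move=> al; rewrite !mcoeff_msupp specialize_coef; apply: contraNN => /eqP ->.
  by rewrite raddf0 mul0r.
rewrite rmorph_sum; apply: eq_bigr => al Dal /=.
by rewrite -mul_mpolyC rmorphM /= specializeC h_special // specialize_coef mul_mpolyC scalerA.
Qed.

Lemma specialize_deg e F : wgrading B d e F -> wgrading K d e (specialize F).
Proof.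
move=> eF al; rewrite mcoeff_msupp specialize_coef => H; apply: eF.
by rewrite mcoeff_msupp; apply: contraNN H => /eqP ->; rewrite raddf0 mul0r.
Qed.

Lemma specialize_ideal a : I a -> (qproj I' \o specialize) a = 0.
Proof.
by move=> /IE E; apply/qproj_eq0/IE'; rewrite -specialize_spanned_part E.
Qed.

Definition quot_specialize : quot I -> quot I' := qlift specialize_ideal.

HB.instance Definition _ := GRing.RMorphism.on quot_specialize.

Lemma quot_specializeE F : quot_specialize (qproj I F) = qproj I' (specialize F).
Proof. exact: qliftE. Qed.

Hypothesis eps_surj : forall c, exists b, eps b = c.

(** An element of degree [e] that is killed has a representative all of whose
    coefficients are killed by [eps]: subtract its combination of the [h al]. *)
Lemma quotient_base_change :
  graded_base_change (quot_grading (wgrading B d) I) (quot_grading (wgrading K d) I')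
    quot_specialize (qproj I \o @mpolyC n B) (qproj I' \o @mpolyC n K) eps.
Proof.
split=> [e x [F eF <-]|||e x [F eF <-]|e O rho lam rhoB rhoM lamD lamZ].
- by rewrite /= quot_specializeE; apply: quot_deg; exact: specialize_deg.
- by split=> c; apply: quot_deg; exact: mpolyC_deg.
- by move=> c; exact: etrans (quot_specializeE _) (congr1 _ (specializeC c)).
- exists (size (msupp F)),
    (fun i => let al := tnth (in_tuple (msupp F)) i in F@_al / torus_weight al),
    (fun i => qproj I 'X_[tnth (in_tuple (msupp F)) i]); split=> [i|].
    by apply: quot_deg => be; rewrite msuppX inE => /eqP ->; apply: eF; exact: mem_tnth.
  rewrite {1}[F]mpolyE rmorph_sum big_tnth; apply: eq_bigr => i _ /=.
  rewrite /= quot_specializeE /= specializeX -rmorphM mul_mpolyC scalerA.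
  by rewrite divfK ?torus_weight_neq0.
have rho0 : rho 0 = 0 by rewrite -(subrr 0) rhoB subrr.
have lam_ker F : wgrading B d e F -> quot_specialize (qproj I F) = 0 -> lam (qproj I F) = 0.
  move=> eF; rewrite /= quot_specializeE => /qproj_eq0/IE' E.
  rewrite (span_quot h_red IE); set G := F - _.
  have eG : wgrading B d e G.
    by apply: (@gpartB _ (wgrading B d)) => //; exact: spanned_part_deg.
  have G0 al : eps G@_al = 0.
    have : specialize G = 0 by rewrite rmorphB /= specialize_spanned_part E subrr.
    move=> /(congr1 (mcoeff al)); rewrite mcoeff0 specialize_coef => /eqP.
    by rewrite mulf_eq0 (negPf (torus_weight_neq0 al)) orbF => /eqP.
  have eX al : al \in msupp G -> quot_grading (wgrading B d) I e (qproj I 'X_[al]).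
    by move=> alG; apply: quot_deg; exact: wpartX alG.
  rewrite [G]mpolyE rmorph_sum (@additive_on_degree_sum _ _ _ _ _ lamD) => [|al alG]; last first.
    by apply: quot_deg; apply: wpartZ; exact: wpartX alG.
  rewrite big_seq big1 // => al alG; rewrite -mul_mpolyC rmorphM.
  by rewrite (lamZ G@_al) ?G0 ?rho0 ?mul0r //; exact: eX.
have lift x : exists y, quot_grading (wgrading K d) I' e x ->
    quot_grading (wgrading B d) I e y /\ quot_specialize y = x.
  have [ex|nex] := pselect (quot_grading (wgrading K d) I' e x); last by exists 0.
  have [F eF Fx] := ex.
  have /choice[c cP] : forall al, exists b, eps b = F@_al / torus_weight al.
    by move=> al; exact: eps_surj.
  exists (qproj I (\sum_(al <- msupp F) c al *: 'X_[al])) => _; split.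
    apply: quot_deg; rewrite big_seq; apply: (@gr_sum _ (wgrading B d)) => al alF.
    by apply: wpartZ => be; rewrite msuppX inE => /eqP ->; exact: eF.
  rewrite /= quot_specializeE -Fx; congr (qproj I' _).
  rewrite rmorph_sum [RHS]mpolyE; apply: eq_bigr => al _.
  rewrite -[c al *: _]mul_mpolyC rmorphM /= specializeC specializeX cP.
  by rewrite mul_mpolyC scalerA divfK ?torus_weight_neq0.
have /choice[L LP] := lift.
have lam_eq x y : quot_grading (wgrading B d) I e x -> quot_grading (wgrading B d) I e y ->
    quot_specialize x = quot_specialize y -> lam x = lam y.
  move=> ex ey E; have exy := gpartB ex ey.
  have : lam (x - y) = 0.
    have [F eF FE] := exy; rewrite -FE; apply: lam_ker => //.
    by rewrite FE rmorphB /= E subrr.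
  by move=> H; rewrite -[x](subrK y) lamD // H add0r.
exists (lam \o L); split=> [x y ex ey|c s es] /=.
  have [eLx Lx] := LP x ex; have [eLy Ly] := LP y ey.
  have [eLxy Lxy] := LP _ (gpartD ex ey).
  rewrite -lamD //; apply: lam_eq => //; first exact: gpartD.
  by rewrite Lxy rmorphD /= Lx Ly.
have [b bc] := eps_surj c.
have ebs : quot_grading (wgrading B d) I e ((qproj I \o @mpolyC n B) b * s).
  rewrite -[e]add0n; apply: gpartM => //; apply: quot_deg; exact: mpolyC_deg.
have E : quot_specialize ((qproj I \o @mpolyC n B) b * s) =
    (qproj I' \o @mpolyC n K) c * quot_specialize s.
  by rewrite rmorphM /= quot_specializeE /= specializeC bc.
have eT : quot_grading (wgrading K d) I' e (quot_specialize ((qproj I \o @mpolyC n B) b * s)).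
  have [F eF <-] := ebs; rewrite /= quot_specializeE; apply: quot_deg.
  exact: specialize_deg.
rewrite -[X in lam (L X)]E; have [eL LE] := LP _ eT.
by rewrite (lam_eq _ _ eL ebs LE) (lamZ b) // bc.
Qed.

End QuotientBaseChange.

(** * Reduced normal forms *)

Lemma seq_maximum (T : eqType) (R : rel T) (s : seq T) : transitive R -> total R ->
  s != [::] -> exists2 x, x \in s & forall y, y \in s -> R y x.
Proof.
move=> R_trans R_total; have Rxx x : R x x by have := R_total x x; rewrite orbb.
elim: s => // x s IH _; have [->|/IH[y ys yM]] := eqVneq s [::].
  by exists x; rewrite ?mem_head // => y; rewrite inE => /eqP ->.
have [Rxy|Ryx] := orP (R_total x y).
  by exists y => [|z]; rewrite inE ?ys ?orbT // => /orP[/eqP ->|/yM].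
exists x => [|z]; rewrite ?mem_head // inE => /orP[/eqP ->//|/yM Rzy].
exact: R_trans Rzy Ryx.
Qed.

Section NormalForms.
Variables (K : fieldType) (n : nat) (d : 'I_n -> nat) (le : term_order n).
Variable J : ideal {mpoly K[n]}.
Hypotheses (d_gt0 : forall i, (0 < d i)%N) (J_homog : homogeneous (wgrading K d) J).
Implicit Types (f g : {mpoly K[n]}) (al be ga : 'X_{1..n}).

Lemma subsum_coef (B : comNzRingType) (F : {mpoly B[n]}) (Q : pred 'X_{1..n}) be :
  (\sum_(al <- msupp F | Q al) F@_al *: 'X_[al])@_be = if Q be then F@_be else 0.
Proof.
rewrite raddf_sum big_mkcond /=; have [beF|beF] := boolP (be \in msupp F).
  rewrite (bigD1_seq be) //= mcoeffZ mcoeffX eqxx mulr1 big1 ?addr0 // => al /negPf ne.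
  by rewrite mcoeffZ mcoeffX ne mulr0 if_same.
rewrite (memN_msupp_eq0 beF) if_same big_seq big1 // => al alF.
rewrite mcoeffZ mcoeffX; case: eqP => [E|_]; last by rewrite mulr0 if_same.
by rewrite -E alF in beF.
Qed.

Lemma ideal_sum (S : comPzRingType) (I : ideal S) (A : eqType) (r : seq A) (Q : pred A)
    (F : A -> S) : (forall a, a \in r -> Q a -> I (F a)) -> I (\sum_(a <- r | Q a) F a).
Proof.
case: (idealP I) => I0 ID _ H; rewrite big_seq_cond.
by apply: big_ind => // a /andP[]; exact: H.
Qed.

Lemma idealZ (B : comNzRingType) (I : ideal {mpoly B[n]}) c F : I F -> I (c *: F).
Proof. by case: (idealP I) => _ _ IM IF; rewrite -mul_mpolyC; exact: IM. Qed.

Lemma idealB (S : comPzRingType) (I : ideal S) a b : I a -> I b -> I (a - b).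
Proof. by case: (idealP I) => _ ID _ Ia /idealN; exact: ID. Qed.

Lemma idgen_mem (S : comPzRingType) (A : set S) a : A a -> idgen A a.
Proof. by move=> Aa I [_]; apply. Qed.

Lemma idgen_sub (S : comPzRingType) (A : set S) (I : set S) :
  is_ideal I -> A `<=` I -> idgen A `<=` I.
Proof. by move=> iI AI a; apply. Qed.

Definition nonstandard : pred 'X_{1..n} := fun al => `[< in_to_ideal le J 'X_[al] >].

Lemma in_to_coef f be :
  (in_to le f)@_be = if all (fun al => le al be) (msupp f) then f@_be else 0.
Proof. exact: subsum_coef. Qed.

Definition leading al : Prop :=
  exists f, [/\ J f, f@_al = 1 & forall be, be \in msupp f -> le be al].

(** Every monomial of an element of an ideal generated by terms is a multiple of a
    generator; here these are leading monomials of elements of [J], and so are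
    their multiples. *)
Lemma in_to_ideal_leading F be : in_to_ideal le J F -> be \in msupp F -> leading be.
Proof.
have mulX ga f : J f -> J ('X_[ga] * f) by case: (idealP J) => _ _ JM; exact: JM.
move: F be; pose W : set {mpoly K[n]} := [set F | forall be, be \in msupp F -> leading be].
suff WI : in_to_ideal le J `<=` W by move=> F be /WI; exact.
apply: idgen_sub => [|_ [f Jf <-] be].
  split=> [be|F G WF WG be|F G WG be]; first by rewrite msupp0.
    by move=> /msuppD_le; rewrite mem_cat => /orP[/WF|/WG].
  move=> /msuppM_le/allpairsP[[ga de] /= [_ /WG[f [Jf f1 fle]] ->]].
  exists ('X_[ga] * f); split; first exact: mulX.
    by rewrite mulrC mcoeffMX.
  move=> be'; rewrite mulrC (perm_mem (msuppMX _ _)) => /mapP[be'' /fle le_be ->].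
  exact: tleD.
rewrite mcoeff_msupp in_to_coef; case: allP => [fle fbe|]; last by rewrite eqxx.
exists ((f@_be)^-1 *: f); split; first exact: idealZ.
  by rewrite mcoeffZ mulVf.
by move=> ga /msuppZ_le /fle.
Qed.

Lemma nonstandardP al : reflect (leading al) (nonstandard al).
Proof.
apply: (iffP idP) => [/asboolP al_in|[f [Jf f1 fle]]].
  by apply: (in_to_ideal_leading al_in); rewrite msuppX mem_head.
apply/asboolP; apply: idgen_mem; exists f => //; apply/mpolyP => be.
rewrite in_to_coef mcoeffX; have [<-|ne] := eqVneq al be; first by rewrite f1 (introT allP fle).
case: allP => // le_be; have alf : al \in msupp f by rewrite mcoeff_msupp f1 oner_eq0.
apply/eqP; have [bef|/memN_msupp_eq0 -> //] := boolP (be \in msupp f).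
by case/eqP: ne; apply: (@tle_anti _ le); rewrite fle // le_be.
Qed.

Lemma max_monomial f : f != 0 -> exists2 al, al \in msupp f &
  forall be, be \in msupp f -> le be al.
Proof.
rewrite -msupp_eq0; apply: (seq_maximum (R := le)).
- exact: tle_trans.
- exact: tle_total.
Qed.

(** The leading monomial of a nonzero element of [J] is nonstandard. *)
Lemma standard_eq0 f : J f -> (forall al, nonstandard al -> f@_al = 0) -> f = 0.
Proof.
move=> Jf f0; apply/eqP; apply: contrapT => /negP /max_monomial[al alf fle].
have fal : f@_al != 0 by rewrite -mcoeff_msupp.
have : nonstandard al.
  apply/nonstandardP; exists ((f@_al)^-1 *: f); split; first exact: idealZ.
    by rewrite mcoeffZ mulVf.
  by move=> be /msuppZ_le /fle.
by move/f0/eqP; rewrite (negPf fal).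
Qed.

Lemma homogeneous_component f e : J f -> exists f', [/\ J f', wgrading K d e f' &
  forall be, f'@_be = if wdeg d be == e then f@_be else 0].
Proof.
have [k [c [hc ->]]] := gpart_sum (wgrading K d) f => Jf.
have cE i be : (c i)@_be = if wdeg d be == i then (\sum_i c i)@_be else 0.
  case: eqP => [E|ne]; last first.
    by apply: memN_msupp_eq0; apply/negP => /hc.
  rewrite raddf_sum (bigD1 i) //= big1 ?addr0 // => j ji.
  apply: memN_msupp_eq0; apply: contraNN ji => /hc E'; apply/eqP/val_inj.
  by rewrite /= -E -E'.
have [ek|ke] := ltnP e k.
  exists (c (Ordinal ek)); split=> [||be]; last by rewrite cE.
    exact: (J_homog hc Jf).
  exact: hc (Ordinal ek).
exists 0; split=> [||be]; [by case: (idealP J)|exact: (gpart0 (wgrading K d))|].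
rewrite mcoeff0 raddf_sum; case: eqP => // E; rewrite big1 // => i _.
by rewrite /= cE E gtn_eqF // (leq_trans (ltn_ord i)).
Qed.

Definition normal_form al g : Prop :=
  [/\ J g, g@_al = 1, forall be, nonstandard be -> be != al -> g@_be = 0 &
      wgrading K d (wdeg d al) g].

Lemma mdeg_le_wdeg al : (mdeg al <= wdeg d al)%N.
Proof.
by rewrite mdegE /wdeg; apply: leq_sum => i _; rewrite leq_pmull.
Qed.

(** Reduction of a homogeneous element of [J] with leading monomial [al]; the
    recursion stops because [al] has only finitely many smaller monomials of the
    same degree. *)
Lemma normal_form_exists al : nonstandard al -> exists g, normal_form al g.
Proof.
pose e := wdeg d al.
pose below ga := [set be : 'X_{1..n < e.+1} | [&& le be ga, (be : 'X_{1..n}) != ga &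
  wdeg d be == e]]%SET.
suff H N ga : (#|below ga| < N)%N -> wdeg d ga = e -> nonstandard ga ->
    exists g, normal_form ga g by exact: H (ltnSn _) erefl.
elim: N ga => // N IH ga; rewrite ltnS => leN ega Dga.
have /nonstandardP[f0 [Jf0 f01 f0le]] := Dga.
have [f [Jf ef fE]] := homogeneous_component e Jf0.
have f1 : f@_ga = 1 by rewrite fE ega eqxx.
have fle be : be \in msupp f -> le be ga.
  by rewrite mcoeff_msupp fE; case: ifP; rewrite ?eqxx // -mcoeff_msupp => _; exact: f0le.
have /choice[g gP] : forall be, exists g, be \in msupp f -> be != ga -> nonstandard be ->
    normal_form be g.
  move=> be; have [[bef [ne Dbe]]|nH] :=
    pselect (be \in msupp f /\ be != ga /\ nonstandard be); last first.
    by exists 0 => bef ne Dbe; case: nH.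
  have ebe := ef _ bef; have ble : (mdeg be < e.+1)%N by rewrite ltnS -ebe mdeg_le_wdeg.
  have [|||g gP] := IH be => //; last by exists g.
  apply: leq_trans leN; apply: proper_card; apply/properP; split.
    apply/fintype.subsetP => de; rewrite !inE => /and3P[le_db ne_db ->]; rewrite andbT.
    rewrite (tle_trans le_db (fle _ bef)) /=; apply: contraNN ne_db => /eqP E.
    by apply/eqP/(@tle_anti _ le); rewrite le_db E fle.
  exists (BMultinom ble); first by rewrite inE /= fle // ne ebe eqxx.
  by rewrite inE /= eqxx andbF.
pose Q be := (be != ga) && nonstandard be.
pose S := \sum_(be <- msupp f | Q be) f@_be *: g be.
have SE de : nonstandard de -> S@_de = if Q de then f@_de else 0.
  move=> Dde; rewrite raddf_sum /= -(subsum_coef f Q de) raddf_sum /=.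
  rewrite big_seq_cond [RHS]big_seq_cond; apply: eq_bigr => be /andP[bef /andP[ne Dbe]].
  have [_ g1 g0 _] := gP be bef ne Dbe; rewrite !mcoeffZ mcoeffX.
  by have [<-|ne'] := eqVneq be de; rewrite ?g1 // g0 // eq_sym.
exists (f - S); split.
- apply: idealB => //; apply: ideal_sum => be bef /andP[ne Dbe]; apply: idealZ.
  by case: (gP be bef ne Dbe).
- by rewrite mcoeffB f1 SE // /Q eqxx subr0.
- by move=> be Dbe ne; rewrite mcoeffB SE // /Q ne Dbe subrr.
- apply: (@gpartB _ (wgrading K d)); rewrite ega //; rewrite /S big_seq_cond.
  apply: (@gr_sum _ (wgrading K d)) => be /andP[bef /andP[ne Dbe]]; apply: wpartZ.
  by rewrite -(ef _ bef); case: (gP be bef ne Dbe).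
Qed.

Lemma normal_forms : exists g : 'X_{1..n} -> {mpoly K[n]},
  [/\ forall al, nonstandard al -> J (g al),
      reduced nonstandard g,
      forall al, nonstandard al -> wgrading K d (wdeg d al) (g al) &
      forall f, J f <-> spanned_part nonstandard g f = f].
Proof.
have /choice[g gP] : forall al, exists g, nonstandard al -> normal_form al g.
  move=> al; have [Dal|] := boolP (nonstandard al); last by exists 0.
  by have [g gP] := normal_form_exists Dal; exists g.
have g_red : reduced nonstandard g.
  move=> al be Dal Dbe; have [_ g1 g0 _] := gP al Dal.
  by have [<-//|ne] := eqVneq al be; rewrite g0 // eq_sym.
have Jspan f : J (spanned_part nonstandard g f).
  by apply: ideal_sum => al _ Dal; apply: idealZ; case: (gP al Dal).
exists g; split=> // [al /gP[]//|al /gP[]//|f].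
split=> [Jf|<-//]; apply/eqP; rewrite eq_sym -subr_eq0; apply/eqP.
apply: standard_eq0 => [|al Dal]; first exact: idealB.
by rewrite mcoeffB spanned_part_coef // subrr.
Qed.

End NormalForms.

(** * Deformations of an ideal by weights *)

Section Deformation.
Variables (K : fieldType) (n : nat) (D : pred 'X_{1..n}) (J : ideal {mpoly K[n]}).
Variable g : 'X_{1..n} -> {mpoly K[n]}.
Hypotheses (Jg : forall al, D al -> J (g al)) (g_red : reduced D g).
Hypothesis JE : forall f, J f <-> spanned_part D g f = f.

Variables (B : comNzRingType) (iota : {rmorphism K -> B}) (W : zmodType).
Variables (leW : W -> W -> Prop) (om : 'X_{1..n} -> W) (c : W -> W -> B).

(** [twist s f] rescales every term of [f] by a coefficient [c s (om al)] that
    depends on its weight relative to a lower bound [s] of the weights of [f].  The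
    initial form for a weight vector (with [c] the Kronecker symbol) and the
    homogenisation [tilde] (with [c] a monomial in [t]) are both of this kind. *)
Definition twist (s : W) (f : {mpoly K[n]}) : {mpoly B[n]} :=
  \sum_(al <- msupp f) (iota f@_al * c s (om al)) *: 'X_[al].

Hypothesis omD : forall al be, om (al + be)%MM = om al + om be.
Hypothesis c_refl : forall s, c s s = 1.
Hypothesis c_trans : forall s s' s'', leW s s' -> leW s' s'' -> c s s' * c s' s'' = c s s''.
Hypothesis c_add : forall s s' u, c (s + u) (s' + u) = c s s'.
Hypothesis le_add : forall s s' u, leW s s' -> leW (s + u) (s' + u).
Hypothesis g_le : forall al be, D al -> be \in msupp (g al) -> leW (om al) (om be).

Definition deform al : {mpoly B[n]} := twist (om al) (g al).

Lemma twist_coef s f be : (twist s f)@_be = iota f@_be * c s (om be).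
Proof.
rewrite raddf_sum /=; have [bef|bef] := boolP (be \in msupp f).
  rewrite (bigD1_seq be) //= mcoeffZ mcoeffX eqxx mulr1 big1 ?addr0 // => al /negPf ne.
  by rewrite mcoeffZ mcoeffX ne mulr0.
rewrite (memN_msupp_eq0 bef) rmorph0 mul0r big_seq big1 // => al alf.
by rewrite mcoeffZ mcoeffX; case: eqP => [E|]; rewrite ?mulr0 // -E alf in bef *.
Qed.

Lemma twist_supp s f : {subset msupp (twist s f) <= msupp f}.
Proof.
move=> al; rewrite !mcoeff_msupp twist_coef; apply: contraNN => /eqP ->.
by rewrite rmorph0 mul0r.
Qed.

Lemma deform_reduced : reduced D deform.
Proof.
move=> al be Dal Dbe; rewrite twist_coef g_red //.
by have [<-|] := eqVneq al be; rewrite ?rmorph1 ?mul1r ?c_refl // rmorph0 mul0r.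
Qed.

(** Twisting the expansion of [f] in the [g al] gives the expansion of [twist s f],
    because the factors [c s (om al)] and [c (om al) (om be)] compose. *)
Lemma twist_span s f : J f -> (forall al, al \in msupp f -> leW s (om al)) ->
  spanned_part D deform (twist s f) = twist s f.
Proof.
move=> /JE/in_span_coefP fE sf; apply/mpolyP => be.
rewrite (spanned_part_over D deform (msupp_uniq f)); last exact: twist_supp.
rewrite twist_coef [f@_be]fE rmorph_sum mulr_suml raddf_sum /=.
rewrite big_seq_cond [RHS]big_seq_cond; apply: eq_bigr => al /andP[alf Dal].
rewrite mcoeffZ !twist_coef rmorphM.
have [beg|/memN_msupp_eq0 ->] := boolP (be \in msupp (g al)).
  by rewrite -(c_trans (sf al alf) (g_le Dal beg)); ring.
by rewrite !rmorph0; ring.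
Qed.

Lemma twist_mulX s f ga : 'X_[ga] * twist s f = twist (s + om ga) ('X_[ga] * f).
Proof.
rewrite [in RHS]mulrC /twist [LHS]mulr_sumr (perm_big _ (msuppMX f ga)) [RHS]big_map.
apply: eq_bigr => al _; rewrite mcoeffMX omD [om ga + _]addrC c_add.
by rewrite mpolyXD scalerAr.
Qed.

(** By [twist_span], the span of the deformed family contains the twists of all
    elements of [J]; multiples of these by monomials are again twists. *)
Lemma deform_ideal (A : set {mpoly B[n]}) :
  (forall al, D al -> A (deform al)) ->
  (forall F, A F -> exists f s,
     [/\ J f, (forall al, al \in msupp f -> leW s (om al)) & F = twist s f]) ->
  forall F, idgen A F <-> spanned_part D deform F = F.
Proof.
move=> hA AE F; split=> [|<-]; last first.
  by apply: ideal_sum => al _ Dal; apply: idealZ; apply: idgen_mem; exact: hA.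
move: F; apply: (@idgen_sub _ A [set F | spanned_part D deform F = F]); last first.
  by move=> _ /AE[f [s [Jf sf ->]]]; exact: twist_span.
apply: span_ideal => al ga Dal; rewrite /deform twist_mulX; apply: twist_span.
  by case: (idealP J) => _ _ JM; apply: JM; exact: Jg.
move=> be; rewrite mulrC (perm_mem (msuppMX _ _)) => /mapP[be' be'g ->].
by rewrite omD [om ga + _]addrC; apply: le_add; exact: g_le.
Qed.

Lemma deform_deg d : (forall al, D al -> wgrading K d (wdeg d al) (g al)) ->
  forall al, D al -> wgrading B d (wdeg d al) (deform al).
Proof. by move=> g_deg al Dal be /twist_supp; exact: g_deg. Qed.

End Deformation.

(** * Initial forms *)

Section InitialForms.
Variables (K : fieldType) (R : realType) (n : nat) (D : pred 'X_{1..n}).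
Variables (J : ideal {mpoly K[n]}) (g : 'X_{1..n} -> {mpoly K[n]}).
Hypotheses (Jg : forall al, D al -> J (g al)) (g_red : reduced D g).
Hypothesis JE : forall f, J f <-> spanned_part D g f = f.
Implicit Types v w : 'rV[R]_n.

Lemma wdotD v al be : wdot v (al + be)%MM = wdot v al + wdot v be.
Proof.
by rewrite -big_split; apply: eq_bigr => i _; rewrite /= mnmDE natrD mulrDr.
Qed.

Lemma wdot_linear v w s al : wdot (v + s *: w) al = wdot v al + s * wdot w al.
Proof.
rewrite /wdot mulr_sumr -big_split; apply: eq_bigr => i _ /=.
by rewrite !mxE mulrDl mulrA.
Qed.

Lemma wdotN v al : wdot (- v) al = - wdot v al.
Proof. by rewrite /wdot -sumrN; apply: eq_bigr => i _; rewrite mxE mulNr. Qed.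

Lemma in_w_coef v (f : {mpoly K[n]}) be :
  (in_w v f)@_be = if all (fun al => wdot v be <= wdot v al) (msupp f) then f@_be else 0.
Proof. exact: subsum_coef. Qed.

Definition kron (s s' : R) : K := (s == s')%:R.

Local Notation wtwist v := (twist idfun (wdot v) kron).

Lemma in_w_twist v f al : (forall be, be \in msupp f -> wdot v al <= wdot v be) ->
  al \in msupp f -> in_w v f = wtwist v (wdot v al) f.
Proof.
move=> al_min alf; apply/mpolyP => be; rewrite in_w_coef twist_coef /kron /=.
have [bef|/memN_msupp_eq0 ->] := boolP (be \in msupp f); last by rewrite if_same mul0r.
have [E|ne] := eqVneq (wdot v al) (wdot v be).
  by rewrite mulr1 -E (introT allP al_min).
rewrite mulr0; case: allP => // /(_ al alf) le_ba; case/eqP: ne.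
by apply/le_anti; rewrite le_ba al_min.
Qed.

Lemma min_monomial v (f : {mpoly K[n]}) : f != 0 -> exists2 al, al \in msupp f &
  forall be, be \in msupp f -> wdot v al <= wdot v be.
Proof.
rewrite -msupp_eq0; apply: (seq_maximum (R := fun al be => wdot v be <= wdot v al)).
  by move=> be al ga /= ab bc; exact: le_trans bc ab.
by move=> al be; exact: le_total.
Qed.

Lemma in_w0 v : in_w v (0 : {mpoly K[n]}) = 0.
Proof. by rewrite /in_w msupp0 big_nil. Qed.

Lemma mem_msupp_g al : D al -> al \in msupp (g al).
Proof. by move=> Dal; rewrite mcoeff_msupp g_red // eqxx oner_eq0. Qed.

(** The leading monomial of every [g al] occurs in its initial form for [v]. *)
Definition selects v : Prop :=
  forall al be, D al -> be \in msupp (g al) -> wdot v al <= wdot v be.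

Lemma kron_trans (s s' s'' : R) : s <= s' -> s' <= s'' ->
  kron s s' * kron s' s'' = kron s s''.
Proof.
move=> le1 le2; rewrite /kron; have [E|ne] := eqVneq s s'; first by rewrite mul1r E.
rewrite mul0r; case: eqP => // E; case/eqP: ne; apply/le_anti.
by rewrite le1 E.
Qed.

Lemma in_w_deform v al : selects v -> D al ->
  in_w v (g al) = deform g idfun (wdot v) kron al.
Proof.
by move=> sv Dal; apply: in_w_twist; [move=> be; exact: sv|exact: mem_msupp_g].
Qed.

Lemma in_ideal_span v : selects v -> forall F,
  in_ideal v J F <-> spanned_part D (deform g idfun (wdot v) kron) F = F.
Proof.
move=> sv; apply: (@deform_ideal K n D J g Jg JE K idfun R (fun s s' : R => s <= s') (wdot v) kron).
- exact: wdotD.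
- exact: kron_trans.
- by move=> s s' u; rewrite /kron (inj_eq (addIr u)).
- by move=> s s' u; rewrite lerD2r.
- exact: sv.
- by move=> al Dal; exists (g al); [exact: Jg|rewrite in_w_deform].
move=> _ [f Jf <-]; have [->|/(min_monomial v)[al alf alM]] := eqVneq f 0.
  exists 0, 0; split; [by case: (idealP J)|by move=> al; rewrite msupp0|].
  by rewrite in_w0 /twist msupp0 big_nil.
by exists f, (wdot v al); split=> //; exact: in_w_twist.
Qed.

Lemma in_deform_reduced v : reduced D (deform g idfun (wdot v) kron).
Proof. by apply: deform_reduced => // s; rewrite /kron eqxx. Qed.

(** The leading monomial of every [g al] is its only initial one for [v]. *)
Definition strictly_selects v : Prop :=
  forall al be, D al -> be \in msupp (g al) -> be != al -> wdot v al < wdot v be.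

Lemma strict_selects v : strictly_selects v -> selects v.
Proof.
move=> sv al be Dal beg; have [->//|ne] := eqVneq be al.
exact: ltW (sv al be Dal beg ne).
Qed.

(** Both initial ideals are spanned by the monomials of [D]. *)
Lemma strict_in_ideal v w : strictly_selects v -> strictly_selects w ->
  in_ideal v J = in_ideal w J.
Proof.
have E u F : strictly_selects u -> in_ideal u J F <-> spanned_part D (fun al => 'X_[al]) F = F.
  move=> su; rewrite (in_ideal_span (strict_selects su)).
  suff -> : spanned_part D (deform g idfun (wdot u) kron) F =
    spanned_part D (fun al => 'X_[al]) F by [].
  apply: eq_bigr => al Dal; congr (_ *: _); apply/mpolyP => be.
  rewrite twist_coef mcoeffX /kron /=; have [<-|ne] := eqVneq al be.
    by rewrite eqxx mulr1 g_red // eqxx.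
  have [beg|/memN_msupp_eq0 ->] := boolP (be \in msupp (g al)); last by rewrite mul0r.
  by rewrite lt_eqF ?mulr0 // su // eq_sym.
move=> sv sw; apply: ideal_ext; apply/seteqP; split=> F.
  by move/(E _ _ sv)/(E _ _ sw).
by move/(E _ _ sw)/(E _ _ sv).
Qed.

(** All monomials of the initial form of [g al] lie in [D], and [al] is the only
    monomial of [g al] in [D]. *)
Lemma strictly_selects_initial (w : 'rV[R]_n) :
  (forall F be, in_ideal w J F -> be \in msupp F -> D be) -> strictly_selects w.
Proof.
move=> wD al be Dal beg ne.
have gal0 : g al != 0.
  by apply/eqP => E; have := mem_msupp_g Dal; rewrite E msupp0.
have init ga : ga \in msupp (g al) -> (forall de, de \in msupp (g al) -> wdot w ga <= wdot w de) ->
    ga = al.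
  move=> gag gaM; have Dga : D ga.
    apply: (wD (in_w w (g al))); first by apply: idgen_mem; exists (g al) => //; exact: Jg.
    by rewrite mcoeff_msupp in_w_coef (introT allP gaM) -mcoeff_msupp.
  have := g_red Dal Dga; case: (eqVneq al ga) => // _ /eqP.
  by rewrite mcoeff_eq0 gag.
have [ga gag gaM] := min_monomial w gal0; have Ega := init ga gag gaM.
rewrite Ega in gaM; rewrite lt_neqAle gaM // andbT; apply: contraNneq ne => E.
by apply/eqP/init => // de /gaM; rewrite E.
Qed.

(** [u] is in the lineality space when the [g al] are [u]-homogeneous: an initial
    form of [g al] that belongs to [J] is [g al] itself or zero, since it involves at
    most the monomial [al] of [D]. *)
Lemma linealityP (u : 'rV[R]_n) : in_ideal u J = J <->
  forall al be, D al -> be \in msupp (g al) -> wdot u al = wdot u be.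
Proof.
split=> [uJ al be Dal beg|uE].
  have gal0 : g al != 0.
    by apply/eqP => E; have := mem_msupp_g Dal; rewrite E msupp0.
  have Ju : J (in_w u (g al)).
    by rewrite -uJ; apply: idgen_mem; exists (g al) => //; exact: Jg.
  have J0 f : J f -> (forall ga, D ga -> f@_ga = 0) -> f = 0.
    by move=> /JE fE f0; rewrite -fE spanned_part0.
  have coefD0 ga : D ga -> ga != al -> (in_w u (g al))@_ga = 0.
    by move=> Dga ne; rewrite in_w_coef g_red // eq_sym (negPf ne) if_same.
  have [ga gag gaM] := min_monomial u gal0.
  have [al_min|al_nmin] := boolP (all (fun ga => wdot u al <= wdot u ga) (msupp (g al))).
    have E : in_w u (g al) = g al.
      apply/eqP; rewrite -subr_eq0; apply/eqP; apply: J0 => [|de Dde].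
        by apply: idealB => //; exact: Jg.
      rewrite mcoeffB in_w_coef; have [->|ne] := eqVneq de al; first by rewrite al_min subrr.
      by rewrite g_red // eq_sym (negPf ne) if_same subrr.
    have := beg; rewrite -{1}E mcoeff_msupp in_w_coef.
    case: ifP => [be_min _|_]; last by rewrite eqxx.
    apply/le_anti; rewrite (allP al_min) // (allP be_min) //.
    exact: mem_msupp_g.
  have E : in_w u (g al) = 0.
    apply: J0 => // de Dde; have [->|ne] := eqVneq de al; last exact: coefD0.
    by rewrite in_w_coef (negPf al_nmin).
  have := congr1 (mcoeff ga) E; rewrite in_w_coef (introT allP gaM) mcoeff0 => /eqP.
  by rewrite mcoeff_eq0 gag.
have su : selects u by move=> al be Dal beg; rewrite (uE al be).
apply: ideal_ext; apply/seteqP; suff H F : in_ideal u J F <-> J F by split=> F /H.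
rewrite (in_ideal_span su) JE.
suff -> : spanned_part D (deform g idfun (wdot u) kron) F = spanned_part D g F by [].
apply: eq_bigr => al Dal; congr (_ *: _); apply/mpolyP => be.
rewrite twist_coef /kron /=; have [beg|/memN_msupp_eq0 ->] := boolP (be \in msupp (g al)).
  by rewrite (uE al be) // eqxx mulr1.
by rewrite mul0r.
Qed.

End InitialForms.

(** * The ideal of the family *)

Section FamilyIdeal.
Variables (K : fieldType) (n m : nat) (r : 'M[int]_(m, n)) (D : pred 'X_{1..n}).
Variables (J : ideal {mpoly K[n]}) (g : 'X_{1..n} -> {mpoly K[n]}).
Hypotheses (Jg : forall al, D al -> J (g al)) (g_red : reduced D g).
Hypothesis JE : forall f, J f <-> spanned_part D g f = f.

Definition rweight (al : 'X_{1..n}) : 'rV[int]_m := \row_j rdot r j al.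

Definition rle (s s' : 'rV[int]_m) : Prop := forall j, s 0 j <= s' 0 j.

Definition tmon (s s' : 'rV[int]_m) : {mpoly K[m]} :=
  'X_[[multinom absz (s' 0 j - s 0 j)%R | j < m]].

Hypothesis r_selects : forall al be, D al -> be \in msupp (g al) ->
  rle (rweight al) (rweight be).

Lemma rdotD j al be : rdot r j (al + be)%MM = rdot r j al + rdot r j be.
Proof.
by rewrite /rdot -big_split; apply: eq_bigr => i _; rewrite /= mnmDE PoszD mulrDr.
Qed.

Lemma min_int_le (s : seq int) x : x \in s -> min_int s <= x.
Proof.
rewrite /min_int; move: (head 0 s) => y; elim: s => // z s IH.
by rewrite inE big_cons ge_min => /orP[/eqP ->|/IH ->]; rewrite ?lexx ?orbT.
Qed.

Lemma min_int_ge (s : seq int) x : (forall y, y \in s -> x <= y) -> s != [::] -> x <= min_int s.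
Proof.
move=> xM; rewrite /min_int; case: s xM => // y s xM _ /=.
have : x <= y by apply: xM; rewrite mem_head.
elim: (y :: s) xM => [|z t IH] xM xy; first by rewrite big_nil.
rewrite big_cons le_min xM ?mem_head //=; apply: IH => // w wt.
by apply: xM; rewrite inE wt orbT.
Qed.

Lemma mu_le (f : {mpoly K[n]}) j al : al \in msupp f -> mu r f j <= rdot r j al.
Proof. by move=> alf; apply: min_int_le; exact: map_f. Qed.

Lemma tilde_twist (f : {mpoly K[n]}) :
  tilde r f = twist (@mpolyC m K) rweight tmon (\row_j mu r f j) f.
Proof.
apply: eq_bigr => al _; rewrite mul_mpolyC; congr ((_ *: 'X_[_]) *: _).
by apply/mnmP => j; rewrite !mnmE !mxE.
Qed.

Lemma tilde_deform al : D al -> tilde r (g al) = deform g (@mpolyC m K) rweight tmon al.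
Proof.
move=> Dal; rewrite tilde_twist /deform; congr twist; apply/rowP => j; rewrite !mxE.
have alg := mem_msupp_g g_red Dal.
apply/le_anti; rewrite mu_le //=; apply: min_int_ge.
  by move=> _ /mapP[be beg ->]; have := r_selects Dal beg j; rewrite !mxE.
by rewrite -size_eq0 size_map size_eq0; apply/eqP => E; rewrite E in alg.
Qed.

Lemma tmon_refl s : tmon s s = 1.
Proof.
rewrite /tmon -mpolyX0; congr 'X_[_]; apply/mnmP => j.
by rewrite mnmE mnm0E subrr.
Qed.

Lemma Jtilde_span F : Jtilde r J F <->
  spanned_part D (deform g (@mpolyC m K) rweight tmon) F = F.
Proof.
apply: (@deform_ideal K n D J g Jg JE _ (@mpolyC m K) _ rle rweight tmon).
- by move=> al be; apply/rowP => j; rewrite !mxE rdotD.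
- move=> s s' s'' le1 le2; rewrite /tmon -mpolyXD; congr 'X_[_]; apply/mnmP => j.
  by rewrite mnmDE !mnmE; have := le1 j; have := le2 j; lia.
- move=> s s' u; congr 'X_[_]; apply/mnmP => j; rewrite !mnmE !mxE.
  by congr absz; ring.
- by move=> s s' u le1 j; rewrite !mxE lerD2r.
- exact: r_selects.
- move=> al Dal; exists (g al); last exact: tilde_deform.
  split; first exact: Jg.
  by apply/eqP => E; have := mem_msupp_g g_red Dal; rewrite E msupp0.
move=> _ [f [Jf _] <-]; exists f, (\row_j mu r f j); split=> //; last exact: tilde_twist.
by move=> al alf j; rewrite !mxE; exact: mu_le.
Qed.

Lemma tilde_reduced : reduced D (deform g (@mpolyC m K) rweight tmon).
Proof. by apply: deform_reduced => //; exact: tmon_refl. Qed.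

End FamilyIdeal.

(** * Cones and their rays *)

Section Cones.
Variables (R : realType) (n : nat).
Implicit Types (u v w x y : 'rV[R]_n) (C L tau : set 'rV[R]_n).

Lemma dotDr l u v : dot l (u + v) = dot l u + dot l v.
Proof. by rewrite -big_split; apply: eq_bigr => i _; rewrite /= !mxE mulrDr. Qed.

Lemma dotZr l c u : dot l (c *: u) = c * dot l u.
Proof. by rewrite /dot mulr_sumr; apply: eq_bigr => i _; rewrite !mxE mulrCA. Qed.

Lemma dotNr l u : dot l (- u) = - dot l u.
Proof. by rewrite -scaleN1r dotZr mulN1r. Qed.

Lemma dotBr l u v : dot l (u - v) = dot l u - dot l v.
Proof. by rewrite dotDr dotNr. Qed.

Lemma dot0r l : dot l (0 : 'rV[R]_n) = 0.
Proof. by rewrite -(scale0r 0) dotZr mul0r. Qed.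

Lemma dot_suml (I : finType) (P : pred I) (l : I -> 'rV[R]_n) v :
  dot (\sum_(i | P i) l i) v = \sum_(i | P i) dot (l i) v.
Proof.
rewrite /dot exchange_big; apply: eq_bigr => j _ /=.
by rewrite summxE mulr_suml.
Qed.

Lemma dot_sumr (I : Type) (s : seq I) (P : pred I) l (v : I -> 'rV[R]_n) :
  dot l (\sum_(i <- s | P i) v i) = \sum_(i <- s | P i) dot l (v i).
Proof. by apply: (big_morph (dot l)); [exact: dotDr|exact: dot0r]. Qed.

Definition convex_cone C : Prop :=
  [/\ C 0, (forall u v, C u -> C v -> C (u + v)) & forall c u, 0 <= c -> C u -> C (c *: u)].

Lemma relint_add C v w s : convex_cone C -> C v -> relint C w -> 0 < s ->
  relint C (v + s *: w).
Proof.
move=> [C0 CD CZ] Cv [Cw wC] s0; split; first by apply: CD => //; apply: CZ => //; exact: ltW.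
move=> u Cu; have [e e0 Ce] := wC u Cu.
have e1 : 0 < 1 + e by rewrite addr_gt0.
(* chosen so that [- t *: u] is the part in [u] of [s / (1 + e) *: (w + e *: (w - u))] *)
pose t := s * e / (1 + e); have t0 : 0 < t by rewrite divr_gt0 // mulr_gt0.
exists t => //.
have -> : v + s *: w + t *: (v + s *: w - u) =
    (1 + t) *: v + (t * s) *: w + (s / (1 + e)) *: (w + e *: (w - u)).
  apply/rowP => i; rewrite !mxE /t; move: (v _ _) (w _ _) (u _ _) => a b c.
  have E : (1 + e)^-1 * (1 + e) = 1 by rewrite mulVf // gt_eqF.
  have -> : s / (1 + e) * (b + e * (b - c)) =
      s * b * ((1 + e)^-1 * (1 + e)) - s * e / (1 + e) * c by ring.
  by rewrite E; ring.
apply: (CD); last by apply: CZ => //; rewrite divr_ge0 // ltW.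
by apply: CD; apply: (CZ) => //; [rewrite addr_ge0 // ltW|rewrite mulr_ge0 // ltW].
Qed.

Lemma half_space_closed (a b : R) : (forall s, 0 < s -> 0 <= a + s * b) -> 0 <= a.
Proof.
move=> H; rewrite leNgt; apply/negP => a0.
have [b0|b0] := lerP b 0.
  have := H 1 ltr01; rewrite mul1r leNgt => /negP; apply.
  by rewrite -[0]addr0 ltr_leD.
have s0 : 0 < - a / (b *+ 2) by rewrite divr_gt0 ?oppr_gt0 // pmulrn_lgt0.
have := H _ s0; rewrite -mulr_natr invfM mulrA mulrAC divfK ?gt_eqF //.
have -> : a + - a / 2%:R = a / 2%:R.
  by rewrite {1}[a]splitr mulNr addrK.
by rewrite pmulr_lge0 ?invr_gt0 ?ltr0n // leNgt a0.
Qed.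

Section Rays.
Variables (k : nat) (l : 'I_k -> 'rV[R]_n).
Let C : set 'rV[R]_n := [set v | forall i, 0 <= dot (l i) v].
Variables (L : set 'rV[R]_n).
Hypothesis LE : forall v, L v <-> C v /\ C (- v).

Lemma polyhedral_cone : convex_cone C.
Proof.
split=> [i|u v Cu Cv i|c u c0 Cu i]; first by rewrite dot0r.
  by rewrite dotDr addr_ge0.
by rewrite dotZr mulr_ge0.
Qed.

Lemma linealityE v : L v <-> forall i, dot (l i) v = 0.
Proof.
split=> [/LE[Cv CNv] i|v0].
  by apply/le_anti; rewrite Cv andbT -oppr_ge0 -dotNr; exact: CNv.
by apply/LE; split=> i; rewrite ?dotNr v0 ?oppr0.
Qed.

Let pos v : {set 'I_k} := [set i | 0 < dot (l i) v]%SET.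

Let posN v i : C v -> i \notin pos v -> dot (l i) v = 0.
Proof. by move=> Cv; rewrite inE -leNgt => le0; apply/le_anti; rewrite le0 Cv. Qed.

(** Move from [x] in the direction [- y] until the boundary is reached. *)
Let peel x y : C x -> C y -> ~ L y ->
  exists s, [/\ 0 <= s, C (x - s *: y), pos (x - s *: y) \subset pos x &
    exists2 i, i \in pos y & i \notin pos (x - s *: y)].
Proof.
move=> Cx Cy nLy.
have [i0 i0y] : exists i, i \in pos y.
  apply: contrapT => H; apply: nLy; apply/linealityE => i; apply: posN => //.
  by apply/negP => iy; apply: H; exists i.
pose F i := dot (l i) x / dot (l i) y.
have [i iy iM] : exists2 i, i \in pos y & forall j, j \in pos y -> F i <= F j.
  by case: (@arg_minP _ _ _ i0 (fun j => j \in pos y) F i0y) => i iy iM; exists i.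
have yi : 0 < dot (l i) y by rewrite inE in iy.
have Fi0 : 0 <= F i by apply: divr_ge0; [exact: Cx|exact: ltW].
have dE j : dot (l j) (x - F i *: y) = dot (l j) x - F i * dot (l j) y.
  by rewrite dotBr dotZr.
exists (F i); split=> // [j||].
- rewrite dE; have [jy|/posN ->//] := boolP (j \in pos y); last by rewrite mulr0 subr0.
  by rewrite subr_ge0 -ler_pdivlMr ?iM //; rewrite inE in jy.
- apply/fintype.subsetP => j; rewrite !inE dE => /lt_le_trans; apply.
  by rewrite gerBl mulr_ge0.
- by exists i => //; rewrite inE dE /F divfK ?subrr ?ltxx // gt_eqF.
Qed.

(** A polyhedral cone is spanned by its rays modulo its lineality space.  If the
    smallest face through [u] is not a ray, it contains a vector independent of
    [u]; peeling writes [u] as a combination of two vectors on smaller faces. *)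
Lemma cone_ray_decomposition m (r : 'I_m -> 'rV[R]_n) :
  (forall j, ~ L (r j)) -> (forall rho, ray L C rho -> exists j, rho (r j)) ->
  forall u, C u -> exists lam : 'I_m -> R, (forall j, 0 <= lam j) /\
    L (u - \sum_j lam j *: r j).
Proof.
move=> rL rR u; have [N] := ubnP #|pos u|; elim: N u => // N IH u; rewrite ltnS => leN Cu.
have [C0 CD CZ] := polyhedral_cone.
have L0 : L 0 by apply/linealityE => i; rewrite dot0r.
have [Lu|nLu] := pselect (L u).
  exists (fun=> 0); split=> //; rewrite big1 ?subr0 // => j _.
  by rewrite scale0r.
pose F : set 'rV[R]_n := [set v | C v /\ pos v \subset pos u].
have [[v [Fv nv]]|Hray] := pselect (exists v, F v /\ forall c, 0 <= c -> ~ L (v - c *: u)).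
  have [Cv vu] := Fv.
  have [s [s0 Cv' v'v [i iu iv']]] := peel Cv Cu nLu.
  set v' := v - s *: u in Cv' v'v iv'.
  have nLv' : ~ L v' by exact: nv.
  have v'u := fintype.subset_trans v'v vu.
  have [t [t0 Cu' u'u [j jv' ju']]] := peel Cu Cv' nLv'.
  set u' := u - t *: v' in Cu' u'u ju'.
  have lt_v' : (#|pos v'| < #|pos u|)%N.
    by apply: proper_card; apply/properP; split=> //; exists i.
  have lt_u' : (#|pos u'| < #|pos u|)%N.
    apply: proper_card; apply/properP; split=> //; exists j => //.
    exact: (fintype.subsetP v'u).
  have [lam1 [lam1_ge0 L1]] := IH _ (leq_trans lt_v' leN) Cv'.
  have [lam2 [lam2_ge0 L2]] := IH _ (leq_trans lt_u' leN) Cu'.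
  have uE : u = u' + t *: v' by rewrite subrK.
  clearbody u' v'; exists (fun j => lam2 j + t * lam1 j); split=> [a|].
    by rewrite addr_ge0 // mulr_ge0.
  apply/linealityE => a; move/linealityE: L1 => /(_ a); move/linealityE: L2 => /(_ a).
  have -> : \sum_j (lam2 j + t * lam1 j) *: r j =
      \sum_j lam2 j *: r j + t *: \sum_j lam1 j *: r j.
    rewrite scaler_sumr -big_split; apply: eq_bigr => b _ /=.
    by rewrite scalerDl scalerA.
  rewrite uE !dotBr !dotDr !dotZr => E2 E1.
  transitivity (dot (l a) u' - dot (l a) (\sum_j lam2 j *: r j) +
    t * (dot (l a) v' - dot (l a) (\sum_j lam1 j *: r j))); first by ring.
  by rewrite E1 E2; ring.
(* the smallest face through [u] is a ray *)
pose f := \sum_(i | i \notin pos u) l i.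
have fC v : C v -> 0 <= dot f v by move=> Cv; rewrite dot_suml sumr_ge0.
have fF v : C v -> dot f v = 0 <-> pos v \subset pos u.
  move=> Cv; rewrite dot_suml; split=> [f0|vu].
    apply/fintype.subsetP => i iv; apply: contraLR (iv) => iu.
    by rewrite inE (psumr_eq0P _ f0) // ltxx.
  by apply: big1 => i iu; apply: posN => //; apply: contraNN iu => /(fintype.subsetP vu).
have [|j [c c0 Lj]] := rR [set v | exists2 c, 0 <= c & L (v - c *: u)].
  split; last by exists u.
  exists f => //; apply/seteqP; split=> v /= [].
    move=> c c0 Lv; have Cv : C v.
      rewrite -[v](subrK (c *: u)); apply: (CD); last exact: CZ.
      by have /LE[] := Lv.
    split=> //; apply/fF => //; apply/fintype.subsetP => i; rewrite !inE.
    move/linealityE: Lv => /(_ i)/eqP; rewrite dotBr dotZr subr_eq0 => /eqP ->.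
    by move: c0; rewrite le_eqVlt => /orP[/eqP <-|c0]; rewrite ?mul0r ?ltxx // pmulr_rgt0.
  move=> Cv /(fF v Cv) vu; apply: contrapT => H; apply: Hray; exists v; split=> //.
  by move=> c c0 Lv; apply: H; exists c.
have c_neq0 : c != 0.
  by apply/eqP => E; apply: (rL j); rewrite E scale0r subr0 in Lj.
exists (fun i => if i == j then c^-1 else 0); split=> [i|].
  by case: ifP => // _; rewrite invr_ge0.
rewrite (bigD1 j) //= eqxx big1 ?addr0 => [|i /negPf ->]; last by rewrite scale0r.
apply/linealityE => i; move/linealityE: Lj => /(_ i)/eqP.
rewrite !dotBr !dotZr subr_eq0 => /eqP ->.
by rewrite mulKf // subrr.
Qed.

End Rays.

(** A point in the relative interior of a face is a combination of the rays of the
    face with positive coefficients: move it slightly away from the sum of these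
    rays, and decompose the result. *)
Lemma relint_face_decomposition k (l : 'I_k -> 'rV[R]_n) (C L tau : set 'rV[R]_n) m
    (r : 'I_m -> 'rV[R]_n) w :
  C = [set v | forall i, 0 <= dot (l i) v] -> (forall v, L v <-> C v /\ C (- v)) ->
  (forall j, ~ L (r j)) -> (forall j, C (r j)) ->
  (forall rho, ray L C rho -> exists j, rho (r j)) ->
  face C tau -> relint tau w ->
  exists lam : 'I_m -> R, (forall j, 0 <= lam j) /\ (forall j, 0 < lam j <-> tau (r j)) /\
    L (w - \sum_j lam j *: r j).
Proof.
move=> CE LE rL rC rR [f fC tauE] [tw wtau]; subst C.
set C := [set v | _] in LE rC rR fC tauE *.
have cone := polyhedral_cone l; have [C0 CD CZ] := cone.
have tau_r j : tau (r j) <-> dot f (r j) = 0 by rewrite tauE; split=> [[]|].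
pose b j : R := `[< tau (r j) >]%:R.
pose s := \sum_j b j *: r j.
have Cs : C s.
  by rewrite /s; apply: big_ind => // j _; apply: CZ; [rewrite /b ler0n|exact: rC].
have tau_s : tau s.
  rewrite tauE; split=> //; rewrite dot_sumr big1 // => j _; rewrite dotZr /b.
  by case: asboolP => [/tau_r ->|]; rewrite ?mulr0 ?mul0r.
have [e e0 te] := wtau s tau_s.
have [Cx fx] : C (w + e *: (w - s)) /\ dot f (w + e *: (w - s)) = 0 by move: te; rewrite tauE.
have [lam [lam_ge0 Llam]] := cone_ray_decomposition LE rL rR Cx.
have fL v : L v -> dot f v = 0.
  by move=> /LE[Cv CNv]; apply/le_anti; rewrite fC // andbT -oppr_ge0 -dotNr fC.
have e1 : 0 < 1 + e by rewrite addr_gt0.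
have lam_tau j : 0 < lam j -> tau (r j).
  move=> lamj; apply/tau_r.
  have : \sum_j lam j * dot f (r j) = 0.
    have := fL _ Llam; rewrite dotBr fx sub0r => /eqP; rewrite oppr_eq0 => /eqP E0.
    by rewrite -[RHS]E0 dot_sumr; apply: eq_bigr => i _; rewrite dotZr.
  move=> /(psumr_eq0P _)/(_ _)/= H; have /eqP : lam j * dot f (r j) = 0.
    by apply: H => // i _; rewrite mulr_ge0 // fC.
  by rewrite mulf_eq0 gt_eqF //= => /eqP.
exists (fun j => (lam j + e * b j) / (1 + e)); split=> [j|]; last split=> [j|].
- by rewrite divr_ge0 ?addr_ge0 ?mulr_ge0 ?ler0n // ltW.
- rewrite pmulr_lgt0 ?invr_gt0 //; split=> [|tj].
    rewrite /b; case: asboolP => // _; rewrite mulr0 addr0; exact: lam_tau.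
  by rewrite /b asboolT // mulr1 ltr_wpDl.
apply/(linealityE LE) => i; move/(linealityE LE): Llam => /(_ i).
have -> : \sum_j ((lam j + e * b j) / (1 + e)) *: r j =
    (1 + e)^-1 *: (\sum_j lam j *: r j + e *: s).
  rewrite scaler_sumr -big_split scaler_sumr; apply: eq_bigr => j _ /=.
  by rewrite scalerA -scalerDl scalerA mulrC.
rewrite !(dotNr, dotDr, dotZr) => E; have E1 : (1 + e)^-1 * (1 + e) = 1 by rewrite mulVf // gt_eqF.
rewrite -[X in X + _]mul1r -{1}E1.
transitivity ((1 + e)^-1 * (dot (l i) w + e * (dot (l i) w - dot (l i) s) -
  dot (l i) (\sum_j lam j *: r j))); first by ring.
by rewrite E mulr0.
Qed.

End Cones.

(** * Fibres of the family *)

(** The positive degree part of [T] is generated by that of [S]. *)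
Lemma base_change_relevant (S T B B' : comPzRingType) (grS : grading S) (grT : grading T)
    (g : {rmorphism S -> T}) (psi : {rmorphism B -> S}) (phi : {rmorphism B' -> T})
    (chi : {rmorphism B -> B'}) :
  graded_base_change grS grT g psi phi chi ->
  forall P : hpoint grT (irrelevant grT), ~ (irrelevant grS `<=` g @^-1` P).
Proof.
move=> [_ _ _ gen _] P H; apply: (hprime_rel (h := P)) => F [e e0 eF].
have [k [b [s [es ->]]]] := gen e F eF; have [[P0 PD PM] _ _] := hprime_prime P.
by apply: big_ind => // i _; apply: PM; apply: H; exists e.
Qed.

Lemma wProj_struct_induced n (B : comNzRingType) (d : 'I_n -> nat) :
  induced (wProj_struct B d) (@mpolyC n B).
Proof. exact: hmap_induced. Qed.

Lemma subProj_emb_induced n (B : comNzRingType) (d : 'I_n -> nat) (I : ideal {mpoly B[n]}) :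
  induced (subProj_emb d I) (qproj I).
Proof. exact: hmap_induced. Qed.

Lemma subProj_struct_induced n (B : comNzRingType) (d : 'I_n -> nat) (I : ideal {mpoly B[n]}) :
  induced (wProj_struct B d \O subProj_emb d I) (qproj I \o @mpolyC n B).
Proof.
apply: induced_comp; [|exact: wProj_struct_induced|exact: subProj_emb_induced].
by move=> e c; exact: mpolyC_deg.
Qed.

Lemma PxA_pullback (K : fieldType) n m (d : 'I_n -> nat) :
  is_pullback (wProj_struct K d) (affine_struct K m) (PxA_pr1 K m d) (PxA_pr2 K m d).
Proof.
apply: (base_change_pullback _ (@polynomial_base_change n K {mpoly K[m]} (@mpolyC m K) d)).
- exact: wgrading_direct.
- exact: wProj_struct_induced.
- exact: hmap_induced.
- exact: hmap_induced.
- exact: wProj_struct_induced.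
Qed.

Section Fibres.
Variables (K : fieldType) (n m : nat) (d : 'I_n -> nat) (r : 'M[int]_(m, n)).
Variables (D : pred 'X_{1..n}) (J : ideal {mpoly K[n]}) (g : 'X_{1..n} -> {mpoly K[n]}).
Hypotheses (Jg : forall al, D al -> J (g al)) (g_red : reduced D g).
Hypothesis g_deg : forall al, D al -> wgrading K d (wdeg d al) (g al).
Hypothesis JE : forall f, J f <-> spanned_part D g f = f.
Hypothesis r_selects : forall al be, D al -> be \in msupp (g al) ->
  rle (rweight r al) (rweight r be).

Let h := deform g (@mpolyC m K) (rweight r) (@tmon K m).
Let h_red : reduced D h. Proof. exact: tilde_reduced. Qed.
Let h_deg al : D al -> wgrading {mpoly K[m]} d (wdeg d al) (h al).
Proof. exact: deform_deg. Qed.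
Let hE F : Jtilde r J F <-> spanned_part D h F = F. Proof. exact: Jtilde_span. Qed.

Lemma family_basis : module_basis (fun c => qproj (Jtilde r J) c%:MP_[n])
  [set al | ~~ D al] (fun al => qproj (Jtilde r J) 'X_[al]).
Proof. exact: (quot_module_basis h_red hE). Qed.

Lemma family_flat : flat_mor (pi_family d r J).
Proof.
apply: (Proj_flat (quot_coordinates h_red hE h_deg)).
  by move=> c; apply: quot_deg; exact: mpolyC_deg.
exact: subProj_struct_induced.
Qed.

(** A point [a] and a torus element [theta] such that evaluation at [a], followed by
    the action of [theta], carries the family that spans [Jtilde] to one that spans [I]
    up to scalars. *)
Section OneFibre.
Variables (a : 'I_m -> K) (theta : 'I_n -> K) (h' : 'X_{1..n} -> {mpoly K[n]}).
Variable I : ideal {mpoly K[n]}.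
Hypotheses (theta_neq0 : forall i, theta i != 0) (h'_red : reduced D h').
Hypothesis h'_deg : forall al, D al -> wgrading K d (wdeg d al) (h' al).
Hypothesis IE : forall F, I F <-> spanned_part D h' F = F.
Hypothesis h_special : forall al be, D al -> be \in msupp (g al) ->
  (g al)@_be * (\prod_j a j ^+ absz (rdot r j be - rdot r j al)%R) * torus_weight theta be
  = torus_weight theta al * (h' al)@_be.
Hypothesis h'_supp : forall al, D al -> {subset msupp (h' al) <= msupp (g al)}.

Let eps : {rmorphism {mpoly K[m]} -> K} := meval a.

Let special_h al : D al -> specialize eps theta (h al) = torus_weight theta al *: h' al.
Proof.
move=> Dal; apply/mpolyP => be; rewrite specialize_coef mcoeffZ twist_coef.
have [beg|beg] := boolP (be \in msupp (g al)).
  rewrite -(h_special Dal beg) rmorphM /= mevalC /tmon mevalX; congr (_ * _ * _).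
  by apply: eq_bigr => j _; rewrite mnmE !mxE.
rewrite (memN_msupp_eq0 beg) rmorph0 mul0r rmorph0 mul0r.
rewrite (memN_msupp_eq0 (p := h' al)) ?mulr0 //.
by apply: contraNN beg; exact: h'_supp.
Qed.

Let eps_surj c : exists b, eps b = c.
Proof. by exists c%:MP; rewrite /eps /= mevalC. Qed.

Let gbc := quotient_base_change h_red h_deg hE IE theta_neq0 special_h eps_surj.

Let q_deg e x : quot_grading (wgrading {mpoly K[m]} d) (Jtilde r J) e x ->
  quot_grading (wgrading K d) I e (quot_specialize hE IE special_h x).
Proof. by case: gbc => H _ _ _ _; exact: H. Qed.

Definition fibre_map : lrs_mor (subProj d I) (subProj d (Jtilde r J)) :=
  hmap q_deg (base_change_relevant gbc).

Lemma fibre_map_pullback : fibre_proj a fibre_map.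
Proof.
apply: (base_change_pullback _ gbc).
- exact: quot_direct (span_homogeneous h'_deg IE).
- exact: subProj_struct_induced.
- exact: hmap_induced.
- exact: hmap_induced.
- exact: subProj_struct_induced.
Qed.

Lemma fibre_map_emb : (forall i, theta i = 1) ->
  PxA_pr1 K m d \O total_emb d r J \O fibre_map = subProj_emb d I.
Proof.
move=> theta1.
have i1 : induced (PxA_pr1 K m d) (map_mpoly (@mpolyC m K) : {mpoly K[n]} -> _).
  exact: hmap_induced.
have i2 := @subProj_emb_induced n _ d (Jtilde r J).
have i3 : induced fibre_map (quot_specialize hE IE special_h) by exact: hmap_induced.
have d1 : graded_map (wgrading K d) (wgrading {mpoly K[m]} d) (map_mpoly (@mpolyC m K)).
  by move=> e F; exact: map_mpoly_deg.
have d2 : graded_map (wgrading {mpoly K[m]} d)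
    (quot_grading (wgrading {mpoly K[m]} d) (Jtilde r J)) (qproj (Jtilde r J)).
  by move=> e F; exact: quot_deg.
have i12 := induced_comp d1 i1 i2.
have d12 : graded_map (wgrading K d)
    (quot_grading (wgrading {mpoly K[m]} d) (Jtilde r J))
      (qproj (Jtilde r J) \o map_mpoly (@mpolyC m K)).
  by move=> e F eF; apply: (d2); exact: (d1).
apply: (induced_eq _ _ (induced_comp d12 i12 i3) (@subProj_emb_induced n K d I)).
  by move=> e F eF; apply: q_deg; exact: (d12).
move=> F; rewrite /= quot_specializeE; congr (qproj I _).
apply/mpolyP => al; rewrite specialize_coef mcoeff_map_mpoly /= mevalC.
by rewrite /torus_weight big1 ?mulr1 // => i _; rewrite theta1 expr1n.
Qed.

End OneFibre.

(** The fibre over a point outside the coordinate hyperplanes is carried to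
    [Proj A] by the torus element that this point defines through [r]. *)
Lemma generic_fibre (a : 'I_m -> K) : (forall j, a j != 0) -> fibre_iso d r J a J.
Proof.
move=> a0; pose theta i := \prod_j a j ^ (- r j i).
have theta0 i : theta i != 0 by apply/prodf_neq0 => j _; rewrite expfz_neq0.
have tw al : torus_weight theta al = \prod_j a j ^ (- rdot r j al).
  rewrite /torus_weight; under eq_bigr do rewrite /theta -prodrXl.
  rewrite exchange_big; apply: eq_bigr => j _ /=.
  rewrite /rdot -sumrN; elim/big_ind2: _ => [|x y z t -> ->|i _]; first by rewrite expr0z.
    by rewrite expfzDr.
  by rewrite exprnP exprz_exp mulNr.
have sp al be : D al -> be \in msupp (g al) ->
  (g al)@_be * (\prod_j a j ^+ absz (rdot r j be - rdot r j al)%R) * torus_weight theta be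
  = torus_weight theta al * (g al)@_be.
  move=> Dal beg; rewrite -mulrA [RHS]mulrC; congr (_ * _).
  rewrite !tw -big_split; apply: eq_bigr => j _ /=.
  have le_ab : 0 <= rdot r j be - rdot r j al.
    by have := r_selects Dal beg j; rewrite !mxE subr_ge0.
  by rewrite exprnP gez0_abs // -expfzDr //; congr (_ ^ _); ring.
exists (fibre_map theta0 JE sp (fun _ _ _ => id)).
by apply: fibre_map_pullback => //.
Qed.

End Fibres.

(** * The cone of an initial ideal *)

Section GroebnerCone.
Variables (K : fieldType) (R : realType) (n m : nat) (d : 'I_n -> nat) (le : term_order n).
Variables (J : ideal {mpoly K[n]}) (C : set 'rV[R]_n) (g : 'X_{1..n} -> {mpoly K[n]}).
Let D := nonstandard le J.
Hypotheses (Jg : forall al, D al -> J (g al)) (g_red : reduced D g).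
Hypothesis g_deg : forall al, D al -> wgrading K d (wdeg d al) (g al).
Hypothesis JE : forall f, J f <-> spanned_part D g f = f.
Hypothesis le_compat : forall w, relint C w -> in_to_ideal le J = in_ideal w J.
Variables (k : nat) (l : 'I_k -> 'rV[int]_n).
Hypothesis CE : C = [set v | forall i, 0 <= dot (int_vec R (l i)) v].
Variable w0 : 'rV[R]_n.
Hypothesis relintE : relint C = [set u | in_ideal u J = in_ideal w0 J].
Implicit Types (u v w : 'rV[R]_n).

Let cone : convex_cone C.
Proof. by rewrite CE; exact: (polyhedral_cone (fun i => int_vec R (l i))). Qed.

Let relint_w0 : relint C w0. Proof. by rewrite relintE. Qed.

Lemma relint_strict w : relint C w -> strictly_selects D g w.
Proof.
move=> /le_compat E; apply: (strictly_selects_initial Jg g_red) => F be.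
by rewrite -E => /in_to_ideal_leading H /H /nonstandardP.
Qed.

(** [C] is the closed cone of the weights that select the leading terms of the
    reduced normal forms; one inclusion holds by closedness of the inequalities,
    the other because [C] is closed and contains the interior of that cone. *)
Lemma coneP v : C v <-> selects D g v.
Proof.
split=> [Cv al be Dal beg|sv].
  rewrite -subr_ge0; apply: (@half_space_closed _ _ (wdot w0 be - wdot w0 al)) => s s0.
  have := strict_selects (relint_strict (relint_add cone Cv relint_w0 s0)) Dal beg.
  by rewrite !wdot_linear -subr_ge0 => H; apply: le_trans H _; rewrite le_eqVlt; apply/orP;
    left; apply/eqP; ring.
rewrite CE => i; apply: (@half_space_closed _ _ (dot (int_vec R (l i)) w0)) => s s0.
suff : C (v + s *: w0) by rewrite CE => /(_ i); rewrite dotDr dotZr.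
suff : relint C (v + s *: w0) by case.
rewrite relintE /=; apply: (strict_in_ideal Jg g_red JE); last exact: relint_strict.
move=> al be Dal beg ne; rewrite !wdot_linear; apply: ler_ltD; first exact: sv.
by rewrite ltr_pM2l //; exact: (relint_strict relint_w0 Dal beg ne).
Qed.

Lemma lineality_coneP u : lineality J u <-> C u /\ C (- u).
Proof.
rewrite /lineality /= (linealityP Jg g_red JE) !coneP; split=> [uE|[su sNu] al be Dal beg].
  by split=> al be Dal beg; rewrite ?wdotN (uE al be).
apply/le_anti; rewrite su //= -lerN2 -!wdotN; exact: sNu.
Qed.

Variable r : 'M[int]_(m, n).
Hypothesis r_gens : ray_generators (@lineality K R n J) C r.
Let rv j : 'rV[R]_n := int_vec R (row j r).

Lemma wdotE w al : wdot w al = dot (\row_i (al i)%:R) w.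
Proof. by apply: eq_bigr => i _; rewrite mxE mulrC. Qed.

Lemma wdot_row j al : wdot (rv j) al = (rdot r j al)%:~R.
Proof.
rewrite /wdot /rdot rmorph_sum; apply: eq_bigr => i _ /=.
by rewrite !mxE rmorphM.
Qed.

Lemma row_in_cone j : C (rv j).
Proof.
by have [_ [rho [[f _ ->] _] []]] := r_gens.1 j.
Qed.

Lemma row_selects al be : D al -> be \in msupp (g al) -> rle (rweight r al) (rweight r be).
Proof.
move=> Dal beg j; rewrite !mxE -(ler_int R) -!wdot_row.
by have /coneP := row_in_cone j; apply.
Qed.

Let face_decomposition tau w : face C tau -> relint tau w ->
  exists lam : 'I_m -> R, (forall j, 0 <= lam j) /\ (forall j, 0 < lam j <-> tau (rv j)) /\
    lineality J (w - \sum_j lam j *: rv j).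
Proof.
apply: (@relint_face_decomposition _ _ k (fun i => int_vec R (l i))) => //.
- exact: lineality_coneP.
- by move=> j; case: (r_gens.1 j) => -[].
- exact: row_in_cone.
- by move=> rho /r_gens.2 [j [rho_j _]]; exists j.
Qed.

Definition face_point (tau : set 'rV[R]_n) (j : 'I_m) : K := (~~ `[< tau (rv j) >])%:R.

(** For a weight in the relative interior of [tau], a term of a normal form is
    initial when it has minimal weight for all rays of [tau]; these are the terms
    that survive when the parameters of these rays are set to 0 and the others
    to 1. *)
Lemma face_point_kron tau w al be : face C tau -> relint tau w -> D al ->
    be \in msupp (g al) ->
  \prod_j face_point tau j ^+ absz (rdot r j be - rdot r j al)%R =
  kron K (wdot w al) (wdot w be).
Proof.
move=> ftau wtau Dal beg; have [lam [lam_ge0 [lamtau Llam]]] := face_decomposition ftau wtau.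
have wE ga : wdot w ga = \sum_j lam j * (rdot r j ga)%:~R + wdot (w - \sum_j lam j *: rv j) ga.
  rewrite !wdotE dotBr dot_sumr addrC -addrA [X in _ + X](_ : _ = 0) ?addr0 //.
  rewrite addrC; apply/eqP; rewrite subr_eq0; apply/eqP; apply: eq_bigr => j _.
  by rewrite dotZr -wdotE wdot_row.
have lE : wdot (w - \sum_j lam j *: rv j) al = wdot (w - \sum_j lam j *: rv j) be.
  exact: ((linealityP Jg g_red JE _).1 Llam).
have rle_ab j : (rdot r j al)%:~R <= (rdot r j be)%:~R :> R.
  by have := row_selects Dal beg j; rewrite !mxE ler_int.
have [H|/existsNP[j /not_implyP[tj ne]]] :=
    pselect (forall j, tau (rv j) -> rdot r j al = rdot r j be).
  have -> : wdot w al = wdot w be.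
    rewrite !wE lE; congr (_ + _); apply: eq_bigr => j _.
    have := lam_ge0 j; rewrite le_eqVlt => /orP[/eqP <-|/lamtau /H -> //].
    by rewrite !mul0r.
  rewrite /kron eqxx; apply: big1 => j _; rewrite /face_point.
  by case: asboolP => [/H ->|_]; rewrite ?subrr ?expr0 // expr1n.
have lt_ab : wdot w al < wdot w be.
  rewrite !wE lE ltrD2r (bigD1 j) //= [X in _ < X](bigD1 j) //=; apply: ltr_leD.
    rewrite ltr_pM2l; last exact/lamtau.
    rewrite lt_neqAle rle_ab andbT; apply: contra_notN ne => /eqP E.
    exact: (mulrIz (oner_neq0 R)).
  by apply: ler_sum => i _; apply: ler_wpM2l.
rewrite /kron lt_eqF // (bigD1 j) //= /face_point asboolT //= expr0n absz_eq0 subr_eq0.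
by case: eqP => [/esym|]; rewrite ?mul0r.
Qed.

Lemma face_sub tau w : face C tau -> relint tau w -> C w.
Proof. by move=> [f _ ->] [[]]. Qed.

Lemma face_fibre tau : face C tau -> forall w, relint tau w ->
  fibre_eq d r J (face_point tau) (in_ideal w J).
Proof.
move=> ftau w wtau; have sw : selects D g w by apply/coneP; exact: face_sub wtau.
have tw al : torus_weight (fun=> 1 : K) al = 1.
  by rewrite /torus_weight big1 // => i _; rewrite expr1n.
pose h' := deform g idfun (wdot w) (@kron K R).
have h'_red : reduced D h' by exact: in_deform_reduced.
have IE := in_ideal_span Jg g_red JE sw.
have sp al be : D al -> be \in msupp (g al) ->
  (g al)@_be * (\prod_j face_point tau j ^+ absz (rdot r j be - rdot r j al)%R) *
    torus_weight (fun=> 1) be = torus_weight (fun=> 1) al * (h' al)@_be.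
  by move=> Dal beg; rewrite !tw mulr1 mul1r (face_point_kron ftau wtau) // twist_coef.
have one_neq0 (i : 'I_n) : (fun=> 1 : K) i != 0 by exact: oner_neq0.
have h'_supp al (_ : D al) : {subset msupp (h' al) <= msupp (g al)} by exact: twist_supp.
exists (fibre_map Jg g_red g_deg JE row_selects one_neq0 IE sp h'_supp).
  by apply: fibre_map_pullback => //; exact: deform_deg.
exact: fibre_map_emb.
Qed.

End GroebnerCone.

(** * The torus of the parameter space and the main result *)

Lemma field_point (K : fieldType) :
  exists p : Spec K, hprime (p : hpoint (triv_grading K) setT) = [set 0].
Proof.
have pP : prime_ideal [set (0 : K)].
  split=> [||a b]; last 1 first.
  - by move=> /eqP; rewrite mulf_eq0 => /orP[]/eqP; [left|right].
  - by split=> //= [a b -> ->|a b ->]; rewrite ?addr0 ?mulr0.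
  - by move=> /eqP; rewrite oner_eq0.
have hP : homogeneous (triv_grading K) [set (0 : K)].
  move=> j c hc /= c0 i; have [i0|/hc //] := posnP i.
  rewrite -c0 (bigD1 i) //= big1 ?addr0 // => a ai; apply: hc; rewrite lt0n.
  by apply: contra ai => /eqP a0; apply/eqP/val_inj; rewrite /= a0.
have rP : ~ (setT `<=` [set (0 : K)]) by move=> /(_ 1 I) /eqP; rewrite oner_eq0.
by exists (HPoint pP hP rP).
Qed.

(** [U] is the locus where the product of the coordinates does not vanish. *)
Lemma torus_open (K : fieldType) m : exists U : set (affine_space K m), [/\ open U, U !=set0 &
  forall a : 'I_m -> K, range (closed_point a) `<=` U -> forall j, a j != 0].
Proof.
have [p pE] := field_point K; pose q : {mpoly K[m]} := \prod_j 'X_j.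
have hq : homog_set (triv_grading {mpoly K[m]}) q by exists 0%N.
pose U : set (affine_space K m) :=
  [set y : hpoint (triv_grading {mpoly K[m]}) setT | ~ hprime y q].
have UE (a : 'I_m -> K) : U (closed_point a p) <-> \prod_j a j != 0.
  have qE : meval a q = \prod_j a j.
    by rewrite rmorph_prod; apply: eq_bigr => j _; rewrite /= mevalXU.
  have : hprime (closed_point a p : hpoint (triv_grading {mpoly K[m]}) setT) q <->
      \prod_j a j = 0 by rewrite -qE -[_ = 0]/([set 0] _) -pE.
  by move=> [H1 H2]; split=> [nU|/eqP n0 /H1 //]; apply/eqP => /H2.
exists U; split.
- exact: (open_D setT hq).
- exists (closed_point (fun=> 1) p); apply/UE.
  by rewrite big1 ?oner_neq0.
- move=> a aU j; have /UE/prodf_neq0/(_ j isT) // : U (closed_point a p).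
  by apply: aU; exists p.
Qed.

Theorem theorem3p14 (K : closedFieldType) (R : realType) (n m : nat)
    (n_gt0 : (0 < n)%N) (d : 'I_n -> nat) (d_gt0 : forall i, (0 < d i)%N)
    (J : ideal {mpoly K[n]}) (J_homog : homogeneous (wgrading K d) J)
    (C : set 'rV[R]_n) (C_max : maximal_cone J C)
    (le : term_order n)
    (le_compat : forall w, relint C w -> in_to_ideal le J = in_ideal w J)
    (r : 'M[int]_(m, n)) (r_gens : ray_generators (@lineality K R n J) C r) :
  (* (i) *)
  [/\ module_basis (R := {mpoly K[m]}) (S := Atilde r J)
        (fun c => qproj (Jtilde r J) c%:MP_[n])
        (standard_monomials le J) (fun al => qproj (Jtilde r J) 'X_[al]),
      is_pullback (wProj_struct K d) (affine_struct K m) (PxA_pr1 K m d) (PxA_pr2 K m d),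
      closed_immersion (total_emb d r J),
      (forall y : affine_space K m, exists x, PxA_pr2 K m d x = y) &
      flat_mor (pi_family d r J)]
  /\
  (* (ii) *)
  [/\ (forall tau, face C tau -> exists a : 'I_m -> K,
         forall w, relint tau w -> fibre_eq d r J a (in_ideal w J)),
      (exists U : set (affine_space K m), [/\ open U, U !=set0 &
         forall a : 'I_m -> K, range (closed_point a) `<=` U -> fibre_iso d r J a J]) &
      (forall tau, face C tau -> tau <> C -> exists a : 'I_m -> K,
         forall w, relint tau w -> fibre_iso d r J a (in_ideal w J))].
Proof.
have [[[k [l CE]] [w0 relintE]] _ _] := C_max.
have [g [Jg g_red g_deg JE]] := normal_forms le d_gt0 J_homog.
have r_sel := row_selects Jg g_red JE le_compat CE relintE r_gens.
have fibre tau := face_fibre Jg g_red g_deg JE le_compat CE relintE r_gens (tau := tau).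
split; split.
- have -> : standard_monomials le J = [set al | ~~ nonstandard le J al].
    apply/seteqP; split=> al /= nal; first by apply/negP => /asboolP.
    by move=> al_in; move/negP: nal; apply; apply/asboolP.
  exact: family_basis r_sel.
- exact: PxA_pullback.
- exact: Proj_quot_closed_immersion.
- by move=> y; exact: wProj_struct_surj.
- exact: family_flat r_sel.
- by move=> tau ftau; exists (face_point K r tau); exact: fibre.
- have [U [oU U0 Ua]] := torus_open K m; exists U; split=> // a /Ua.
  exact: generic_fibre r_sel a.
- move=> tau ftau _; exists (face_point K r tau) => w wtau.
  by have [i pi _] := fibre tau ftau w wtau; exists i.
Qed.
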